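(* Let $\sigma>d/2$ and let $\{X_j\}_{j=1}^n\subseteq\mathbb S^d$ be a sequence of quasi-uniform QMC designs for $H^\sigma(\mathbb S^d)$ with fill distances $\{h_j\}_{j=1}^n$ satisfying $c_\delta\delta h_j\le h_{j+1}\le\delta h_j$ for some $\delta\in(0,1)$ and $0<c_\delta\le1$. Let the scale parameters be $\rho_j=\nu h_j^{1/2}$ with $\nu>1$. Assume that the scaled zonal kernels $\varphi_\rho$ satisfy, with constants $c_1,c_2>0$ and $0<c_3\le c_4<\infty$ independent of $\ell$ and $\rho$, for all $0<\rho<\rho_0<1$: (i) $|1-\widehat{\varphi_\rho}(\ell)|\le c_1\ell^\sigma\rho^\sigma$ for $0\le\ell\le\ell_\rho:=\lfloor\rho^{-1}-1\rfloor$; (ii) $\widehat{\varphi_\rho}(\ell)\le c_2$ for $\ell>\ell_\rho$; (iii) $c_3(1+\rho\ell)^{-4\sigma}\le\widehat{\varphi_\rho}(\ell)\le c_4(1+\rho\ell)^{-4\sigma}$ for all $\ell>0$. Let $f\in H^\sigma(\mathbb S^d)$ and define the multilevel approximation by $\mathcal M_0f=0$, $\mathcal E_0f=f$ and, for $j=1,\dots,n$, $s_j=Q_{X_j,\rho_j}\mathcal E_{j-1}f$, $\mathcal M_jf=\mathcal M_{j-1}f+s_j$, $\mathcal E_jf=\mathcal E_{j-1}f-s_j$. Then there exists a constant $C>0$, independent of $n$, such that $$\|f-\mathcal M_nf\|_{L_2}\le C\,h_1^{\sigma/2}\,\beta^{n-1}\,\|f\|_{H^\sigma},$$ where $\beta=C_\nu\delta^{\sigma/2}$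 with $C_\nu=1+\nu^{-2\sigma}$.
   Context: $\mathbb S^d=\{x\in\mathbb R^{d+1}:\|x\|=1\}$ and $\mu$ is the rotationally invariant measure on $\mathbb S^d$, normalized so that $\mu(\mathbb S^d)=1$; $L_2=L_2(\mathbb S^d,\mu)$. $\{\mathcal Y_{\ell,k}:k=1,\dots,Z(d,\ell),\ \ell\ge0\}$ is an orthonormal basis of $L_2$ of spherical harmonics ($\mathcal Y_{\ell,k}$ of degree $\ell$; $Z(d,\ell)$ the dimension of the degree-$\ell$ space). $\widehat f_{\ell,k}=\int f\,\overline{\mathcal Y_{\ell,k}}\,d\mu$, and $H^\sigma(\mathbb S^d)$ is the space of $f\in L_2$ with $\|f\|_{H^\sigma}^2=\sum_{\ell,k}(1+\ell)^{2\sigma}|\widehat f_{\ell,k}|^2<\infty$. Scaled zonal kernel: let $\phi\in C[0,\infty]$, $\Phi_\rho(x)=\phi(\rho^{-1}\|x\|)$ on $\mathbb R^{d+1}$, $0<\rho<1$. Then $\varphi_\rho(x\cdot y)=\Lambda_{\phi,\rho}^{-1}\Phi_\rho(x-y)$ for $x,y\in\mathbb S^d$, where $\Lambda_{\phi,\rho}=\int_{\mathbb S^d}\Phi_\rho(x-y)\,d\mu(x)$. Its Fourier–Legendre coefficients are defined by $\varphi_\rho(x\cdot y)=\sum_{\ell\ge0}\widehat{\varphi_\rho}(\ell)\sum_{k=1}^{Z(d,\ell)}\mathcal Y_{\ell,k}(x)\mathcal Y_{\ell,k}(y)$. Quasi-interpolation operators: $Q_{X_j,\rho_j}g(x)=\frac1{|X_j|}\sum_{x_k\in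 X_j}g(x_k)\varphi_{\rho_j}(x\cdot x_k)$. The scale parameters $\rho_j$ lie in the range $(0,\rho_0)$ where the kernel assumptions hold. QMC designs: a sequence of finite sets $X\subset\mathbb S^d$ is a sequence of QMC designs for $H^\sigma(\mathbb S^d)$ if there is $C(\sigma,d)>0$, independent of $|X|$, with $\big|\frac1{|X|}\sum_{y\in X}g(y)-\int_{\mathbb S^d}g\,d\mu\big|\le C(\sigma,d)|X|^{-\sigma/d}\|g\|_{H^\sigma}$ for all $g\in H^\sigma(\mathbb S^d)$. Quasi-uniform: there is a constant $c_q\ge1$ with $q_j\le h_j\le c_qq_j$, where $q_j$ is the separation distance and $h_j$ the fill distance of $X_j$, and $|X_j|=\mathcal O(h_j^{-d})$ (with constants independent of $j$). *)

(* Defs.v *)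
From HB Require Import structures.
From mathcomp Require Import all_boot all_order all_algebra.
From mathcomp Require Import finmap all_classical all_reals all_analysis.
(* The notations of mpoly clash with those of mathcomp-analysis. *)
From mathcomp Require Import(canonicals, coercions) mpoly.

Set Implicit Arguments.
Unset Strict Implicit.
Unset Printing Implicit Defensive.

Import Order.TTheory GRing.Theory Num.Theory numFieldNormedType.Exports.

Local Open Scope classical_set_scope.
Local Open Scope ring_scope.

Section Sphere.
Context (R : realType) (d : nat).

Definition dotp (x y : 'rV[R]_d.+1) : R := \sum_i x 0 i * y 0 i.

(* The library norm on row vectors is the sup norm, hence this one. *)
Definition enorm (x : 'rV[R]_d.+1) : R := Num.sqrt (dotp x x).

Definition sphere : Type := [set x : 'rV[R]_d.+1 | enorm x = 1].

Definition sphere_val (x : sphere) : 'rV[R]_d.+1 := set_val x.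

Lemma delta_in_sphere :
  delta_mx 0 0 \in [set x : 'rV[R]_d.+1 | enorm x = 1].
Proof.
rewrite inE /= /enorm /dotp (bigD1 ord0) //= big1.
  by rewrite !mxE !eqxx mulr1 addr0 sqrtr1.
by move=> i i0; rewrite !mxE (negbTE i0) andbF mulr0.
Qed.

HB.instance Definition _ := Topological.copy sphere
  (set_type [set x : 'rV[R]_d.+1 | enorm x = 1]).
HB.instance Definition _ := isPointed.Build sphere (SigSub delta_in_sphere).
(* The Borel sigma-algebra. *)
HB.instance Definition _ := Measurable.copy sphere
  (g_sigma_algebraType (@open sphere)).

(* T ranges over the maps of the sphere induced by matrices in SO(d+1); for
   d >= 1 the only such probability measure is the normalized surface
   measure. *)
Definition rotation_invariant (mu : probability sphere R) : Prop :=
  forall (U : 'M[R]_d.+1) (T : sphere -> sphere),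
    U *m U^T = 1%:M -> \det U = 1 ->
    (forall x, sphere_val (T x) = sphere_val x *m U) ->
    forall A : set sphere, measurable A -> mu (T @^-1` A) = mu A.

Definition laplacian (p : mpoly.mpoly d.+1 R) : mpoly.mpoly d.+1 R :=
  \sum_i mpoly.mderiv i (mpoly.mderiv i p).

Definition spherical_harmonic (l : nat) (g : sphere -> R) : Prop :=
  exists p : mpoly.mpoly d.+1 R,
    [/\ p \is mpoly.ishomog1 l mpoly.mdeg,
        laplacian p = 0
      & forall x, g x = mpoly.meval (fun i => sphere_val x 0 i) p].

(* The geodesic distance. *)
Definition geodist (x y : sphere) : R :=
  acos (dotp (sphere_val x) (sphere_val y)).

Definition fill_distance (X : {fset sphere}) : R :=
  sup [set inf [set geodist x y | y in [set` X]] | x in setT].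

Definition separation_distance (X : {fset sphere}) : R :=
  inf [set geodist p.1 p.2 |
       p in [set p : sphere * sphere |
              [/\ p.1 \in X, p.2 \in X & p.1 != p.2]]] / 2.

(* The constants are arguments, to express that they do not depend on j when
   the bounds are required of every X j. *)
Definition quasi_uniform (cq cX : R) (X : {fset sphere}) : Prop :=
  [/\ separation_distance X <= fill_distance X,
      fill_distance X <= cq * separation_distance X
    & #|` X|%:R <= cX * (fill_distance X ^+ d)^-1].

End Sphere.

Section HarmonicAnalysis.
Context (R : realType) (d : nat) (mu : probability (sphere R d) R).
Context (Z : nat -> nat) (Y : forall l, 'I_(Z l) -> sphere R d -> R).
Implicit Types f g : sphere R d -> R.

Definition fourier_coef f (l : nat) (k : 'I_(Z l)) : R :=
  \int[mu]_x (f x * Y k x).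

Definition fourier_partial f (N : nat) : sphere R d -> R :=
  fun x => \sum_(l < N) \sum_(k < Z l) fourier_coef f k * Y k x.

(* Real-valued spherical harmonics; the third clause, with orthonormality,
   makes Z l the dimension of the space of harmonics of degree l. *)
Definition harmonic_basis : Prop :=
  [/\ forall l (k : 'I_(Z l)), spherical_harmonic l (Y k),
      forall l (k : 'I_(Z l)) l' (k' : 'I_(Z l')),
        \int[mu]_x (Y k x * Y k' x)
        = ((l == l') && (k == k' :> nat))%:R,
      forall l g, spherical_harmonic l g ->
        exists c : 'I_(Z l) -> R,
          forall x, g x = \sum_(k < Z l) c k * Y k x
    & forall f, f \in Lfun mu 2%:E ->
        (fun N => Lnorm mu 2%:E (EFin \o (f \- fourier_partial f N)))
          @ \oo --> 0%E].

Definition sobolev_sqnorm (sigma : R) f : \bar R :=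
  (\sum_(0 <= l <oo)
     (\sum_(k < Z l) (1 + l%:R) `^ (2 * sigma) * `|fourier_coef f k| ^+ 2)%:E)%E.

Definition sobolev_norm (sigma : R) f : R :=
  Num.sqrt (fine (sobolev_sqnorm sigma f)).

(* Continuity selects the representative whose point values are used; each
   class has exactly one when sigma > d / 2 (Sobolev embedding). *)
Definition sobolev (sigma : R) : set (sphere R d -> R) :=
  [set f | [/\ f \in Lfun mu 2%:E, (sobolev_sqnorm sigma f < +oo)%E
             & continuous f]].

(* K is an argument, to express that it does not depend on X. *)
Definition qmc_design (sigma K : R) (X : {fset sphere R d}) : Prop :=
  forall g, sobolev sigma g ->
    `| #|` X|%:R^-1 * (\sum_(y <- X) g y) - \int[mu]_x g x |
    <= K * #|` X|%:R `^ (- (sigma / d%:R)) * sobolev_norm sigma g.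

Definition scaled_rbf (phi : R -> R) (rho : R) (z : 'rV[R]_d.+1) : R :=
  phi (rho^-1 * enorm z).

(* Independent of y when mu is rotation invariant. *)
Definition zonal_mass (phi : R -> R) (rho : R) (y : sphere R d) : R :=
  \int[mu]_x scaled_rbf phi rho (sphere_val x - sphere_val y).

Definition zonal_kernel (phi : R -> R) (rho : R) (x y : sphere R d) : R :=
  (zonal_mass phi rho y)^-1 * scaled_rbf phi rho (sphere_val x - sphere_val y).

Definition fourier_legendre (ker : sphere R d -> sphere R d -> R)
    (a : nat -> R) : Prop :=
  forall x y, (fun N => \sum_(l < N) a l * \sum_(k < Z l) Y k x * Y k y)
                @ \oo --> ker x y.

End HarmonicAnalysis.

Section Multilevel.
Context (R : realType) (d : nat).

Definition quasi_interp (ker : sphere R d -> sphere R d -> R)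
    (X : {fset sphere R d}) (g : sphere R d -> R) : sphere R d -> R :=
  fun x => #|` X|%:R^-1 * \sum_(y <- X) g y * ker x y.

Definition scale (nu : R) (X : nat -> {fset sphere R d}) (j : nat) : R :=
  nu * Num.sqrt (fill_distance (X j)).

Context (Q : nat -> (sphere R d -> R) -> sphere R d -> R).

(* The pair (M_j f, E_j f). *)
Fixpoint multilevel (f : sphere R d -> R) (j : nat) :
    (sphere R d -> R) * (sphere R d -> R) :=
  if j is j'.+1 then
    let: (Mf, Ef) := multilevel f j' in
    let s := Q j Ef in (Mf \+ s, Ef \- s)
  else (cst 0, f).

Definition multilevel_approx f j := (multilevel f j).1.

End Multilevel.

(* Main.v *)
(* Write a quasi-interpolation error operator as E = (1 - T) + D, where T is the
   convolution with the kernel, i.e. the multiplier phihat, and D collects the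
   quadrature errors.  By duality, D is bounded through the QMC property applied
   to the products g * Y_(l,k).  These satisfy a tame product estimate in
   H^sigma, because the degrees of two factors and of a component of their
   product obey the triangle inequality.  Hence D gains a factor
   rho^(sigma - tau), for d/2 < tau < sigma, over the trivial bound; as the rho_j
   decay geometrically, these gains are summable.  The multiplier |1 - phihat|
   may exceed 1 only for l rho bounded and bounded below, a window which each
   degree meets at boundedly many levels, so a weight in the variable rho_j l
   absorbs it.  Thus the H^sigma norms of all the residuals are bounded by a
   multiple of that of f.  The last level then gains rho_n^sigma =
   nu^sigma h_n^(sigma/2), and h_n <= delta^(n-1) h_1. *)
Require Import Defs.
From mathcomp Require Import all_boot all_order all_algebra.
From mathcomp Require Import finmap all_classical all_reals all_analysis.
From mathcomp Require Import measurable_realfun.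
From mathcomp Require Import(canonicals, coercions) mpoly.
From mathcomp Require Import ring lra.
Set Implicit Arguments.
Unset Strict Implicit.
Unset Printing Implicit Defensive.
Import Order.TTheory GRing.Theory Num.Theory numFieldNormedType.Exports.
Local Open Scope classical_set_scope.
Local Open Scope ring_scope.

(** * Decomposition of homogeneous polynomials into harmonic ones *)

(** The obstacle is the top norm. As rho^2 = nu^2 h, the QMC rate h^sigma is of order rho^(2 sigma).
    Its square rho^(4 sigma) is used up entirely when the quadrature errors are measured in H^sigma
    and the test function also carries sigma derivatives: no power of rho is left. In the tame
    estimate, however, this critical term contains only the H^tau norm of the current error, and for
    tau < sigma the previous level has already made that norm small. So two norms are propagated
    together, and Young's inequality with parameter theta_j = rho_j^(sigma - tau) turns each step
    into a factor 1 + O(theta_j), whose product converges. The condition tau > d/2 provides the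
    embedding constant [A]: the reproducing kernels are constant on the diagonal by rotation
    invariance, a dimension count of order L^d bounds them, and dyadic summation does the rest. The
    QMC rate being expressed in |X|, a lower bound of |X| by a multiple of h^(-d) is also needed; it
    comes from the covering property. *)

Section HarmonicDecomposition.
Context (R : realType) (d : nat).
Local Notation poly := (mpoly.mpoly d.+1 R).
Local Notation Var i := (mpoly.mpolyX R (mpoly.mnm1 i)).
Local Notation "n .-homog" := (mpoly.ishomog1 n mpoly.mdeg).
Implicit Types p q : poly.

Definition sqradius : poly := \sum_i Var i * Var i.

Lemma mderiv_homog0 (i : 'I_d.+1) p : p \is 0.-homog -> mpoly.mderiv i p = 0.
Proof.
move=> p_hom; apply/mpoly.mpolyP => m; rewrite mpoly.mcoeff_mderiv mpoly.mcoeff0.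
rewrite (mpoly.dhomog_nemf_coeff p_hom) ?mul0rn//.
by rewrite /= mpoly.mdegD mpoly.mdeg1 addn1.
Qed.

Lemma mderiv_homog (i : 'I_d.+1) n p :
  p \is n.-homog -> mpoly.mderiv i p \is n.-1.-homog.
Proof.
move=> p_hom; apply/mpoly.dhomogP => m.
rewrite mpoly.mcoeff_msupp mpoly.mcoeff_mderiv.
apply: contra_neq_eq => mn; rewrite (mpoly.dhomog_nemf_coeff p_hom) ?mul0rn//.
rewrite /= mpoly.mdegD mpoly.mdeg1 addn1; apply: contra_neq mn => <-//.
Qed.

Lemma laplacian_homog n p : p \is n.-homog -> laplacian p \is n.-2.-homog.
Proof.
by move=> p_hom; apply: rpred_sum => i _; do 2!apply: mderiv_homog.
Qed.

Lemma laplacian_homog_eq0 n p : (n < 2)%N -> p \is n.-homog -> laplacian p = 0.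
Proof.
case: n => [|[|//]] _ p_hom; apply: big1 => i _.
  by rewrite (mderiv_homog0 _ p_hom) mpoly.mderiv0.
by apply: mderiv_homog0; exact: (mderiv_homog i p_hom).
Qed.

Lemma laplacian_is_linear : linear (@laplacian R d).
Proof.
move=> a p q; rewrite /laplacian scaler_sumr -big_split/=; apply: eq_bigr => i _.
by rewrite !(mpoly.mderivD, mpoly.mderivZ).
Qed.

Lemma laplacianD p q : laplacian (p + q) = laplacian p + laplacian q.
Proof. by have := laplacian_is_linear 1 p q; rewrite !scale1r. Qed.

Lemma laplacianZ a p : laplacian (a *: p) = a *: laplacian p.
Proof.
have := laplacian_is_linear a p 0; rewrite !addr0 => ->.
have -> : laplacian (0 : poly) = 0; last by rewrite addr0.
by apply: big1 => i _; rewrite !mpoly.mderiv0.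
Qed.

Lemma iter_laplacianZ k a p :
  iter k (@laplacian R d) (a *: p) = a *: iter k (@laplacian R d) p.
Proof. by elim: k => //= k ->; rewrite laplacianZ. Qed.

Lemma iter_laplacianB k p q : iter k (@laplacian R d) (p - q) =
  iter k (@laplacian R d) p - iter k (@laplacian R d) q.
Proof.
by elim: k => //= k ->; rewrite laplacianD -scaleN1r laplacianZ scaleN1r.
Qed.

(** Euler's identity, checked on monomials: x_i d_i multiplies a monomial by its i-th exponent, and
    the exponents add up to [n]. *)
Lemma euler_homog n p : p \is n.-homog ->
  \sum_i Var i * mpoly.mderiv i p = n%:R *: p.
Proof.
move=> p_hom.
rewrite [in LHS](mpoly.mpolyE p) [in RHS](mpoly.mpolyE p) scaler_sumr.
under eq_bigr => i _ do rewrite raddf_sum mulr_sumr.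
rewrite exchange_big/=; apply: eq_big_seq => m m_supp.
have <- : mpoly.mdeg m = n by apply: (mpoly.dhomogP _ _ _ p_hom).
rewrite mpoly.mdegE natr_sum scaler_suml; apply: eq_bigr => i _.
rewrite mpoly.mderivZ mpoly.mderivX scalerA mulrC -scalerAl mulrC mulr_natl.
have [mi0|mi_gt0] := posnP (m i); first by rewrite mi0 mulr0n !scale0r.
rewrite scalerA mulr_natl; congr (_ *: _).
rewrite -mpoly.mpolyXD mpoly.submK//.
by rewrite mpoly.lep1mP -lt0n.
Qed.

Lemma laplacianM p q : laplacian (p * q) =
  laplacian p * q + 2 *: (\sum_i mpoly.mderiv i p * mpoly.mderiv i q)
  + p * laplacian q.
Proof.
rewrite /laplacian mulr_suml mulr_sumr scaler_sumr -!big_split/=.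
apply: eq_bigr => i _.
rewrite mpoly.mderivM mpoly.mderivD !mpoly.mderivM scaler_nat; ring.
Qed.

Lemma mderivU (i j : 'I_d.+1) : mpoly.mderiv i (Var j) = (i == j)%:R.
Proof.
rewrite mpoly.mderivX mpoly.mnm1E; case: (eqVneq j i) => [->|ji]; last first.
  by rewrite scale0r.
rewrite scale1r -[X in mpoly.mnm_sub X _](mpoly.add0m (mpoly.mnm1 i)).
by rewrite mpoly.addmK mpoly.mpolyX0.
Qed.

Lemma mderiv_sqradius (i : 'I_d.+1) : mpoly.mderiv i sqradius = 2 *: Var i.
Proof.
rewrite raddf_sum (bigD1 i)//= big1 => [|j ji].
  by rewrite mpoly.mderivM mderivU eqxx addr0 mul1r mulr1 scaler_nat mulr2n.
by rewrite mpoly.mderivM mderivU eq_sym (negbTE ji) mul0r mulr0 addr0.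
Qed.

Lemma laplacian_sqradius : laplacian sqradius = (2 * d.+1)%:R.
Proof.
rewrite /laplacian.
under eq_bigr => i _ do rewrite mderiv_sqradius mpoly.mderivZ mderivU eqxx.
by rewrite sumr_const card_ord scaler_nat -mulrnA.
Qed.

Lemma sqradius_homog : sqradius \is 2.-homog.
Proof.
apply: rpred_sum => i _; rewrite -mpoly.mpolyXD mpoly.dhomogX.
by rewrite /= mpoly.mdegD mpoly.mdeg1.
Qed.

Lemma sqradiusX_homog k n p : p \is n.-homog ->
  sqradius ^+ k * p \is (2 * k + n).-homog.
Proof.
move=> p_hom; apply: mpoly.dhomogM => //; apply: mpoly.dhomogMn.
exact: sqradius_homog.
Qed.

(** The gradient of |x|^2 is 2x, so the cross term of the Leibniz formula is 4 times Euler's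
    operator and contributes [4 * n]. *)
Lemma laplacian_sqradiusM n p : p \is n.-homog ->
  laplacian (sqradius * p) =
  (2 * d.+1 + 4 * n)%:R *: p + sqradius * laplacian p.
Proof.
move=> p_hom; rewrite laplacianM laplacian_sqradius; congr (_ + _).
under eq_bigr => i _ do rewrite mderiv_sqradius -scalerAl.
rewrite -scaler_sumr (euler_homog p_hom) !scalerA -!natrM natrD scalerDl.
by rewrite mulr_natl -scaler_nat.
Qed.

(** The constants of [laplacian_sqradiusM] add up along the induction. Their positivity permits the
    division in the decomposition below. *)
Lemma laplacian_sqradiusX n p : p \is n.-homog -> laplacian p = 0 ->
  forall k, exists2 c : R, 0 < c &
    laplacian (sqradius ^+ k.+1 * p) = c *: (sqradius ^+ k * p).
Proof.
move=> p_hom p_harm; elim=> [|k [c c_gt0 IHk]].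
  exists (2 * d.+1 + 4 * n)%:R; first by rewrite ltr0n addn_gt0.
  by rewrite expr1 expr0 mul1r (laplacian_sqradiusM p_hom) p_harm mulr0 addr0.
exists ((2 * d.+1 + 4 * (2 * k.+1 + n))%:R + c).
  by rewrite addr_gt0// ltr0n addn_gt0.
rewrite exprS -mulrA (laplacian_sqradiusM (sqradiusX_homog _ p_hom)) IHk.
by rewrite scalerDl -scalerAr mulrA -exprS.
Qed.

Lemma iter_laplacian_sqradiusX n p : p \is n.-homog -> laplacian p = 0 ->
  forall k, exists2 c : R, 0 < c &
    iter k (@laplacian R d) (sqradius ^+ k * p) = c *: p.
Proof.
move=> p_hom p_harm; elim=> [|k [c c_gt0 IHk]].
  by exists 1 => //; rewrite expr0 mul1r scale1r.
have [c' c'_gt0 lapE] := laplacian_sqradiusX p_hom p_harm k.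
exists (c' * c); first exact: mulr_gt0.
by rewrite iterSr lapE iter_laplacianZ IHk scalerA.
Qed.

Lemma iter_laplacian_homog k n p : p \is n.-homog ->
  iter k (@laplacian R d) p \is (n - 2 * k).-homog.
Proof.
move=> p_hom; elim: k => [|k IHk]; first by rewrite muln0 subn0.
rewrite iterS mulnS [(2 + _)%N]addnC subnDA subn2.
exact: laplacian_homog.
Qed.

(* By induction on the order m of nilpotency of the Laplacian at p: for
   h = Delta^(m-1) p, which is harmonic, p - c^-1 |x|^(2(m-1)) h is killed by
   Delta^(m-1). *)
Lemma harmonic_decomposition_iter n m p : p \is n.-homog ->
  (2 * m <= n + 2)%N -> iter m (@laplacian R d) p = 0 ->
  exists h : nat -> poly,
    (forall i, (i < m)%N -> h i \is (n - 2 * i).-homog /\ laplacian (h i) = 0)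
    /\ p = \sum_(i < m) sqradius ^+ i * h i.
Proof.
elim: m p => [|m IHm] p p_hom mn lap0.
  by exists (fun=> 0); split => //; rewrite big_ord0.
set h := iter m (@laplacian R d) p.
have h_hom : h \is (n - 2 * m).-homog by exact: iter_laplacian_homog.
have h_harm : laplacian h = 0 by exact: lap0.
have [c c_gt0 hE] := iter_laplacian_sqradiusX h_hom lap0 m.
have mn' : (2 * m <= n)%N by rewrite mulnS addnC leq_add2r in mn.
have [|||h' [h'P h'E]] := IHm (p - c^-1 *: (sqradius ^+ m * h)).
- apply: rpredB => //; apply: mpoly.dhomogZ.
  by rewrite -[X in X.-homog](subnKC mn'); exact: sqradiusX_homog.
- by rewrite (leq_trans mn')// leq_addr.
- by rewrite iter_laplacianB iter_laplacianZ hE scalerA mulVf ?gt_eqF// scale1r subrr.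
exists (fun i => if (i == m)%N then c^-1 *: h else h' i); split => [i|].
  rewrite ltnS leq_eqVlt; case: eqP => [->|/eqP im] /= ltim; last first.
    exact: h'P.
  by split; [exact: mpoly.dhomogZ|rewrite laplacianZ h_harm scaler0].
rewrite big_ord_recr/= eqxx -scalerAr; apply/eqP; rewrite -subr_eq h'E.
by apply/eqP; apply: eq_bigr => i _; rewrite ltn_eqF.
Qed.

(** After [n./2] Laplacians the degree is at most 1, so one more kills [p]. *)
Lemma harmonic_decomposition n p : p \is n.-homog ->
  exists h : nat -> poly,
    (forall i, (i < n./2.+1)%N -> h i \is (n - 2 * i).-homog /\ laplacian (h i) = 0)
    /\ p = \sum_(i < n./2.+1) sqradius ^+ i * h i.
Proof.
move=> p_hom.
have n2 : (2 * n./2 <= n)%N by rewrite mul2n -[leqRHS]odd_double_half leq_addl.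
apply: harmonic_decomposition_iter => //.
  by rewrite mulnS addnC leq_add2r.
rewrite iterS; apply: laplacian_homog_eq0 (iter_laplacian_homog _ p_hom).
by rewrite ltn_subLR// -[ltnLHS]odd_double_half mul2n addnC ltn_add2l; case: odd.
Qed.

End HarmonicDecomposition.

(** * Polynomial functions on the sphere *)

Section PolynomialFunctions.
Context (R : realType) (d : nat).
Local Notation "n .-homog" := (mpoly.ishomog1 n mpoly.mdeg).

Definition crd (i : 'I_d.+1) (x : sphere R d) : R := sphere_val x 0 i.

Lemma sum_crd2 x : \sum_i crd i x ^+ 2 = 1.
Proof.
have := set_valP x; rewrite /= /enorm => x1.
have : Num.sqrt (dotp (sphere_val x) (sphere_val x)) ^+ 2 = 1.
  by rewrite x1 expr1n.
rewrite sqr_sqrtr => [<-|]; first by apply: eq_bigr => i _; rewrite expr2.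
by apply: sumr_ge0 => i _; rewrite -expr2 sqr_ge0.
Qed.

Lemma crd_le1 i x : `|crd i x| <= 1.
Proof.
rewrite -(@ler_pXn2r _ 2)// ?nnegrE// expr1n -normrX ger0_norm ?sqr_ge0//.
rewrite -(sum_crd2 x) (bigD1 i)//= lerDl.
by apply: sumr_ge0 => j _; exact: sqr_ge0.
Qed.

(* Restrictions to the sphere of polynomials of degree at most n. *)
Inductive polyfn : nat -> (sphere R d -> R) -> Prop :=
| polyfn_cst c : polyfn 0 (fun=> c)
| polyfn_crd i n g : polyfn n g -> polyfn n.+1 (fun x => crd i x * g x)
| polyfnD n f g : polyfn n f -> polyfn n g -> polyfn n (fun x => f x + g x)
| polyfnS n g : polyfn n g -> polyfn n.+1 g.

Lemma polyfn_leq m n g : (m <= n)%N -> polyfn m g -> polyfn n g.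
Proof.
move=> /subnKC <- g_poly; elim: (n - m)%N => [|k IHk]; first by rewrite addn0.
by rewrite addnS; exact: polyfnS.
Qed.

Lemma polyfn_cstn n c : polyfn n (fun=> c).
Proof. exact: polyfn_leq (polyfn_cst c). Qed.

Lemma polyfnZ n a g : polyfn n g -> polyfn n (fun x => a * g x).
Proof.
elim=> {n g} [c|i n g _ IH|n f g _ IHf _ IHg|n g _ IH].
- exact: polyfn_cst.
- under eq_fun do rewrite mulrCA.
  exact: polyfn_crd.
- under eq_fun do rewrite mulrDr.
  exact: polyfnD.
- exact: polyfnS.
Qed.

Lemma polyfnM m n f g :
  polyfn m f -> polyfn n g -> polyfn (m + n) (fun x => f x * g x).
Proof.
move=> f_poly g_poly.
elim: f_poly => {m f} [c|i m f _ IH|m f f' _ IHf _ IHf'|m f _ IH].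
- exact: polyfnZ.
- under eq_fun do rewrite -mulrA.
  exact: polyfn_crd.
- under eq_fun do rewrite mulrDl.
  exact: polyfnD.
- exact: polyfnS.
Qed.

Lemma polyfn_sum (I : Type) (r : seq I) (P : pred I) n (F : I -> sphere R d -> R) :
  (forall i, P i -> polyfn n (F i)) -> polyfn n (fun x => \sum_(i <- r | P i) F i x).
Proof.
move=> F_poly; elim: r => [|i r IHr].
  by under eq_fun do rewrite big_nil; exact: polyfn_cstn.
under eq_fun do rewrite big_cons.
case: (boolP (P i)) => Pi//; apply: polyfnD => //; exact: F_poly.
Qed.

Lemma polyfn_crdX i n : polyfn n (fun x => crd i x ^+ n).
Proof.
elim: n => [|n IHn]; first by under eq_fun do rewrite expr0; exact: polyfn_cst.
by under eq_fun do rewrite exprS; exact: polyfn_crd.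
Qed.

Lemma polyfn_prod (I : Type) (r : seq I) (n : I -> nat)
    (F : I -> sphere R d -> R) : (forall i, polyfn (n i) (F i)) ->
  polyfn (\sum_(i <- r) n i) (fun x => \prod_(i <- r) F i x).
Proof.
move=> F_poly; elim: r => [|i r IHr].
  rewrite big_nil (_ : (fun x => _) = fun=> 1); first exact: polyfn_cst.
  by apply/funext => x; rewrite big_nil.
rewrite big_cons (_ : (fun x => _) = fun x => F i x * \prod_(j <- r) F j x).
  exact: polyfnM.
by apply/funext => x; rewrite big_cons.
Qed.

Lemma polyfn_meval n (p : mpoly.mpoly d.+1 R) : p \is n.-homog ->
  polyfn n (fun x => mpoly.meval (crd^~ x) p).
Proof.
move=> p_hom; under eq_fun do rewrite mpoly.mevalE big_seq.
apply: polyfn_sum => m m_supp; apply: polyfnZ.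
have <- : mpoly.mdeg m = n by apply: (mpoly.dhomogP _ _ _ p_hom).
rewrite mpoly.mdegE; apply: polyfn_prod => i; exact: polyfn_crdX.
Qed.

(** Passage from functions back to polynomials, sorted by degree so that [harmonic_decomposition]
    applies to each part. *)
Lemma polyfn_homog n g : polyfn n g ->
  exists2 p : nat -> mpoly.mpoly d.+1 R, (forall i, p i \is i.-homog) &
    forall x, g x = \sum_(i < n.+1) mpoly.meval (crd^~ x) (p i).
Proof.
elim=> {n g} [c|i n g _ [p p_hom gE]|n f g _ [p p_hom fE] _ [q q_hom gE]
  |n g _ [p p_hom gE]].
- exists (fun i => if i == 0%N then mpoly.mpolyC _ c else 0) => [[|i]|x]/=.
  + by rewrite -mpoly.alg_mpolyC; apply: mpoly.dhomogZ; exact: mpoly.dhomog1.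
  + exact: mpoly.dhomog0.
  + by rewrite big_ord_recl big_ord0/= mpoly.mevalC addr0.
- exists (fun j => if j is j'.+1 then
      mpoly.mpolyX R (mpoly.mnm1 i) * p j' else 0) => [[|j]|x].
  + exact: mpoly.dhomog0.
  + apply: (@mpoly.dhomogM _ _ _ 1 _ j) => //.
    by rewrite mpoly.dhomogX /= mpoly.mdeg1.
  + rewrite big_ord_recl/= mpoly.meval0 add0r gE mulr_sumr.
    by apply: eq_bigr => j _; rewrite mpoly.mevalM mpoly.mevalXU.
- exists (fun i => p i + q i) => [i|x]; first exact: mpoly.dhomogD.
  rewrite fE gE -big_split/=; apply: eq_bigr => i _.
  by rewrite mpoly.mevalD.
- exists (fun i => if (i <= n)%N then p i else 0) => [i|x].
    by case: ifP => // _; exact: mpoly.dhomog0.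
  rewrite big_ord_recr/= ltnn mpoly.meval0 addr0 gE.
  by apply: eq_bigr => i _; rewrite -ltnS ltn_ord.
Qed.

Lemma spherical_harmonic_polyfn l g : spherical_harmonic l g -> polyfn l g.
Proof.
move=> [p [p_hom _ gE]].
by rewrite (funext gE : g = _); exact: polyfn_meval.
Qed.

Lemma meval_sqradius x : mpoly.meval (crd^~ x) (sqradius R d) = 1.
Proof.
rewrite /sqradius raddf_sum/= -(sum_crd2 x); apply: eq_bigr => i _.
by rewrite mpoly.mevalM mpoly.mevalXU expr2.
Qed.

Section Span.
Context (Z : nat -> nat) (Y : forall l, 'I_(Z l) -> sphere R d -> R).
Hypothesis Y_spans : forall l g, spherical_harmonic l g ->
  exists c : 'I_(Z l) -> R, forall x, g x = \sum_(k < Z l) c k * Y k x.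

Definition harm_sum L (c : forall l, 'I_(Z l) -> R) (x : sphere R d) : R :=
  \sum_(l < L) \sum_(k < Z l) c l k * Y k x.

Definition harm_span L (g : sphere R d -> R) :=
  exists c, forall x, g x = harm_sum L c x.

Lemma harm_span_leq m n g : (m <= n)%N -> harm_span m g -> harm_span n g.
Proof.
move=> mn [c gE]; exists (fun l k => if (l < m)%N then c l k else 0) => x.
rewrite gE /harm_sum (big_ord_widen _ (fun l => \sum_(k < Z l) c l k * Y k x) mn).
rewrite big_mkcond; apply: eq_bigr => l _; case: ifP => // _.
by rewrite big1// => k _; rewrite mul0r.
Qed.

Lemma harm_span_sum L (I : Type) (r : seq I) (P : pred I)
    (F : I -> sphere R d -> R) :
  (forall i, P i -> harm_span L (F i)) ->
  harm_span L (fun x => \sum_(i <- r | P i) F i x).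
Proof.
move=> F_span; elim: r => [|i r [c cE]].
  exists (fun _ _ => 0) => x; rewrite big_nil /harm_sum big1// => l _.
  by rewrite big1// => k _; rewrite mul0r.
case: (boolP (P i)) => Pi; last first.
  by exists c => x; rewrite big_cons (negbTE Pi) cE.
have [c' c'E] := F_span i Pi; exists (fun l k => c' l k + c l k) => x.
rewrite big_cons Pi cE c'E /harm_sum -big_split/=; apply: eq_bigr => l _.
by rewrite -big_split/=; apply: eq_bigr => k _; rewrite mulrDl.
Qed.

Lemma spherical_harmonic_span l g : spherical_harmonic l g -> harm_span l.+1 g.
Proof.
move=> /Y_spans[c gE].
(* The coefficients form a dependent family over all degrees; those of [g], indexed by ['I_(Z l)],
   are transported along [l' = l]. *)
exists (fun l' => if eqVneq l' l is EqNotNeq e then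
   (fun k => c (cast_ord (f_equal Z e) k)) else (fun=> 0)) => x.
rewrite /harm_sum big_ord_recr/= big1 => [|i _]; last first.
  case: eqVneq => [il|_]; last by rewrite big1// => k _; rewrite mul0r.
  by exfalso; move: (ltn_ord i); rewrite il ltnn.
rewrite add0r gE; case: eqVneq => [e|/eqP//].
by apply: eq_bigr => k _; congr (c _ * _); apply: val_inj.
Qed.

(** In the decomposition of each homogeneous part the factors |x|^(2j) are 1 on the sphere, so only
    harmonics of degree at most [n] remain. *)
Lemma polyfn_span n g : polyfn n g -> harm_span n.+1 g.
Proof.
move=> /polyfn_homog[p p_hom gE].
rewrite (funext gE : g = _).
apply: harm_span_sum => i _.
have [h [hP pE]] := harmonic_decomposition (p_hom i).
rewrite (_ : (fun x => _) =
    (fun x => \sum_(j < i./2.+1) mpoly.meval (crd^~ x) (h j))); last first.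
  apply/funext => x; rewrite pE raddf_sum/=; apply: eq_bigr => j _.
  by rewrite mpoly.mevalM rmorphXn/= meval_sqradius expr1n mul1r.
apply: harm_span_sum => j _; have [hj_hom hj_harm] := hP j (ltn_ord j).
apply: (@harm_span_leq (i - 2 * j).+1).
  by rewrite ltnS (leq_trans (leq_subr _ _))// -ltnS.
by apply: spherical_harmonic_span; exists (h j).
Qed.

End Span.
End PolynomialFunctions.

(** Independence of the [F t] gives their coordinate matrix in [b] a trivial left kernel, hence full
    row rank, and the rank is at most the number of columns. *)
Lemma leq_card_span (R : fieldType) (U : Type) (T S : finType)
    (F : T -> U -> R) (b : S -> U -> R) :
  (forall t, exists m : S -> R, forall x, F t x = \sum_s m s * b s x) ->
  (forall v : T -> R, (forall x, \sum_t v t * F t x = 0) -> forall t, v t = 0) ->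
  (#|T| <= #|S|)%N.
Proof.
move=> /boolp.choice[m mE] F_free.
pose M : 'M[R]_(#|T|, #|S|) := \matrix_(i, j) m (enum_val i) (enum_val j).
suff : row_free M by rewrite -row_leq_rank => /leq_trans; apply; exact: rank_leq_col.
apply: inj_row_free => v vM0.
have v0 : forall t, v 0 (enum_rank t) = 0.
  apply: F_free => x; under eq_bigr => t _ do rewrite mE mulr_sumr.
  rewrite exchange_big big1//= => s _.
  under eq_bigr => t _ do rewrite mulrA.
  rewrite -mulr_suml (_ : \sum_t _ = 0) ?mul0r//.
  transitivity ((v *m M) 0 (enum_rank s)); last by rewrite vM0 mxE.
  rewrite mxE [RHS](reindex (@enum_rank T))/=; last first.
    by exists enum_val => t _; [exact: enum_rankK|exact: enum_valK].
  by apply: eq_bigr => t _; rewrite mxE !enum_rankK.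
by apply/rowP => i; rewrite mxE -(v0 (enum_val i)) enum_valK.
Qed.

(** * Dimension of the spaces of polynomial functions on the sphere *)

Section PolynomialDimension.
Context (R : realType) (d : nat).

Definition tail_crd (x : sphere R d) (i : 'I_d) : R := crd (lift ord0 i) x.

(* On the sphere the square of the first coordinate is a polynomial in the
   others. *)
Lemma polyfn_tail n (g : sphere R d -> R) : polyfn n g ->
  exists A B : mpoly.mpoly d R,
    [/\ (mpoly.mmeasure mpoly.mdeg A <= n.+1)%N,
        (mpoly.mmeasure mpoly.mdeg B <= n)%N
      & forall x, g x = mpoly.meval (tail_crd x) A
                        + crd ord0 x * mpoly.meval (tail_crd x) B].
Proof.
(* [mmeasure] is the degree plus one, and 0 for the zero polynomial: [A] has degree at most [n], and
   [B] less than [n]. *)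
have sizeXM (i : 'I_d) k p : (mpoly.mmeasure mpoly.mdeg p <= k)%N ->
    (mpoly.mmeasure mpoly.mdeg (mpoly.mpolyX R (mpoly.mnm1 i) * p) <= k.+1)%N.
  move=> pk; have [->|p0] := eqVneq p 0; first by rewrite mulr0 mpoly.mmeasure0.
  rewrite mpoly.msizeM//; last first.
    by rewrite -mpoly.msize_poly_eq0 mpoly.msizeX.
  by rewrite mpoly.msizeX mpoly.mdeg1.
elim=> {n g} [c|i n g _ [A [B [szA szB gE]]]
  |n f g _ [A [B [szA szB fE]]] _ [A' [B' [szA' szB' gE]]]
  |n g _ [A [B [szA szB gE]]]].
- exists (mpoly.mpolyC d c), 0; split; rewrite ?mpoly.mmeasure0//.
    by rewrite mpoly.msizeC; case: eqP.
  by move=> x; rewrite mpoly.mevalC mpoly.meval0 mulr0 addr0.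
- have [j ->|->] := unliftP ord0 i.
    exists (mpoly.mpolyX R (mpoly.mnm1 j) * A), (mpoly.mpolyX R (mpoly.mnm1 j) * B).
    split; [exact: sizeXM|exact: sizeXM|move=> x].
    rewrite gE !mpoly.mevalM mpoly.mevalXU /tail_crd; ring.
  exists (B - \sum_j mpoly.mpolyX R (mpoly.mnm1 j) * (mpoly.mpolyX R (mpoly.mnm1 j) * B)), A.
  split=> //.
    rewrite (leq_trans (mpoly.msizeD_le _ _))// geq_max.
    apply/andP; split; first exact: leqW (leqW szB).
    rewrite mpoly.msizeN; apply: (leq_trans (mpoly.msize_sum _ _ _)).
    by apply/bigmax_leqP => j _; do 2!apply: (sizeXM).
  move=> x; rewrite gE mpoly.mevalB (raddf_sum (mpoly.meval (tail_crd x)))/=.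
  under eq_bigr => j _ do
    rewrite !mpoly.mevalM !mpoly.mevalXU mulrA -expr2 /tail_crd.
  rewrite -mulr_suml; set S := \sum_i _.
  have -> : S = 1 - crd ord0 x ^+ 2.
    by rewrite -(sum_crd2 x) big_ord_recl addrAC subrr add0r.
  ring.
- exists (A + A'), (B + B'); split.
  + by rewrite (leq_trans (mpoly.msizeD_le _ _))// geq_max szA.
  + by rewrite (leq_trans (mpoly.msizeD_le _ _))// geq_max szB.
  + by move=> x; rewrite fE gE !mpoly.mevalD; ring.
- by exists A, B; split => //; exact: leqW.
Qed.

Lemma card_bmultinom n : (#|{: mpoly.bmultinom d n}| <= n ^ d)%N.
Proof.
case: n => [|n].
  rewrite (@eq_card0 _ _) ?leq0n// => m.
  by have := mpoly.bmdeg m; rewrite ltn0.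
rewrite -[X in (X ^ _)%N]card_ord -[X in (_ ^ X)%N](card_ord d) -card_ffun.
apply: (@leq_card _ _ (fun m : mpoly.bmultinom d n.+1 =>
  [ffun i => inord (mpoly.bmnm m i) : 'I_n.+1])) => m m' /ffunP mm'.
apply/val_inj/mpoly.mnmP => i; have := congr1 val (mm' i); rewrite !ffunE/=.
have mlt (u : mpoly.bmultinom d n.+1) : (mpoly.bmnm u i < n.+1)%N.
  by rewrite (leq_ltn_trans _ (mpoly.bmdeg u))// mpoly.mdegE (bigD1 i)//= leq_addr.
by rewrite !inordK.
Qed.

(** The two polynomials of [polyfn_tail] have only [d] variables. So the bound has order n^d, not
    n^(d+1), and this exponent makes tau > d/2 the condition for the embedding. *)
Lemma leq_polyfn_dim n (T : finType) (F : T -> sphere R d -> R) :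
  (forall t, polyfn n (F t)) ->
  (forall v : T -> R, (forall x, \sum_t v t * F t x = 0) -> forall t, v t = 0) ->
  (#|T| <= 2 * n.+1 ^ d)%N.
Proof.
move=> F_poly F_free.
pose b (s : bool * mpoly.bmultinom d n.+1) x :=
  (if s.1 then crd ord0 x else 1) *
  mpoly.meval (tail_crd x) (mpoly.mpolyX R (mpoly.bmnm s.2)).
have : (#|T| <= #|{: bool * mpoly.bmultinom d n.+1}|)%N.
  apply: (@leq_card_span R (sphere R d) T _ F b) => // t.
  have [A [B [szA szB FE]]] := polyfn_tail (F_poly t).
  exists (fun s => mpoly.mcoeff (mpoly.bmnm s.2) (if s.1 then B else A)) => x.
  rewrite -(pair_bigA _ (fun e m =>
    mpoly.mcoeff (mpoly.bmnm m) (if e then B else A) * b (e, m) x))/=.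
  rewrite big_bool/= FE addrC; congr (_ + _).
    rewrite [in LHS](mpoly.mpolywE szA) (raddf_sum (mpoly.meval (tail_crd x)))/=.
    by apply: eq_bigr => m _; rewrite mpoly.mevalZ /b/= mul1r.
  rewrite [in LHS](mpoly.mpolywE (leqW szB)) (raddf_sum (mpoly.meval (tail_crd x)))/=.
  by rewrite mulr_sumr; apply: eq_bigr => m _; rewrite mpoly.mevalZ /b/= mulrCA.
move=> /leq_trans; apply.
by rewrite card_prod card_bool leq_mul2l card_bmultinom.
Qed.

End PolynomialDimension.

(** * Topology and rotations of the sphere *)

Lemma cvg_mx_coord (T : Type) (F : set_system T) (FF : Filter F) (R : realType)
    m n (f : T -> 'M[R]_(m, n)) (M : 'M[R]_(m, n)) :
  (forall i j, f x i j @[x --> F] --> M i j) -> f x @[x --> F] --> M.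
Proof.
move=> fM A [P MP sPA]; rewrite /nbhs/=.
have : \forall x \near F, forall i j, P i j (f x i j).
  by apply: filter_forall => i; apply: filter_forall => j; exact: fM (MP i j).
by apply: filterS => x Px; apply: sPA.
Qed.

Section SphereTopology.
Context (R : realType) (d : nat).
Local Notation sphere := (sphere R d).

Lemma continuous_sphere_val : continuous (@sphere_val R d).
Proof. exact: initial_continuous. Qed.

Lemma continuous_crd i : continuous (@crd R d i).
Proof.
move=> x; apply: (@continuous_comp _ _ _ (@sphere_val R d) (fun v => v 0 i)).
  exact: continuous_sphere_val.
exact: coord_continuous.
Qed.

Lemma polyfn_continuous n (g : sphere -> R) : polyfn n g -> continuous g.
Proof.
elim=> {n g} [c|i n g _ IH|n f g _ IHf _ IHg|n g _ IH] x.
- exact: cst_continuous.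
- by apply: (@continuousM R sphere (crd i) g); [exact: continuous_crd|exact: IH].
- by apply: (@continuousD _ _ sphere f g); [exact: IHf|exact: IHg].
- exact: IH.
Qed.

Lemma polyfn_bounded n (g : sphere -> R) :
  polyfn n g -> exists M, forall x, `|g x| <= M.
Proof.
elim=> {n g} [c|i n g _ [M gM]|n f g _ [M fM] _ [M' gM']|n g _ [M gM]].
- by exists `|c|.
- exists M => x; rewrite normrM (le_trans _ (gM x))// ler_piMl//.
  exact: crd_le1.
- by exists (M + M') => x; rewrite (le_trans (ler_normD _ _))// lerD.
- by exists M.
Qed.

Lemma continuous_sphere_measurable (g : sphere -> R) :
  continuous g -> measurable_fun setT g.
Proof.
move=> /continuousP g_cont.
apply: (measurability _ (RGenOInfty.measurableE R)) => _ [_ [a ->] <-].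
rewrite setTI; apply: sub_sigma_algebra; apply: g_cont.
by rewrite set_itvE; exact: open_gt.
Qed.

Lemma sphere_valK (x y : sphere) : sphere_val x = sphere_val y -> x = y.
Proof. exact: val_inj. Qed.

Lemma mulmx_trK_sphere (U : 'M[R]_d.+1) (x : sphere) : U *m U^T = 1%:M ->
  sphere_val x *m U \in [set v : 'rV[R]_d.+1 | enorm v = 1].
Proof.
move=> UU; rewrite inE/= -(set_valP x) /enorm; congr Num.sqrt.
have dotE (v : 'rV[R]_d.+1) : dotp v v = (v *m v^T) 0 0.
  by rewrite mxE; apply: eq_bigr => i _; rewrite mxE.
by rewrite !dotE trmx_mul mulmxA -(mulmxA _ U) UU mulmx1.
Qed.

Definition rotate (U : 'M[R]_d.+1) (UU : U *m U^T = 1%:M) (x : sphere) : sphere :=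
  SigSub (mulmx_trK_sphere x UU).

Lemma crd_rotate U UU i x :
  crd i (@rotate U UU x) = \sum_j crd j x * U j i.
Proof. by rewrite /crd /sphere_val/= mxE. Qed.

Lemma polyfn_rotate U UU n g : polyfn n g -> polyfn n (g \o @rotate U UU).
Proof.
elim=> {n g} [c|i n g _ IH|n f g _ IHf _ IHg|n g _ IH].
- exact: polyfn_cst.
- rewrite (_ : _ \o _ = fun x => \sum_j U j i * (crd j x * g (rotate UU x))).
    by apply: polyfn_sum => j _; apply: polyfnZ; exact: polyfn_crd.
  apply/funext => x /=; rewrite crd_rotate mulr_suml.
  by apply: eq_bigr => j _; rewrite mulrAC mulrC mulrA.
- exact: polyfnD IHf IHg.
- exact: polyfnS.
Qed.

Lemma continuous_rotate U UU : continuous (@rotate U UU).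
Proof.
have cU : continuous (fun x => sphere_val (@rotate U UU x)).
  move=> x; apply: (@cvg_mx_coord sphere (nbhs x) (nbhs_filter x)) => i j.
  rewrite ord1.
  have : polyfn 1 ((fun y => crd j y * 1) \o rotate UU).
    exact/polyfn_rotate/polyfn_crd/polyfn_cst.
  move=> /polyfn_continuous; rewrite (_ : _ \o _ = fun y => crd j (rotate UU y)).
    exact.
  by apply/funext => y /=; rewrite mulr1.
apply/continuousP => _ [V oV <-].
by have /continuousP/(_ V oV) := cU.
Qed.

Lemma measurable_rotate U UU : measurable_fun setT (@rotate U UU).
Proof.
have /continuousP cU := @continuous_rotate U UU.
apply: (@measurability _ _ _ _ _ _ (@open sphere)) => // _ [B oB <-].
by rewrite setTI; apply: sub_sigma_algebra; exact: cU.
Qed.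

End SphereTopology.

(** * Square integrable functions *)

Section SquareIntegrable.
Context d (T : measurableType d) (R : realType) (mu : probability T R).
Local Notation L2 := (Lfun mu 2%:E).
Implicit Types f g : T -> R.

Let le12 : (1 <= 2%:E :> \bar R)%E.
Proof. by rewrite lee_fin ler1n. Qed.

Lemma L2_measurable f : f \in L2 -> measurable_fun setT f.
Proof. by rewrite inE => /andP[]; rewrite inE. Qed.

Lemma L2D f g : f \in L2 -> g \in L2 -> (fun x => f x + g x) \in L2.
Proof. by move=> f2 g2; exact: (Lfun_addr_closed mu le12).2 f g f2 g2. Qed.

Lemma L2Z a f : f \in L2 -> (fun x => a * f x) \in L2.
Proof.
move=> f2; have -> : (fun x => a * f x) = a \o* f.
  by apply/funext => x /=; rewrite mulrC.
by apply: Lfun_scale => //; rewrite ler1n.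
Qed.

Lemma L2B f g : f \in L2 -> g \in L2 -> (fun x => f x - g x) \in L2.
Proof.
move=> f2 g2; rewrite (_ : (fun x => _) = fun x => f x + (-1) * g x).
  by apply: L2D => //; exact: L2Z.
by apply/funext => x; rewrite mulN1r.
Qed.

Lemma L2_sum (I : Type) (r : seq I) (F : I -> T -> R) :
  (forall i, F i \in L2) -> (fun x => \sum_(i <- r) F i x) \in L2.
Proof.
move=> F2; elim: r => [|i r IHr].
  rewrite (_ : (fun x => _) = cst 0); first exact: Lfun_cst.
  by apply/funext => x; rewrite big_nil.
rewrite (_ : (fun x => _) = fun x => F i x + \sum_(j <- r) F j x).
  exact: L2D.
by apply/funext => x; rewrite big_cons.
Qed.

Lemma L2_sqr_integrableP f : measurable_fun setT f ->
  (\int[mu]_x (`|f x| `^ 2)%:E < +oo)%E -> f \in L2.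
Proof.
move=> mf fi; rewrite inE; apply/andP; split; rewrite inE//=.
by rewrite /finite_norm unlock poweR_lty.
Qed.

Lemma L2_mul_bounded f g M : f \in L2 -> measurable_fun setT g ->
  (forall x, `|g x| <= M) -> (fun x => f x * g x) \in L2.
Proof.
move=> f2 mg gM; have mf := L2_measurable f2.
have M0 : 0 <= M by rewrite (le_trans _ (gM point)).
apply: L2_sqr_integrableP; first exact: measurable_funM.
have fi : mu.-integrable setT (fun x => (`|f x| `^ 2)%:E).
  by apply: Lfun_integrable; rewrite ?ler1n.
have := integrable_lty measurableT (integrableZl measurableT (M `^ 2) fi).
apply: le_lt_trans; apply: ge0_le_integral => //.
- apply/measurable_EFinP; apply: (measurableT_comp (measurable_powR _)).
  by apply: measurableT_comp => //; exact: measurable_funM.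
- by have /measurable_int := integrableZl measurableT (M `^ 2) fi.
- move=> x _; rewrite -EFinM lee_fin normrM powRM// mulrC ler_wpM2r ?powR_ge0//.
  by rewrite ge0_ler_powR ?nnegrE.
Qed.

Lemma L2_bounded f M : measurable_fun setT f -> (forall x, `|f x| <= M) ->
  f \in L2.
Proof.
move=> mf fM; rewrite (_ : f = fun x => cst 1 x * f x).
  exact: L2_mul_bounded (Lfun_cst mu 1 2) mf fM.
by apply/funext => x; rewrite mul1r.
Qed.

Lemma L2M_integrable f g : f \in L2 -> g \in L2 ->
  mu.-integrable setT (EFin \o (fun x => f x * g x)).
Proof. by move=> f2 g2; apply/Lfun1_integrable; exact: Lfun2_mul_Lfun1. Qed.

Lemma Rintegral_probability_cst (a : R) : \int[mu]_x cst a x = a.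
Proof. by rewrite Rintegral_cst// [X in fine X](@probability_setT _ _ _ mu) mulr1. Qed.

Definition ip f g : R := \int[mu]_x (f x * g x).

Lemma ipC f g : ip f g = ip g f.
Proof. by apply: eq_Rintegral => x _; rewrite mulrC. Qed.

Lemma ipDl f g h : f \in L2 -> g \in L2 -> h \in L2 ->
  ip (fun x => f x + g x) h = ip f h + ip g h.
Proof.
move=> f2 g2 h2; rewrite /ip -RintegralD//; try exact: L2M_integrable.
by apply: eq_Rintegral => x _; rewrite mulrDl.
Qed.

Lemma ipZl a f g : f \in L2 -> g \in L2 -> ip (fun x => a * f x) g = a * ip f g.
Proof.
move=> f2 g2; rewrite /ip -RintegralZl//; last exact: L2M_integrable.
by apply: eq_Rintegral => x _; rewrite mulrA.
Qed.

Lemma ipBl f g h : f \in L2 -> g \in L2 -> h \in L2 ->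
  ip (fun x => f x - g x) h = ip f h - ip g h.
Proof.
move=> f2 g2 h2; rewrite /ip -RintegralB//; try exact: L2M_integrable.
by apply: eq_Rintegral => x _; rewrite mulrBl.
Qed.

Lemma ip_suml (I : Type) (r : seq I) (F : I -> T -> R) g :
  (forall i, F i \in L2) -> g \in L2 ->
  ip (fun x => \sum_(i <- r) F i x) g = \sum_(i <- r) ip (F i) g.
Proof.
move=> F2 g2; elim: r => [|i r IHr].
  rewrite big_nil /ip (_ : (fun x => _) = cst 0) ?Rintegral_cst ?mul0r//.
  by apply/funext => x; rewrite big_nil mul0r.
rewrite big_cons -IHr -ipDl//; last exact: L2_sum.
by congr ip; apply/funext => x; rewrite big_cons.
Qed.

Lemma ip_ge0 f : 0 <= ip f f.
Proof. by apply: Rintegral_ge0 => x _; rewrite -expr2 sqr_ge0. Qed.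

Lemma Lnorm2E f : f \in L2 -> Lnorm mu 2%:E (EFin \o f) = (Num.sqrt (ip f f))%:E.
Proof.
move=> f2; rewrite unlock -powR12_sqrt ?ip_ge0// -poweR_EFin; congr (_ `^ _)%E.
rewrite fineK; last first.
  by apply: integrable_fin_num => //; exact: L2M_integrable.
apply: eq_integral => x _ /=.
by rewrite powR_mulrn// -normrX ger0_norm ?sqr_ge0// expr2.
Qed.

Lemma ip_le f g : f \in L2 -> g \in L2 -> (forall x, f x ^+ 2 <= g x ^+ 2) ->
  ip f f <= ip g g.
Proof.
move=> f2 g2 fg; apply: le_Rintegral => //; try exact: L2M_integrable.
by move=> x _; rewrite -!expr2.
Qed.

Lemma ip_sqrD f g : f \in L2 -> g \in L2 ->
  ip (fun x => f x + g x) (fun x => f x + g x) <= 2 * ip f f + 2 * ip g g.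
Proof.
move=> f2 g2; rewrite -!ipZl//; try exact: L2Z.
rewrite /ip -RintegralD//; last 2 first.
  by apply: L2M_integrable => //; exact: L2Z.
  by apply: L2M_integrable => //; exact: L2Z.
apply: le_Rintegral => //.
- by apply: L2M_integrable; exact: L2D.
- have := L2M_integrable (L2Z 2 f2) f2; have := L2M_integrable (L2Z 2 g2) g2.
  by move=> gi fi; exact: (integrableD _ fi gi).
- by move=> x _; have := sqr_ge0 (f x - g x); nra.
Qed.

Lemma ip_mul_bounded f g M : f \in L2 -> measurable_fun setT g ->
  (forall x, `|g x| <= M) ->
  ip (fun x => f x * g x) (fun x => f x * g x) <= M ^+ 2 * ip f f.
Proof.
move=> f2 mg gM; have M0 : 0 <= M by rewrite (le_trans _ (gM point)).
apply: (@le_trans _ _ (ip (fun x => M * f x) (fun x => M * f x))); last first.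
  by rewrite ipZl ?[ip f _]ipC ?ipZl ?mulrA//; exact: L2Z.
apply: ip_le; [exact: L2_mul_bounded gM|exact: L2Z|move=> x].
rewrite !exprMn mulrC ler_wpM2r ?sqr_ge0//.
by rewrite -[g x ^+ 2]ger0_norm ?sqr_ge0// normrX lerXn2r ?nnegrE.
Qed.

End SquareIntegrable.

(** * Reflections, and transitivity of the rotation group *)

Section Rotations.
Context (R : realType) (d : nat).
Local Notation sphere := (sphere R d).

(** The Householder matrix of the hyperplane orthogonal to [v], acting on row vectors from the
    right. *)
Definition reflection (v : 'rV[R]_d.+1) : 'M[R]_d.+1 :=
  1%:M - (2 / dotp v v) *: (v^T *m v).

Lemma dotpE (u v : 'rV[R]_d.+1) : dotp u v = (u *m v^T) 0 0.
Proof. by rewrite mxE; apply: eq_bigr => i _; rewrite mxE. Qed.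

Lemma dotp_mx (u v : 'rV[R]_d.+1) : u *m v^T = (dotp u v)%:M.
Proof. by rewrite [LHS]mx11_scalar dotpE. Qed.

Lemma dotp_eq0 (v : 'rV[R]_d.+1) : (dotp v v == 0) = (v == 0).
Proof.
apply/idP/eqP => [|->]; last first.
  by rewrite /dotp big1// => i _; rewrite mxE mulr0.
rewrite psumr_eq0 => [/allP v0|i _]; last by rewrite -expr2 sqr_ge0.
apply/rowP => i; apply/eqP; have := v0 i; rewrite mem_index_enum mulf_eq0 orbb.
by rewrite mxE; apply.
Qed.

Lemma reflection_tr v : (reflection v)^T = reflection v.
Proof.
by rewrite /reflection raddfB/= tr_scalar_mx linearZ/= trmx_mul trmxK.
Qed.

Lemma reflection_orthogonal v : v != 0 ->
  reflection v *m (reflection v)^T = 1%:M.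
Proof.
rewrite -dotp_eq0 => v0; rewrite reflection_tr /reflection.
rewrite mulmxBr mulmx1 mulmxBl mul1mx -!scalemxAl -!scalemxAr.
rewrite mulmxA -(mulmxA v^T) dotp_mx mul_mx_scalar -scalemxAl !scalerA.
by rewrite divfK// mulr_natr mulr2n scalerDl opprB addrK subrK.
Qed.

Lemma mul_reflection u v : u *m reflection v = u - (2 / dotp v v * dotp u v) *: v.
Proof.
by rewrite /reflection mulmxBr mulmx1 -scalemxAr mulmxA dotp_mx mul_scalar_mx scalerA.
Qed.

(* Two factorizations of the block matrix [1, v; c v^T, 1]. *)
Lemma det_reflection v : v != 0 -> \det (reflection v) = -1.
Proof.
rewrite -dotp_eq0 => v0; set c := 2 / dotp v v.
have E1 : block_mx 1%:M v (c *: v^T) 1%:M =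
    block_mx 1%:M 0 (c *: v^T) 1%:M *m block_mx 1%:M v 0 (reflection v).
  rewrite mulmx_block ?mul1mx ?mulmx1 ?mul0mx ?mulmx0 !addr0.
  by rewrite /reflection -/c -scalemxAl addrCA subrr addr0.
have E2 : block_mx 1%:M v (c *: v^T) 1%:M =
    block_mx (1%:M - v *m (c *: v^T)) v 0 1%:M *m block_mx 1%:M 0 (c *: v^T) 1%:M.
  by rewrite mulmx_block ?mul1mx ?mulmx1 ?mul0mx ?mulmx0 !add0r subrK.
have := congr1 (fun M => \det M) E1; rewrite E2 !det_mulmx !det_ublock !det_lblock.
rewrite !det1 !mul1r !mulr1 => <-.
rewrite -scalemxAr dotp_mx scale_scalar_mx /c divfK// -raddfB/= det_scalar1.
ring.
Qed.

(** The reflection along [x - y] sends [x] to [y]; a second one, along some [w] orthogonal to [y],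
    fixes [y] and restores the determinant to 1. Such a [w] exists because the dimension [d.+1] is
    at least 2. *)
Lemma rotation_transitive (x y : sphere) : (0 < d)%N ->
  exists U : 'M[R]_d.+1, exists UU : U *m U^T = 1%:M,
    \det U = 1 /\ rotate UU x = y.
Proof.
move=> d_gt0; set u := sphere_val x; set v := sphere_val y.
have norm1 (z : sphere) : dotp (sphere_val z) (sphere_val z) = 1.
  by rewrite -(sum_crd2 z); apply: eq_bigr => i _; rewrite expr2.
have [uv|uv] := eqVneq u v.
  have UU : 1%:M *m (1%:M : 'M[R]_d.+1)^T = 1%:M by rewrite trmx1 mulmx1.
  exists 1%:M, UU; split; first by rewrite det1.
  by apply: sphere_valK; rewrite -[LHS]/(u *m 1%:M) mulmx1 uv.
have [w w0 wv] : exists2 w : 'rV[R]_d.+1, w != 0 & dotp v w = 0.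
  have : kermx v^T != 0.
    by rewrite kermx_eq0 -row_leq_rank -ltnNge (leq_ltn_trans (rank_leq_col _)).
  move=> /rowV0Pn[w /sub_kermxP wv w0]; exists w => //.
  have := congr1 (fun M : 'M[R]_1 => M 0 0) wv; rewrite -dotpE mxE => <-.
  by apply: eq_bigr => i _; rewrite mulrC.
have uv0 : u - v != 0 by rewrite subr_eq0.
pose U := reflection (u - v) *m reflection w.
have UU : U *m U^T = 1%:M.
  rewrite trmx_mul mulmxA -(mulmxA (reflection _)) reflection_orthogonal// mulmx1.
  exact: reflection_orthogonal.
exists U, UU; split.
  by rewrite det_mulmx !det_reflection// mulrNN mulr1.
apply: sphere_valK; rewrite -[LHS]/(u *m U) -/v.
have uvE : dotp (u - v) (u - v) = 2 * dotp u (u - v).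
  have dB (a b c : 'rV[R]_d.+1) : dotp a (b - c) = dotp a b - dotp a c.
    by rewrite !dotpE raddfB/= mulmxBr !mxE.
  have dC (a b : 'rV[R]_d.+1) : dotp a b = dotp b a.
    by apply: eq_bigr => i _; rewrite mulrC.
  by rewrite !dB ![dotp (u - v) _]dC !dB !norm1 (dC v u); ring.
rewrite /U mulmxA (mul_reflection u).
have -> : 2 / dotp (u - v) (u - v) * dotp u (u - v) = 1.
  rewrite mulrAC -uvE divff// dotp_eq0//.
by rewrite scale1r opprB addrCA subrr addr0 mul_reflection wv mulr0 scale0r subr0.
Qed.

End Rotations.

(** * Series with Sobolev weights *)

Section Series.
Context (R : realType).
Implicit Types (u v e : nat -> R) (s : R).

Lemma nneseries_EFin_cvg u l : (\sum_(i < n) u i @[n --> \oo] --> l) ->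
  (\sum_(0 <= i <oo) (u i)%:E)%E = l%:E.
Proof.
move=> ul; apply/cvg_lim => //.
rewrite (_ : (fun n => _) = EFin \o (fun n => \sum_(i < n) u i)).
  by apply: cvg_EFin; first exact: nearW.
by apply/funext => n /=; rewrite sumEFin big_mkord.
Qed.

Lemma nneseries_trunc u b :
  (\sum_(0 <= i <oo) (if (i <= b)%N then u i else 0)%:E)%E
  = (\sum_(i < b.+1) u i)%:E.
Proof.
apply: nneseries_EFin_cvg; apply: cvg_near_cst; exists b.+1 => // n /= bn.
rewrite (big_ord_widen _ u bn) [RHS]big_mkcond/=; apply: eq_bigr => i _.
by rewrite ltnS.
Qed.

Lemma leq_nneseries_partial u n : (forall i, 0 <= u i) ->
  ((\sum_(i < n) u i)%:E <= \sum_(0 <= i <oo) (u i)%:E)%E.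
Proof.
move=> u0; rewrite -sumEFin -(big_mkord xpredT (fun i => (u i)%:E)).
by apply: nneseries_lim_ge => i _ _; rewrite lee_fin.
Qed.

Definition weight s (l : nat) : R := (1 + l%:R) `^ (2 * s).

(** Difference of consecutive weights; for [s > 0] it is 1 at [l = 0], so that the sums telescope to
    [weight] without a boundary term. *)
Definition weight_incr s (l : nat) : R := (1 + l%:R) `^ (2 * s) - l%:R `^ (2 * s).

Lemma weight_ge0 s l : 0 <= weight s l.
Proof. exact: powR_ge0. Qed.

Lemma weight_incr_ge0 s l : 0 <= s -> 0 <= weight_incr s l.
Proof.
by move=> s0; rewrite subr_ge0 ge0_ler_powR ?nnegrE ?mulr_ge0 ?addr_ge0 ?lerDr.
Qed.

Lemma sum_weight_incr s l : 0 < s -> \sum_(i < l.+1) weight_incr s i = weight s l.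
Proof.
move=> s0; rewrite -(big_mkord xpredT (weight_incr s)).
rewrite (eq_bigr (fun i => i.+1%:R `^ (2 * s) - i%:R `^ (2 * s))); last first.
  by move=> i _; rewrite /weight_incr nat1r.
rewrite (telescope_sumr (fun i => i%:R `^ (2 * s)))//.
by rewrite powR0 ?subr0 ?mulf_neq0 ?gt_eqF// /weight nat1r.
Qed.

(* Summation by parts, in the form [sum_L v_L sum_(l : a L <= l) e_l]. *)
Lemma nneseries_weight_tail s e (a b : nat -> nat) : 0 < s ->
  (forall l, 0 <= e l) -> (forall i l, (a i <= l)%N = (i <= b l)%N) ->
  (\sum_(0 <= i <oo) ((weight_incr s i)%:E *
     \sum_(0 <= l <oo) (if (a i <= l)%N then e l else 0)%:E))%E =
  (\sum_(0 <= l <oo) (weight s (b l) * e l)%:E)%E.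
Proof.
move=> s0 e0 ab.
transitivity (\sum_(0 <= i <oo) \sum_(0 <= l <oo)
    ((if (i <= b l)%N then weight_incr s i else 0) * e l)%:E)%E.
  apply: eq_eseriesr => i _; rewrite -nneseriesZl; last first.
    by move=> l _; rewrite lee_fin; case: ifP.
  apply: eq_eseriesr => l _; rewrite -EFinM ab; congr EFin.
  by case: ifP; rewrite ?mulr0 ?mul0r.
rewrite nneseries_interchange; last first.
  move=> i l; rewrite lee_fin mulr_ge0//; case: ifP => // _.
  exact/weight_incr_ge0/ltW.
apply: eq_eseriesr => l _.
under eq_eseriesr do rewrite mulrC EFinM.
rewrite nneseriesZl; last first.
  by move=> i _; rewrite lee_fin; case: ifP => // _; exact/weight_incr_ge0/ltW.
by rewrite nneseries_trunc sum_weight_incr// -EFinM mulrC.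
Qed.

Lemma weight_double s l : 0 <= s -> weight s l.*2 <= 2 `^ (2 * s) * weight s l.
Proof.
move=> s0; rewrite /weight -powRM// ?addr_ge0//.
rewrite ge0_ler_powR ?nnegrE ?mulr_ge0 ?addr_ge0//.
by rewrite -mul2n natrM; lra.
Qed.

(** Cauchy-Schwarz extracted from a nonnegative quadratic form: take [t = S] and [u = A] when
    [A > 0]; the degenerate case [A = 0] is treated apart. *)
Lemma quadratic_discriminant (A B S : R) : 0 <= A -> 0 <= B ->
  (forall t u : R, 2 * t * u * S <= t ^+ 2 * A + u ^+ 2 * B) -> S ^+ 2 <= A * B.
Proof.
move=> A0 B0 H.
have [A_gt0|] := ltP 0 A.
  rewrite -(ler_pM2l A_gt0); have := H S A; nra.
move=> A_le0; have {A_le0 A0}A0 : A = 0 by apply/eqP; rewrite eq_le A_le0.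
have [B_gt0|] := ltP 0 B.
  by rewrite -(ler_pM2l B_gt0); have := H B S; rewrite A0; nra.
by move=> B_le0; have := H S 1; rewrite A0; nra.
Qed.

Lemma ler_product_split (A U G p q r1 r2 : R) :
  p <= U * A * r1 -> q <= G * A * r2 ->
  2 * p + 2 * q <= 2 * A * (U * r1 + G * r2).
Proof. lra. Qed.

Lemma mulr_product_split (w A U G r1 r2 : R) :
  2 * A * w * (U * r1 + G * r2) =
  2 * A * U * (w * r1) + 2 * A * G * (w * r2).
Proof. ring. Qed.

Lemma nneseries_le_comb (p r1 r2 : nat -> R) (a b S1 S2 : R) :
  0 <= a -> 0 <= b -> (forall i, 0 <= p i) -> (forall i, 0 <= r1 i) ->
  (forall i, 0 <= r2 i) -> (forall i, p i <= a * r1 i + b * r2 i) ->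
  (\sum_(0 <= i <oo) (r1 i)%:E <= S1%:E)%E ->
  (\sum_(0 <= i <oo) (r2 i)%:E <= S2%:E)%E ->
  (\sum_(0 <= i <oo) (p i)%:E <= (a * S1 + b * S2)%:E)%E.
Proof.
move=> a0 b0 p0 r10 r20 pE S1E S2E.
apply: (@le_trans _ _ (\sum_(0 <= i <oo)
    (a%:E * (r1 i)%:E + b%:E * (r2 i)%:E))%E).
  apply: lee_nneseries => [i _ _|i _]; first by rewrite lee_fin.
  by rewrite -!EFinM -EFinD lee_fin.
rewrite nneseriesD; last 2 first.
- by move=> i _ _; rewrite -EFinM lee_fin mulr_ge0.
- by move=> i _ _; rewrite -EFinM lee_fin mulr_ge0.
rewrite !nneseriesZl; last 2 first.
- by move=> i _; rewrite lee_fin.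
- by move=> i _; rewrite lee_fin.
by rewrite EFinD !EFinM; apply: leeD; apply: lee_wpmul2l; rewrite ?lee_fin.
Qed.

End Series.

(** * Spherical harmonics and Sobolev norms *)

Section Basis.
Context (R : realType) (d : nat) (d_gt0 : (0 < d)%N).
Local Notation sphere := (sphere R d).
Context (mu : probability sphere R) (mu_rot : rotation_invariant mu).
Context (Z : nat -> nat) (Y : forall l, 'I_(Z l) -> sphere -> R).
Hypothesis Y_basis : harmonic_basis mu Y.
Local Notation L2 := (Lfun mu 2%:E).
Local Notation "<< f , g >>" := (ip mu f g).
Local Notation coef := (fourier_coef mu Y).
Local Notation harm_sum := (harm_sum Y).
Implicit Types f g : sphere -> R.

Lemma ip_rotate U UU f : continuous f -> \det U = 1 ->
  << f \o @rotate R d U UU, f \o rotate UU >> = << f, f >>.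
Proof.
move=> f_cont detU; have mf := continuous_sphere_measurable f_cont.
rewrite /ip /Rintegral; congr fine.
transitivity (\int[pushforward mu (rotate UU)]_x (f x * f x)%:E)%E.
  rewrite ge0_integral_pushforward//.
  - exact: measurable_rotate.
  - by apply/measurable_EFinP; exact: measurable_funM.
  - by move=> x _; rewrite lee_fin -expr2 sqr_ge0.
apply: eq_measure_integral => [|mT A mA _]; first exact: measurable_rotate.
exact: (@mu_rot U (rotate UU) UU detU (fun=> erefl) A mA).
Qed.

Lemma Y_polyfn l (k : 'I_(Z l)) : polyfn l (Y k).
Proof. by case: Y_basis => Yh _ _ _; exact: spherical_harmonic_polyfn. Qed.

Lemma polyfn_L2 n g : polyfn n g -> g \in L2.
Proof.
move=> g_poly; have [M gM] := polyfn_bounded g_poly.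
apply: L2_bounded gM.
exact: continuous_sphere_measurable (polyfn_continuous g_poly).
Qed.

Lemma Y_L2 l (k : 'I_(Z l)) : Y k \in L2.
Proof. exact: polyfn_L2 (Y_polyfn k). Qed.

Lemma ip_Y l (k : 'I_(Z l)) l' (k' : 'I_(Z l')) :
  << Y k, Y k' >> = ((l == l') && (k == k' :> nat))%:R.
Proof. by case: Y_basis => _ Yo _ _; exact: Yo. Qed.

Lemma polyfn_harm_span n g : polyfn n g -> harm_span Y n.+1 g.
Proof. by case: Y_basis => _ _ Ys _; exact: polyfn_span. Qed.

Lemma harm_sum_polyfn L c : polyfn L (harm_sum L c).
Proof.
apply: polyfn_sum => l _; apply: polyfn_sum => k _; apply: polyfnZ.
apply: polyfn_leq (Y_polyfn k); exact: ltnW.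
Qed.

Lemma harm_sum_polyfnS L c : polyfn L (harm_sum L.+1 c).
Proof.
apply: polyfn_sum => l _; apply: polyfn_sum => k _; apply: polyfnZ.
by apply: polyfn_leq (Y_polyfn k); rewrite -ltnS.
Qed.

Lemma harm_sum_L2 L c : harm_sum L c \in L2.
Proof. exact: polyfn_L2 (harm_sum_polyfn L c). Qed.

Lemma coefE f l (k : 'I_(Z l)) : coef f k = << f, Y k >>.
Proof. by []. Qed.

Lemma coefD f g l (k : 'I_(Z l)) : f \in L2 -> g \in L2 ->
  coef (fun x => f x + g x) k = coef f k + coef g k.
Proof. by move=> f2 g2; apply: ipDl => //; exact: Y_L2. Qed.

Lemma coefB f g l (k : 'I_(Z l)) : f \in L2 -> g \in L2 ->
  coef (fun x => f x - g x) k = coef f k - coef g k.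
Proof. by move=> f2 g2; apply: ipBl => //; exact: Y_L2. Qed.

Lemma ip_harm_sum L c g : g \in L2 ->
  << harm_sum L c, g >> = \sum_(l < L) \sum_(k < Z l) c l k * coef g k.
Proof.
move=> g2; rewrite ip_suml//; last first.
  by move=> l; apply: L2_sum => k; apply: L2Z; exact: Y_L2.
apply: eq_bigr => l _; rewrite ip_suml//; last first.
  by move=> k; apply: L2Z; exact: Y_L2.
by apply: eq_bigr => k _; rewrite ipZl ?Y_L2// ipC.
Qed.

Lemma sum_delta L (F : forall l, 'I_(Z l) -> R) l0 (k0 : 'I_(Z l0)) :
  \sum_(l < L) \sum_(k < Z l) F l k * ((l0 == l) && (k0 == k :> nat))%:R =
  if (l0 < L)%N then F l0 k0 else 0.
Proof.
case: ifPn => [l0L|]; last first.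
  rewrite -leqNgt => Ll0; apply: big1 => l _; apply: big1 => k _.
  by rewrite gtn_eqF ?mulr0// (leq_trans _ Ll0).
rewrite (bigD1 (Ordinal l0L))//= [X in _ + X]big1 ?addr0; last first.
  move=> l; rewrite -val_eqE/= eq_sym => /negbTE ll0; apply: big1 => k _.
  by rewrite ll0 mulr0.
rewrite (bigD1 k0)//= !eqxx mulr1 big1 ?addr0// => k.
rewrite -val_eqE/= => /negbTE kk0.
by rewrite [(k0 : nat) == k]eq_sym kk0 ?andbF mulr0.
Qed.

Lemma coef_harm_sum L c l (k : 'I_(Z l)) :
  coef (harm_sum L c) k = if (l < L)%N then c l k else 0.
Proof.
rewrite coefE ip_harm_sum ?Y_L2// -sum_delta.
by do 2![apply: eq_bigr => ? _]; rewrite coefE ip_Y.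
Qed.

Lemma ip_harm_sum2 L c :
  << harm_sum L c, harm_sum L c >> = \sum_(l < L) \sum_(k < Z l) c l k ^+ 2.
Proof.
rewrite ip_harm_sum ?harm_sum_L2//; apply: eq_bigr => l _; apply: eq_bigr => k _.
by rewrite coef_harm_sum ltn_ord expr2.
Qed.

(** The reproducing kernel of the harmonics of degree below [L], on the diagonal. *)
Definition christoffel L x := \sum_(l < L) \sum_(k < Z l) Y k x ^+ 2.

(* If p reproduces evaluation at Tx on the polynomials of degree < L, then
   2 K(Tx) = 2 p(Tx) = 2 (p o T)(x) <= |p o T|^2 + K(x) = K(Tx) + K(x). *)
Lemma christoffel_rotate_le L U UU x : \det U = 1 ->
  christoffel L (@rotate R d U UU x) <= christoffel L x.
Proof.
case: L => [|L] detU; first by rewrite /christoffel !big_ord0.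
set y := rotate UU x; pose p := harm_sum L.+1 (fun l k => Y k y).
have p_poly : polyfn L p by exact: harm_sum_polyfnS.
have [c cE] := polyfn_harm_span (polyfn_rotate UU p_poly).
have pE : << p, p >> = christoffel L.+1 y by rewrite ip_harm_sum2.
have pyE : p y = christoffel L.+1 y.
  by do 2![apply: eq_bigr => ? _]; rewrite expr2.
have : 2 * p y <= << p, p >> + christoffel L.+1 x; last first.
  by rewrite pE pyE mulr_natl mulr2n lerD2l.
rewrite -(ip_rotate UU (polyfn_continuous p_poly) detU).
rewrite -[p y]/((p \o rotate UU) x) (funext cE : p \o rotate UU = _).
rewrite ip_harm_sum2 /harm_sum /christoffel mulr_sumr -big_split/=.
apply: ler_sum => l _; rewrite mulr_sumr -big_split/=; apply: ler_sum => k _.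
by have := sqr_ge0 (c l k - Y k x); nra.
Qed.

Lemma christoffel_cst L x y : christoffel L x = christoffel L y.
Proof.
apply/eqP; rewrite eq_le; apply/andP; split.
  have [U [UU [detU <-]]] := rotation_transitive y x d_gt0.
  exact: christoffel_rotate_le.
have [U [UU [detU <-]]] := rotation_transitive x y d_gt0.
exact: christoffel_rotate_le.
Qed.

(** The addition formula on the diagonal: a constant function equals its mean, and each squared
    basis function has integral 1. *)
Lemma christoffelE L x : christoffel L x = \sum_(l < L) (Z l)%:R.
Proof.
have KE : christoffel L x = \int[mu]_y christoffel L y.
  rewrite (@eq_Rintegral _ _ _ mu setT (cst (christoffel L x))); last first.
    by move=> y _; exact: christoffel_cst.
  by rewrite (Rintegral_probability_cst mu).
rewrite KE.
have := @ip_suml _ _ _ mu 'I_L (index_enum _)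
  (fun l y => \sum_(k < Z l) Y k y ^+ 2) (cst 1).
rewrite /ip; under eq_Rintegral do rewrite mulr1.
move=> ->; last exact: Lfun_cst; last first.
  move=> l; apply: L2_sum => k; apply: (@polyfn_L2 (l + l)).
  by under eq_fun do rewrite expr2; apply: polyfnM; exact: Y_polyfn.
apply: eq_bigr => l _; rewrite -/(ip _ _ _) ip_suml; last exact: Lfun_cst; last first.
  move=> k; apply: (@polyfn_L2 (l + l)).
  by under eq_fun do rewrite expr2; apply: polyfnM; exact: Y_polyfn.
rewrite (eq_bigr (fun=> 1)) ?sumr_const ?card_ord// => k _.
transitivity << Y k, Y k >>; last by rewrite ip_Y !eqxx.
by apply: eq_Rintegral => y _ /=; rewrite mulr1 expr2.
Qed.

(** The basis functions of degree below [L] are orthonormal, hence independent, so [leq_polyfn_dim]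
    counts them. *)
Lemma sum_dim_le L : (\sum_(l < L) Z l <= 2 * L ^ d)%N.
Proof.
case: L => [|L]; first by rewrite big_ord0.
rewrite (_ : (\sum_(l < L.+1) Z l)%N = #|{: {l : 'I_L.+1 & 'I_(Z l)}}|); last first.
  rewrite card_tagged sumnE big_map big_enum/=.
  by apply: eq_bigr => l _; rewrite card_ord.
apply: (@leq_polyfn_dim R d L _ (fun t => Y (tagged t))) => [[l k]|v v0 [l0 k0]].
  by apply: polyfn_leq (Y_polyfn k); rewrite -ltnS.
have t0_L2 : Y k0 \in L2 by exact: Y_L2.
have : << fun x => \sum_(t : {l : 'I_L.+1 & 'I_(Z l)}) v t * Y (tagged t) x, Y k0 >>
    = 0.
  by rewrite /ip (eq_Rintegral _ _ (g := cst 0)) ?Rintegral_cst ?mul0r// => x _;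
    rewrite v0 mul0r.
rewrite ip_suml//; last by move=> t; apply: L2Z; exact: Y_L2.
rewrite (bigD1 (Tagged (fun l : 'I_L.+1 => 'I_(Z l)) k0))//=.
rewrite ipZl ?Y_L2// ip_Y !eqxx mulr1 big1 ?addr0// => -[l k] lk.
rewrite ipZl ?Y_L2// ip_Y/=; case: eqP => [/val_inj ll0|_]; last by rewrite mulr0.
subst l; case: eqP => [/val_inj kk0|_]; last by rewrite mulr0.
by rewrite kk0 eqxx in lk.
Qed.

Lemma christoffel_le L x : christoffel L x <= 2 * L%:R ^+ d.
Proof.
rewrite christoffelE -natr_sum -natrX -natrM ler_nat; exact: sum_dim_le.
Qed.

(** * Parseval identity, and Sobolev norms expressed by remainders *)

Definition degree_energy f l : R := \sum_(k < Z l) coef f k ^+ 2.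

Lemma energy_ge0 f l : 0 <= degree_energy f l.
Proof. by apply: sumr_ge0 => k _; exact: sqr_ge0. Qed.

Local Notation sqn s f := (sobolev_sqnorm mu Y s f).

Lemma sqnE s f : sqn s f = (\sum_(0 <= l <oo) (weight s l * degree_energy f l)%:E)%E.
Proof.
apply: eq_eseriesr => l _; rewrite mulr_sumr; congr EFin.
by apply: eq_bigr => k _; rewrite -normrX ger0_norm ?sqr_ge0.
Qed.

Lemma sqn_ge0 s f : (0 <= sqn s f)%E.
Proof.
rewrite sqnE; apply: nneseries_ge0 => l _ _.
by rewrite lee_fin mulr_ge0 ?weight_ge0 ?energy_ge0.
Qed.

Lemma fourier_partialE f N :
  fourier_partial mu Y f N = harm_sum N (fun l => @coef f l).
Proof. by []. Qed.

Definition remainder f N x : R := f x - fourier_partial mu Y f N x.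

Lemma remainder_L2 f N : f \in L2 -> remainder f N \in L2.
Proof. by move=> f2; apply: L2B => //; exact: harm_sum_L2. Qed.

Lemma coef_remainder f N l (k : 'I_(Z l)) : f \in L2 ->
  coef (remainder f N) k = if (l < N)%N then 0 else coef f k.
Proof.
move=> f2; rewrite coefB ?harm_sum_L2// fourier_partialE coef_harm_sum.
by case: ifP; rewrite ?subrr ?subr0.
Qed.

Lemma ip_remainder f N : f \in L2 ->
  << remainder f N, remainder f N >> = << f, f >> - \sum_(l < N) degree_energy f l.
Proof.
move=> f2; set p := fourier_partial mu Y f N.
have p2 : p \in L2 by exact: harm_sum_L2.
have pf : << p, f >> = \sum_(l < N) degree_energy f l.
  by rewrite ip_harm_sum//; do 2![apply: eq_bigr => ? _]; rewrite -expr2.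
have pp : << p, p >> = \sum_(l < N) degree_energy f l by rewrite ip_harm_sum2.
rewrite ipBl ?remainder_L2// (ipC _ f) (ipC _ p) !ipBl// (ipC _ f p) pf pp.
by rewrite subrr subr0.
Qed.

Lemma parseval_cvg f : f \in L2 ->
  \sum_(l < N) degree_energy f l @[N --> \oo] --> << f, f >>.
Proof.
move=> f2; have [_ _ _ /(_ f f2) f_cvg] := Y_basis.
pose r N := << remainder f N, remainder f N >>.
have r_cvg : Num.sqrt (r N) @[N --> \oo] --> (0 : R).
  have /fine_cvgP[_] : (Num.sqrt (r N))%:E @[N --> \oo] --> 0%:E.
    under eq_cvg do rewrite -Lnorm2E ?remainder_L2//.
    exact: f_cvg.
  exact.
have -> : (fun N => \sum_(l < N) degree_energy f l) =
    (fun N => << f, f >> - Num.sqrt (r N) * Num.sqrt (r N)).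
  apply/funext => N; rewrite -expr2 sqr_sqrtr ?ip_ge0// /r ip_remainder//.
  by rewrite opprB addrC subrK.
rewrite -[X in _ --> X]subr0 -[X in _ - X](mulr0 0).
by apply: cvgB; [exact: cvg_cst|exact: cvgM].
Qed.

Lemma parseval f : f \in L2 ->
  (\sum_(0 <= l <oo) (degree_energy f l)%:E)%E = (<< f, f >>)%:E.
Proof. by move=> f2; apply: nneseries_EFin_cvg; exact: parseval_cvg. Qed.

Lemma energy_remainder f N l : f \in L2 ->
  degree_energy (remainder f N) l = if (N <= l)%N then degree_energy f l else 0.
Proof.
move=> f2; rewrite /degree_energy leqNgt; case: ifPn => lN.
  by apply: eq_bigr => k _; rewrite coef_remainder// (negbTE lN).
rewrite negbK in lN; apply: big1 => k _.
by rewrite coef_remainder// lN expr0n.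
Qed.

Lemma parseval_remainder f N : f \in L2 ->
  (<< remainder f N, remainder f N >>)%:E =
  (\sum_(0 <= l <oo) (if (N <= l)%N then degree_energy f l else 0)%:E)%E.
Proof.
move=> f2; rewrite -parseval ?remainder_L2//.
by apply: eq_eseriesr => l _; rewrite energy_remainder.
Qed.

(** Summation by parts brings in the L2 distances to polynomials. Unlike the coefficients
    themselves, these can be estimated for a product. *)
Lemma sqn_remainder s f : 0 < s -> f \in L2 ->
  sqn s f = (\sum_(0 <= i <oo)
    (weight_incr s i * << remainder f i, remainder f i >>)%:E)%E.
Proof.
move=> s0 f2; rewrite sqnE.
rewrite -(@nneseries_weight_tail R s (degree_energy f) id id)//; last exact: energy_ge0.
by apply: eq_eseriesr => i _; rewrite EFinM parseval_remainder.
Qed.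

(** Since [uphalf i <= l] means [i <= l.*2], halving the index of the remainders replaces the weight
    at [l] by the weight at [l.*2], which costs a constant factor. *)
Lemma sqn_remainder_uphalf s f : 0 < s -> f \in L2 ->
  (\sum_(0 <= i <oo) (weight_incr s i *
     << remainder f (uphalf i), remainder f (uphalf i) >>)%:E <=
  (2 `^ (2 * s))%:E * sqn s f)%E.
Proof.
move=> s0 f2.
rewrite (eq_eseriesr (g := fun i => (weight_incr s i)%:E *
  \sum_(0 <= l <oo) (if (uphalf i <= l)%N then degree_energy f l else 0)%:E)%E); last first.
  by move=> i _; rewrite EFinM parseval_remainder.
rewrite (@nneseries_weight_tail R s (degree_energy f) uphalf double)//; last 2 first.
- exact: energy_ge0.
- by move=> i l; rewrite leq_uphalf_double.
rewrite sqnE -nneseriesZl; last first.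
  by move=> l _; rewrite lee_fin mulr_ge0 ?weight_ge0 ?energy_ge0.
apply: lee_nneseries => [l _ _|l _].
  by rewrite lee_fin mulr_ge0 ?weight_ge0 ?energy_ge0.
rewrite -EFinM lee_fin mulrA ler_wpM2r ?energy_ge0//.
by apply: weight_double; exact: ltW.
Qed.

Lemma coef_polyfn_eq0 n g l (k : 'I_(Z l)) : polyfn n g -> (n < l)%N ->
  coef g k = 0.
Proof.
move=> /polyfn_harm_span[c cE] nl; rewrite (funext cE : g = harm_sum n.+1 c).
by rewrite coef_harm_sum ltnS leqNgt nl.
Qed.

Lemma energy_harm_sum L c l : degree_energy (harm_sum L c) l =
  if (l < L)%N then \sum_(k < Z l) c l k ^+ 2 else 0.
Proof.
rewrite /degree_energy; case: ifPn => lL.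
  by apply: eq_bigr => k _; rewrite coef_harm_sum lL.
by apply: big1 => k _; rewrite coef_harm_sum (negbTE lL) expr0n.
Qed.

(** * Pointwise bounds, the product estimate and duality *)

Section Embedding.
Variables (tau A : R).
Hypothesis A_bound : forall L x,
  \sum_(l < L) (weight tau l)^-1 * \sum_(k < Z l) Y k x ^+ 2 <= A.

(** Cauchy-Schwarz with the weight on one factor and its inverse on the other; [A] bounds the second
    factor uniformly in [L] and [x]. *)
Lemma harm_sum_sqr_le L c x : harm_sum L c x ^+ 2 <=
  (\sum_(l < L) weight tau l * \sum_(k < Z l) c l k ^+ 2) * A.
Proof.
apply: (@le_trans _ _ ((\sum_(l < L) weight tau l * \sum_(k < Z l) c l k ^+ 2) *
   (\sum_(l < L) (weight tau l)^-1 * \sum_(k < Z l) Y k x ^+ 2))); last first.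
  rewrite ler_wpM2l// sumr_ge0// => l _.
  by rewrite mulr_ge0 ?weight_ge0 ?sumr_ge0// => k _; exact: sqr_ge0.
apply: quadratic_discriminant.
- apply: sumr_ge0 => l _.
  by rewrite mulr_ge0 ?weight_ge0 ?sumr_ge0// => k _; exact: sqr_ge0.
- apply: sumr_ge0 => l _.
  by rewrite mulr_ge0 ?invr_ge0 ?weight_ge0 ?sumr_ge0// => k _; exact: sqr_ge0.
move=> t u; rewrite !mulr_sumr -big_split/=; apply: ler_sum => l _.
rewrite !mulr_sumr -big_split/=; apply: ler_sum => k _.
have w_gt0 : 0 < weight tau l by rewrite powR_gt0// ltr_pwDl.
rewrite -(ler_pM2l w_gt0) mulrDr.
rewrite [X in _ <= _ + X](_ : _ = (u * Y k x) ^+ 2); last first.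
  by field; rewrite gt_eqF.
have := sqr_ge0 (weight tau l * t * c l k - u * Y k x); nra.
Qed.

Lemma fourier_partial_sqr_le f N x : (sqn tau f < +oo)%E ->
  fourier_partial mu Y f N x ^+ 2 <= fine (sqn tau f) * A.
Proof.
move=> f_fin; apply: (le_trans (harm_sum_sqr_le _ _ _)).
have A0 : 0 <= A by have := A_bound 0 x; rewrite big_ord0.
rewrite ler_wpM2r// -lee_fin fineK ?ge0_fin_numE ?sqn_ge0// sqnE.
apply: leq_nneseries_partial => l.
by rewrite mulr_ge0 ?weight_ge0 ?energy_ge0.
Qed.

Lemma sqn_harm_sum s L c : sqn s (harm_sum L c) =
  (\sum_(l < L) weight s l * \sum_(k < Z l) c l k ^+ 2)%:E.
Proof.
rewrite sqnE; apply: nneseries_EFin_cvg; apply: cvg_near_cst; exists L => // n /= Ln.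
rewrite (big_ord_widen _ (fun l => weight s l * \sum_(k < Z l) c l k ^+ 2) Ln).
rewrite [RHS]big_mkcond/=; apply: eq_bigr => l _.
by rewrite energy_harm_sum; case: ifP; rewrite ?mulr0.
Qed.

Lemma polyfn_sqr_le n u x : polyfn n u -> u x ^+ 2 <= fine (sqn tau u) * A.
Proof.
move=> /polyfn_harm_span[c cE]; rewrite (funext cE : u = harm_sum n.+1 c).
by rewrite sqn_harm_sum/= harm_sum_sqr_le.
Qed.

Lemma polyfn_sqn_fin n u s : polyfn n u -> sqn s u \is a fin_num.
Proof.
move=> /polyfn_harm_span[c cE]; rewrite (funext cE : u = harm_sum n.+1 c).
by rewrite sqn_harm_sum.
Qed.

(* Of [g u = (g - g_a) u + g_a (u - u_a) + g_a u_a], where [_a] is the part of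
   degree < a = uphalf i, the last term has degree < i. *)
Lemma ip_remainder_mul g u n i : g \in L2 -> polyfn n u ->
  (sqn tau g < +oo)%E ->
  << remainder (fun x => g x * u x) i, remainder (fun x => g x * u x) i >> <=
  2 * A * (fine (sqn tau u) *
             << remainder g (uphalf i), remainder g (uphalf i) >> +
           fine (sqn tau g) *
             << remainder u (uphalf i), remainder u (uphalf i) >>).
Proof.
move=> g2 u_poly g_fin; set a := uphalf i.
have u2 : u \in L2 by exact: polyfn_L2 u_poly.
have mu_u : measurable_fun setT u by exact: L2_measurable u2.
have A0 : 0 <= A by have := A_bound 0 point; rewrite big_ord0.
have gu2 : (fun x => g x * u x) \in L2.
  have [M uM] := polyfn_bounded u_poly.
  exact: L2_mul_bounded uM.
pose ga := fourier_partial mu Y g a; pose ua := fourier_partial mu Y u a.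
have ga2 : ga \in L2 by exact: harm_sum_L2.
have ma : measurable_fun setT ga by exact: L2_measurable ga2.
have u_le x : `|u x| <= Num.sqrt (fine (sqn tau u) * A).
  rewrite -(@ler_pXn2r _ 2)// ?nnegrE ?sqrtr_ge0// sqr_sqrtr; last first.
    by rewrite mulr_ge0// fine_ge0// sqn_ge0.
  by rewrite -normrX ger0_norm ?sqr_ge0// (polyfn_sqr_le _ u_poly).
have ga_le x : `|ga x| <= Num.sqrt (fine (sqn tau g) * A).
  rewrite -(@ler_pXn2r _ 2)// ?nnegrE ?sqrtr_ge0// sqr_sqrtr; last first.
    by rewrite mulr_ge0// fine_ge0// sqn_ge0.
  by rewrite -normrX ger0_norm ?sqr_ge0// fourier_partial_sqr_le.
pose w x := remainder g a x * u x + remainder u a x * ga x.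
have w1_2 : (fun x => remainder g a x * u x) \in L2.
  by apply: L2_mul_bounded u_le => //; exact: remainder_L2.
have w2_2 : (fun x => remainder u a x * ga x) \in L2.
  by apply: L2_mul_bounded ga_le => //; exact: remainder_L2.
have w2 : w \in L2 by exact: L2D.
have guE : (fun x => g x * u x) = fun x => w x + ga x * ua x.
  by apply/funext => x; rewrite /w /remainder -/ga -/ua; ring.
have gaua2 : (fun x => ga x * ua x) \in L2.
  by apply: (@polyfn_L2 (a + a)); apply: polyfnM; exact: harm_sum_polyfn.
have energyE l : (i <= l)%N -> degree_energy (fun x => g x * u x) l = degree_energy w l.
  move=> il; apply: eq_bigr => k _; rewrite guE coefD//.
  suff -> : coef (fun x => ga x * ua x) k = 0 by rewrite addr0.
  (* If [a = 0] the low-degree part is an empty sum. Otherwise, with [a = b.+1], both low parts have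
     degree at most [b], and [uphalf i = b.+1] gives 2b < i <= l. *)
  have [a0|] := posnP a.
    rewrite coefE /ip (@eq_Rintegral _ _ _ mu setT (cst 0)).
      by rewrite Rintegral_probability_cst.
    by move=> x _; rewrite /ga a0 /fourier_partial big_ord0 !mul0r.
  case aE : a => [//|b] _; apply: (@coef_polyfn_eq0 (b + b)).
    by apply: polyfnM; rewrite /ga /ua aE; apply: harm_sum_polyfnS.
  rewrite (leq_trans _ il)// ltnNge addnn -leq_uphalf_double -/a aE.
  by rewrite ltnn.
apply: (@le_trans _ _ << w, w >>).
  rewrite -lee_fin parseval_remainder// -parseval//.
  apply: lee_nneseries => [l _ _|l _]; case: ifPn => il; rewrite ?lee_fin ?energy_ge0//.
  by rewrite energyE.
apply: (le_trans (ip_sqrD w1_2 w2_2)).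
have e1 := ip_mul_bounded (remainder_L2 a g2) mu_u u_le.
have e2 := ip_mul_bounded (remainder_L2 a u2) ma ga_le.
rewrite sqr_sqrtr in e1; last by rewrite mulr_ge0// fine_ge0// sqn_ge0.
rewrite sqr_sqrtr in e2; last by rewrite mulr_ge0// fine_ge0// sqn_ge0.
exact: ler_product_split e1 e2.
Qed.


(** The remainder estimate is multiplied by [weight_incr] and summed, the halved index costing
    2^(2s). The result is tame: each term has only one factor in the norm of order [s]. *)
Lemma sqn_mul_le s g u n : 0 < s -> g \in L2 -> polyfn n u ->
  (sqn s g < +oo)%E -> (sqn tau g < +oo)%E ->
  (sqn s (fun x => (g x * u x)%R) <=
   (2 * A * 2 `^ (2 * s) * (fine (sqn tau u) * fine (sqn s g)
                           + fine (sqn tau g) * fine (sqn s u)))%:E)%E.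
Proof.
move=> s0 g2 u_poly gs_fin gt_fin.
have u2 : u \in L2 by exact: polyfn_L2 u_poly.
have A0 : 0 <= A by have := A_bound 0 point; rewrite big_ord0.
have gu2 : (fun x => g x * u x) \in L2.
  have [M uM] := polyfn_bounded u_poly.
  by apply: L2_mul_bounded uM => //; exact: L2_measurable u2.
set U := fine (sqn tau u); set G := fine (sqn tau g).
have U0 : 0 <= U by rewrite fine_ge0// sqn_ge0.
have G0 : 0 <= G by rewrite fine_ge0// sqn_ge0.
have r0 f i : 0 <= weight_incr s i * << remainder f (uphalf i), remainder f (uphalf i) >>.
  by rewrite mulr_ge0 ?ip_ge0// weight_incr_ge0// ltW.
have us_num : sqn s u \is a fin_num by exact: polyfn_sqn_fin u_poly.
have gs_num : sqn s g \is a fin_num by rewrite ge0_fin_numE ?sqn_ge0.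
rewrite sqn_remainder// mulr_product_split.
apply: (nneseries_le_comb _ _ _ (r0 g) (r0 u)); rewrite ?mulr_ge0//.
- by move=> i; rewrite mulr_ge0 ?ip_ge0// weight_incr_ge0// ltW.
- move=> i; rewrite -mulr_product_split [leRHS]mulrAC [leRHS]mulrC.
  apply: ler_wpM2l; first exact: weight_incr_ge0 (ltW s0).
  exact: ip_remainder_mul u_poly gt_fin.
- by rewrite EFinM fineK//; exact: sqn_remainder_uphalf.
- by rewrite EFinM fineK//; exact: sqn_remainder_uphalf.
Qed.

(** Only through these numbers does quasi-interpolation differ from convolution with the kernel; see
    [coef_quasi_interp]. *)
Definition quad_err (X : {fset sphere}) g l (k : 'I_(Z l)) : R :=
  #|` X|%:R^-1 * (\sum_(y <- X) g y * Y k y) - coef g k.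

Lemma sobolev_mul s g u n : 0 < s -> sobolev mu Y s g -> polyfn n u ->
  (sqn tau g < +oo)%E -> sobolev mu Y s (fun x => g x * u x).
Proof.
move=> s0 [g2 gs_fin g_cont] u_poly gt_fin; split.
- have [M uM] := polyfn_bounded u_poly.
  apply: L2_mul_bounded uM => //.
  exact: continuous_sphere_measurable (polyfn_continuous u_poly).
- by apply: le_lt_trans (sqn_mul_le s0 g2 u_poly gs_fin gt_fin) _; exact: ltry.
- move=> x; apply: (@continuousM R sphere g u); first exact: g_cont.
  exact: polyfn_continuous u_poly x.
Qed.

Lemma quad_err_harm_sum (X : {fset sphere}) g L c : g \in L2 ->
  #|` X|%:R^-1 * (\sum_(y <- X) g y * harm_sum L c y)
    - \int[mu]_x (g x * harm_sum L c x) =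
  \sum_(l < L) \sum_(k < Z l) c l k * quad_err X g k.
Proof.
move=> g2; rewrite -/(ip mu g _) ipC ip_harm_sum//.
rewrite [X in _ * X](_ : _ =
    \sum_(l < L) \sum_(k < Z l) c l k * \sum_(y <- X) g y * Y k y).
  rewrite mulr_sumr -sumrB; apply: eq_bigr => l _.
  rewrite mulr_sumr -sumrB; apply: eq_bigr => k _.
  by rewrite /quad_err mulrBr mulrCA.
under eq_bigr => y _ do rewrite mulr_sumr.
rewrite exchange_big; apply: eq_bigr => l _ /=.
under eq_bigr => y _ do rewrite mulr_sumr.
rewrite exchange_big; apply: eq_bigr => k _ /=.
by rewrite mulr_sumr; apply: eq_bigr => y _; rewrite mulrCA.
Qed.

(* Duality: testing the quadrature rule on [g u], where the coefficients of [u]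
   are the weighted errors themselves, turns the bound on the error functional
   into a bound on the weighted sum of squares of the errors. *)
Lemma sum_quad_err_le s K (X : {fset sphere}) g L (m : nat -> R) (Bt Bs : R) :
  0 < s -> qmc_design mu Y s K X -> sobolev mu Y s g ->
  (sqn tau g < +oo)%E -> (forall l, 0 <= m l) ->
  (forall l, weight tau l * m l <= Bt) ->
  (forall l, weight s l * m l <= Bs) ->
  \sum_(l < L) m l * \sum_(k < Z l) quad_err X g k ^+ 2 <=
  (K * #|` X|%:R `^ (- (s / d%:R))) ^+ 2 *
  (2 * A * 2 `^ (2 * s) * (Bt * fine (sqn s g) + fine (sqn tau g) * Bs)).
Proof.
move=> s0 qmcX g_sob gt_fin m0 mBt mBs; have [g2 gs_fin g_cont] := g_sob.
set S := \sum_(l < L) _; set kap := K * _.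
pose c l (k : 'I_(Z l)) := m l * quad_err X g k.
have u_poly : polyfn L (harm_sum L c) by exact: harm_sum_polyfn.
have S0 : 0 <= S.
  apply: sumr_ge0 => l _; rewrite mulr_ge0// sumr_ge0// => k _.
  exact: sqr_ge0.
have A0 : 0 <= A by have := A_bound 0 point; rewrite big_ord0.
have := qmcX _ (sobolev_mul s0 g_sob u_poly gt_fin).
rewrite quad_err_harm_sum//.
have -> : \sum_(l < L) \sum_(k < Z l) c l k * quad_err X g k = S.
  apply: eq_bigr => l _; rewrite mulr_sumr; apply: eq_bigr => k _.
  by rewrite /c -mulrA expr2.
rewrite ger0_norm// -/kap => S_le.
(* The squared coefficients of the test function carry [m l ^+ 2]: one factor is absorbed with the
   weight into [B], the other rebuilds [S]. Hence [S ^+ 2] is at most a constant times [S], and [S]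
   is divided out. *)
have N_le t B : (forall l, weight t l * m l <= B) ->
    fine (sqn t (harm_sum L c)) <= B * S.
  move=> mB; rewrite sqn_harm_sum/= mulr_sumr; apply: ler_sum => l _.
  rewrite [X in _ * X](_ : _ = m l ^+ 2 * \sum_(k < Z l) quad_err X g k ^+ 2).
    rewrite expr2 !mulrA ler_wpM2r ?sumr_ge0// => [k _|]; first exact: sqr_ge0.
    by rewrite ler_wpM2r.
  by rewrite mulr_sumr; apply: eq_bigr => k _; rewrite exprMn.
have SS : S ^+ 2 <= kap ^+ 2 * fine (sqn s (fun x => g x * harm_sum L c x)).
  rewrite -[fine _]sqr_sqrtr ?fine_ge0 ?sqn_ge0// -exprMn.
  by rewrite lerXn2r ?nnegrE// (le_trans S0).
have [->|S_neq0] := eqVneq S 0.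
  apply: mulr_ge0; first exact: sqr_ge0.
  apply: mulr_ge0; first by rewrite mulr_ge0 ?powR_ge0// mulr_ge0.
  apply: addr_ge0; apply: mulr_ge0.
  - exact: le_trans (mulr_ge0 (weight_ge0 _ _) (m0 0)) (mBt 0).
  - by rewrite fine_ge0// sqn_ge0.
  - by rewrite fine_ge0// sqn_ge0.
  - exact: le_trans (mulr_ge0 (weight_ge0 _ _) (m0 0)) (mBs 0).
have S_gt0 : 0 < S by rewrite lt_def S_neq0.
rewrite -(ler_pM2r S_gt0) -expr2; apply: (le_trans SS).
rewrite -[leRHS]mulrA; apply: ler_wpM2l; first exact: sqr_ge0.
have gu_le := sqn_mul_le s0 g2 u_poly gs_fin gt_fin.
rewrite -lee_fin fineK; last first.
  rewrite ge0_fin_numE; last exact: sqn_ge0.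
  exact: le_lt_trans gu_le (ltry _).
apply: (le_trans gu_le); rewrite lee_fin -[leRHS]mulrA; apply: ler_wpM2l.
  by rewrite mulr_ge0 ?powR_ge0// mulr_ge0.
rewrite mulrDl; apply: lerD.
  by rewrite mulrAC ler_wpM2r ?N_le// fine_ge0// sqn_ge0.
by rewrite -mulrA ler_wpM2l ?N_le// fine_ge0// sqn_ge0.
Qed.

End Embedding.
End Basis.

(** * The embedding constant and the coefficients of the kernel *)

Section DyadicSum.
Context (R : realType) (d : nat) (tau : R).
Hypothesis tau_gt : d%:R / 2 < tau.

Let tau_ge0 : 0 <= 2 * tau.
Proof. by move: tau_gt (ler0n R d); set D := d%:R; lra. Qed.

Lemma weight_dyadic i l : (2 ^ i <= l)%N -> (2 `^ (2 * tau)) ^+ i <= weight tau l.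
Proof.
move=> il; have tau0 := tau_ge0.
rewrite -powR_mulrn ?powR_ge0// powRAC powR_mulrn// ge0_ler_powR ?nnegrE ?exprn_ge0//.
by rewrite -natrX nat1r ler_nat (leq_trans il).
Qed.

Lemma dyadic_ratio : 0 <= 2 ^+ d / 2 `^ (2 * tau) < 1.
Proof.
rewrite divr_ge0 ?exprn_ge0 ?powR_ge0//= ltr_pdivrMr ?powR_gt0// mul1r.
have -> : 2 * tau = (2 * tau - d%:R) + d%:R by rewrite subrK.
rewrite powRD; last by rewrite pnatr_eq0 implybT.
rewrite powR_mulrn// ltr_pMl ?exprn_gt0//.
have r0 : 0 < 2 * tau - d%:R by move: tau_gt; set D := d%:R; lra.
by have /(_ 1 2) := gt0_ltr_powR r0; rewrite !nnegrE powR1; apply => //; rewrite ltr1n.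
Qed.

(** On the block 2^I <= l < 2^(I+1) the inverse weight is at most 2^(-2 tau I), while the [k l] add
    up to at most 2 * 2^((I+1) d). So the blocks are dominated by 2 * 2^d * q^I, where q < 1 because
    d < 2 tau; the leading 2 of the constant is for [l = 0]. *)
Lemma dyadic_sum_bounded : exists A : R, forall k : nat -> R,
  (forall l, 0 <= k l) -> (forall L, \sum_(l < L) k l <= 2 * L%:R ^+ d) ->
  forall L, \sum_(l < L) (weight tau l)^-1 * k l <= A.
Proof.
have /andP[q0 q1] := dyadic_ratio; set q := 2 ^+ d / 2 `^ (2 * tau) in q0 q1.
exists (2 + 2 * 2 ^+ d * (1 - q)^-1) => k k0 k_le L.
have tau0 := tau_ge0.
have w_gt0 l : 0 < weight tau l by rewrite powR_gt0// ltr_pwDl.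
have term_ge0 l : 0 <= (weight tau l)^-1 * k l.
  by rewrite mulr_ge0// invr_ge0 ltW.
have dyadic I : \sum_(l < 2 ^ I) (weight tau l)^-1 * k l <=
    2 + 2 * 2 ^+ d * \sum_(i < I) q ^+ i.
  elim: I => [|I IHI].
    rewrite expn0 big_ord1 big_ord0 mulr0 addr0.
    have := k_le 1%N; rewrite big_ord1 expr1n mulr1 => k0_le.
    rewrite (le_trans _ k0_le)// ler_piMl// invf_le1// /weight.
    by rewrite addr0 powR1.
  have II : (2 ^ I <= 2 ^ I.+1)%N by rewrite leq_exp2l.
  rewrite -(big_mkord xpredT (fun l => (weight tau l)^-1 * k l)).
  rewrite (big_cat_nat _ II)//= big_mkord [X in _ <= _ + _ * X]big_ord_recr/=.
  rewrite mulrDr addrA lerD//.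
  apply: (@le_trans _ _ (((2 `^ (2 * tau)) ^+ I)^-1 * \sum_(2 ^ I <= l < 2 ^ I.+1) k l)).
    rewrite mulr_sumr; apply: ler_sum_nat => l /andP[Il _].
    rewrite ler_wpM2r// lef_pV2 ?posrE ?exprn_gt0 ?powR_gt0//.
    exact: weight_dyadic.
  apply: (@le_trans _ _ (((2 `^ (2 * tau)) ^+ I)^-1 * (2 * (2 ^ I.+1)%:R ^+ d))).
    rewrite ler_wpM2l ?invr_ge0 ?exprn_ge0 ?powR_ge0//.
    rewrite (le_trans _ (k_le _))// -(big_mkord xpredT k).
    rewrite [leRHS](big_cat_nat _ II)//= lerDr.
    by apply: sumr_ge0.
  rewrite /q expr_div_n -natrX -!exprM natrX.
  rewrite le_eqVlt; apply/orP; left; apply/eqP.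
  by rewrite natrX -!exprM mulSn exprD mulnC; field; rewrite expf_neq0// gt_eqF ?powR_gt0.
have L2 : (L <= 2 ^ L)%N by exact/ltnW/ltn_expl.
apply: (@le_trans _ _ (\sum_(l < 2 ^ L) (weight tau l)^-1 * k l)).
  rewrite (big_ord_widen _ (fun l => (weight tau l)^-1 * k l) L2).
  by rewrite big_mkcond; apply: ler_sum => l _; case: ifP.
apply: (le_trans (dyadic L)); rewrite lerD2l ler_wpM2l//.
have q1' : 0 < 1 - q by rewrite subr_gt0.
have := subrX1 q L; rewrite -(ler_pM2l q1') divff ?gt_eqF//.
have := exprn_ge0 L q0; nra.
Qed.

End DyadicSum.

Section Kernel.
Context (R : realType) (d : nat) (d_gt0 : (0 < d)%N).
Local Notation sphere := (sphere R d).
Context (mu : probability sphere R) (mu_rot : rotation_invariant mu).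
Context (Z : nat -> nat) (Y : forall l, 'I_(Z l) -> sphere -> R).
Hypothesis Y_basis : harmonic_basis mu Y.
Local Notation coef := (fourier_coef mu Y).

(** The constant of the Sobolev embedding of H^tau into bounded functions; [christoffel_le] supplies
    the cumulative bounds, uniformly in [x]. *)
Lemma embedding_bound tau : d%:R / 2 < tau -> exists A, forall L x,
  \sum_(l < L) (weight tau l)^-1 * \sum_(k < Z l) Y k x ^+ 2 <= A.
Proof.
move=> /dyadic_sum_bounded[A AE]; exists A => L x.
apply: (AE (fun l => \sum_(k < Z l) Y k x ^+ 2)) => [l|{}L].
  by apply: sumr_ge0 => k _; exact: sqr_ge0.
exact: (christoffel_le d_gt0 mu_rot Y_basis).
Qed.

Variables (tau A : R).
Hypothesis A_bound : forall L x,
  \sum_(l < L) (weight tau l)^-1 * \sum_(k < Z l) Y k x ^+ 2 <= A.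

(** Uniform in [N], [x] and [y]: this dominates the partial sums in [coef_kernel] and passes to the
    kernel itself in [ker_bounded]. *)
Lemma kernel_partial_le (a : nat -> R) B N x y :
  (forall l, `|a l| <= B * (weight tau l)^-1) ->
  `|\sum_(l < N) a l * \sum_(k < Z l) Y k x * Y k y| <= B * A.
Proof.
move=> aB; have B0 : 0 <= B.
  have := le_trans (normr_ge0 _) (aB 0%N).
  by rewrite pmulr_lge0// invr_gt0 powR_gt0// ltr_pwDl.
apply: (le_trans (ler_norm_sum _ _ _)).
apply: (@le_trans _ _ (B * (2^-1 * (\sum_(l < N) (weight tau l)^-1 * \sum_(k < Z l) Y k x ^+ 2)
   + 2^-1 * (\sum_(l < N) (weight tau l)^-1 * \sum_(k < Z l) Y k y ^+ 2)))).
  rewrite !mulr_sumr -big_split/= mulr_sumr; apply: ler_sum => l _.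
  rewrite normrM.
  have YY : `|\sum_(k < Z l) Y k x * Y k y| <=
      2^-1 * \sum_(k < Z l) Y k x ^+ 2 + 2^-1 * \sum_(k < Z l) Y k y ^+ 2.
    rewrite (le_trans (ler_norm_sum _ _ _))// !mulr_sumr -big_split/=.
    apply: ler_sum => k _; rewrite ler_norml; apply/andP; split.
      by have := sqr_ge0 (Y k x + Y k y); nra.
    by have := sqr_ge0 (Y k x - Y k y); nra.
  apply: (le_trans (ler_pM (normr_ge0 _) (normr_ge0 _) (aB l) YY)).
  by rewrite -mulrA ler_wpM2l// mulrDr lerD// mulrCA.
rewrite ler_wpM2l//; have := A_bound N x; have := A_bound N y; lra.
Qed.

(** The expansion is assumed to converge only pointwise, so the integral passes to the limit by
    dominated convergence; along the partial sums the coefficient is constant once [N > l]. *)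
Lemma coef_kernel (ker : sphere -> sphere -> R) (a : nat -> R) B y l (k : 'I_(Z l)) :
  fourier_legendre Y ker a -> (forall l, `|a l| <= B * (weight tau l)^-1) ->
  measurable_fun setT (ker ^~ y) -> coef (ker ^~ y) k = a l * Y k y.
Proof.
move=> kerE aB mker.
pose c l' (k' : 'I_(Z l')) := a l' * Y k' y.
pose f_ N x := (harm_sum Y N c x * Y k x)%:E.
have [M YM] := polyfn_bounded (Y_polyfn Y_basis k).
have f_E N x : harm_sum Y N c x =
    \sum_(l < N) a l * \sum_(k < Z l) Y k x * Y k y.
  apply: eq_bigr => l' _; rewrite mulr_sumr; apply: eq_bigr => k' _.
  by rewrite /c -mulrA [Y _ y * _]mulrC.
have mY : measurable_fun setT (Y k) by exact: L2_measurable (Y_L2 Y_basis k).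
have := @dominated_convergence _ _ _ mu setT measurableT f_
  (fun x => (ker x y * Y k x)%:E) (cst (B * A * M)%:E).
case.
- move=> N; apply/measurable_EFinP; apply: measurable_funM => //.
  exact: L2_measurable (harm_sum_L2 Y_basis N c).
- by apply/measurable_EFinP; exact: measurable_funM.
- apply: aeW => x _; apply: cvg_EFin; first exact: nearW.
  apply: cvgM; last exact: cvg_cst.
  by under eq_fun do rewrite f_E; exact: kerE.
- exact: (finite_measure_integrable_cst mu _ measurableT).
- apply: aeW => x N _; rewrite /= lee_fin normrM ler_pM// f_E.
  exact: kernel_partial_le.
move=> _ _ h.
have e : (\int[mu]_x f_ N x @[N --> \oo] --> (a l * Y k y)%:E)%E.
  apply: cvg_near_cst; exists l.+1 => // N /= lN.
  have := coef_harm_sum Y_basis N c k; rewrite lN /c => <-.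
  rewrite /fourier_coef /Rintegral fineK//.
  apply: integrable_fin_num => //; apply: L2M_integrable; last exact: Y_L2.
  exact: harm_sum_L2.
rewrite /fourier_coef /Rintegral.
by rewrite (_ : (\int[mu]_x _)%E = (a l * Y k y)%:E)//; apply: cvg_unique h e.
Qed.

End Kernel.

(** * Fill distance and cardinality *)

Section Covering.
Context (R : realType) (d : nat) (d_gt0 : (0 < d)%N).
Local Notation sphere := (sphere R d).

Lemma ler_sin_id (t : R) : 0 <= t -> sin t <= t.
Proof.
rewrite le_eqVlt => /predU1P[<-|t0]; first by rewrite sin0.
have [|c _] := @MVT R sin cos 0 t t0.
  by apply: continuous_subspaceT => x; exact: continuous_sin.
rewrite sin0 !subr0 => ->; rewrite ler_piMl ?cos_le1//; exact: ltW.
Qed.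

Lemma dotp_crd (x y : sphere) :
  dotp (sphere_val x) (sphere_val y) = \sum_i crd i x * crd i y.
Proof. by []. Qed.

Lemma sum_crdB2 (x y : sphere) :
  \sum_i (crd i x - crd i y) ^+ 2 = 2 - 2 * dotp (sphere_val x) (sphere_val y).
Proof.
rewrite (eq_bigr (fun i => crd i x ^+ 2 + crd i y ^+ 2
    + (-2) * (crd i x * crd i y))); last by move=> i _; ring.
by rewrite !big_split/= -mulr_sumr !sum_crd2 dotp_crd; ring.
Qed.

Lemma dotp_itv (x y : sphere) : -1 <= dotp (sphere_val x) (sphere_val y) <= 1.
Proof.
have p : 0 <= \sum_i (crd i x - crd i y) ^+ 2.
  by apply: sumr_ge0 => i _; exact: sqr_ge0.
have q : 0 <= \sum_i (crd i x + crd i y) ^+ 2.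
  by apply: sumr_ge0 => i _; exact: sqr_ge0.
have qE : \sum_i (crd i x + crd i y) ^+ 2 = 2 + 2 * dotp (sphere_val x) (sphere_val y).
  rewrite (eq_bigr (fun i => crd i x ^+ 2 + crd i y ^+ 2
      + 2 * (crd i x * crd i y))); last by move=> i _; ring.
  by rewrite !big_split/= -mulr_sumr !sum_crd2 dotp_crd; ring.
rewrite sum_crdB2 in p; rewrite qE in q; lra.
Qed.

Lemma geodist_ge0 (x y : sphere) : 0 <= geodist x y.
Proof. exact/acos_ge0/dotp_itv. Qed.

(** A coordinate difference is at most the chord, and the chord of an arc t has length 2 sin(t/2) <=
    t. *)
Lemma crdB_le_geodist i (x y : sphere) : `|crd i x - crd i y| <= geodist x y.
Proof.
set t := geodist x y; have t0 : 0 <= t by exact: geodist_ge0.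
have t_pi : t <= pi by exact/acos_lepi/dotp_itv.
have cost : cos t = dotp (sphere_val x) (sphere_val y).
  by rewrite /t /geodist acosK// in_itv/= dotp_itv.
rewrite -(@ler_pXn2r _ 2)// ?nnegrE// -normrX ger0_norm ?sqr_ge0//.
apply: (@le_trans _ _ (\sum_i (crd i x - crd i y) ^+ 2)).
  by rewrite (bigD1 i)//= lerDl sumr_ge0// => j _; exact: sqr_ge0.
rewrite sum_crdB2 -cost.
have tE : t = (t / 2) *+ 2 by rewrite mulr2n -splitr.
rewrite {1}tE cos_mulr2n.
have th0 : 0 <= t / 2 by rewrite divr_ge0.
have s0 : 0 <= sin (t / 2).
  rewrite sin_ge0_pi// th0/= (le_trans _ t_pi)//; lra.
have s1 := ler_sin_id th0.
have := sin2cos2 (t / 2) => s2.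
have : sin (t / 2) ^+ 2 <= (t / 2) ^+ 2 by rewrite lerXn2r ?nnegrE.
rewrite s2 expr_div_n -mulr_natl; lra.
Qed.

(** The infimum of the distances from [x] is at most the fill distance; the factor 2 makes room for
    the strict inequality that yields a point. *)
Lemma fill_distance_cover (X : {fset sphere}) (x : sphere) :
  0 < fill_distance X ->
  exists2 y, y \in X & geodist x y < 2 * fill_distance X.
Proof.
set h := fill_distance X => h_gt0.
(* For empty [X] the infima are 0 by convention, and the fill distance would be 0. *)
have [X0|[y0 y0X]] := fset_0Vmem X.
  exfalso; move: h_gt0; rewrite /h /fill_distance.
  rewrite (_ : [set _ | _ in _] = [set 0]) ?sup1 ?ltxx//.
  apply/seteqP; split => [_ [z _ <-]|_ ->] /=.
    rewrite (_ : [set _ | _ in _] = set0) ?inf0//.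
    by apply/seteqP; split => // t [y/=]; rewrite X0 inE.
  exists x => //; rewrite (_ : [set _ | _ in _] = set0) ?inf0//.
  by apply/seteqP; split => // t [y/=]; rewrite X0 inE.
pose D z := [set geodist z y | y in [set` X]].
have D_lb z : has_lbound (D z) by exists 0 => _ [y _ <-]; exact: geodist_ge0.
have D_ne z : D z !=set0 by exists (geodist z y0), y0.
have inf_le : inf (D x) <= h.
  apply: ub_le_sup; last by exists x.
  exists pi => _ [z _ <-]; apply: (@le_trans _ _ (geodist z y0)).
    by apply: (ge_inf (D_lb z)); exists y0.
  exact/acos_lepi/dotp_itv.
have : inf (D x) < 2 * h by lra.
by move=> /(inf_lt (D_ne x))[_ [y yX <-] yh]; exists y.
Qed.

(* Lifts to the sphere of a grid of mesh 5h in R^d: two of its points cannot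
   both be at distance less than 2h from the same point of X. *)
Lemma grid_le_card (X : {fset sphere}) m : 0 < fill_distance X ->
  5 * fill_distance X * m%:R * d%:R <= 1 -> (m ^ d <= #|` X|)%N.
Proof.
set h := fill_distance X => h_gt0 hm.
pose tl (v : {ffun 'I_d -> 'I_m}) (i : 'I_d) : R := 5 * h * (v i)%:R.
have tl0 v i : 0 <= tl v i by rewrite !mulr_ge0// ltW.
have d_gt0' : 0 < d%:R :> R by rewrite ltr0n.
(* With [d] coordinates of size at most 1/d the squares add up to at most 1, which leaves room for a
   first coordinate completing a unit vector. *)
have tl_le v i : tl v i <= d%:R^-1.
  rewrite -(ler_pM2r d_gt0') mulVf ?gt_eqF// (le_trans _ hm)//.
  by rewrite ler_wpM2r// ler_wpM2l ?ler_nat ?mulr_ge0 1?ltnW ?ltW.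
have sum_le v : \sum_i tl v i ^+ 2 <= 1.
  apply: (@le_trans _ _ (\sum_(i < d) d%:R^-1)).
    apply: ler_sum => i _; apply: (@le_trans _ _ (tl v i)) => //.
    rewrite expr2 ler_piMl// (le_trans (tl_le v i))// invf_le1//.
    by rewrite ler1n.
  by rewrite sumr_const card_ord -[leLHS]mulr_natr mulVf// gt_eqF.
pose pt (v : {ffun 'I_d -> 'I_m}) : 'rV[R]_d.+1 := \row_i
  if unlift ord0 i is Some j then tl v j else Num.sqrt (1 - \sum_i tl v i ^+ 2).
have ptP v : pt v \in [set x : 'rV[R]_d.+1 | enorm x = 1].
  rewrite inE/= /enorm /dotp (_ : \sum_i _ = 1) ?sqrtr1// big_ord_recl.
  rewrite !mxE unlift_none -expr2 sqr_sqrtr ?subr_ge0//.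
  rewrite [X in _ + X](eq_bigr (fun i => tl v i ^+ 2)) ?subrK// => i _.
  by rewrite !mxE liftK expr2.
pose P v : sphere := SigSub (ptP v).
have y_ex v : exists y, y \in X /\ geodist (P v) y < 2 * h.
  by have [y yX yh] := fill_distance_cover (P v) h_gt0; exists y.
have [y yP] := boolp.choice y_ex.
have y_inj : injective y.
  move=> v w yvw; apply/ffunP => i; apply/val_inj/eqP; rewrite -[_ == _]negbK.
  apply/negP => vw.
  have crdP u : crd (lift ord0 i) (P u) = 5 * h * (u i)%:R.
    by rewrite /crd /sphere_val/= mxE liftK.
  have [_ dv] := yP v; have [_ dw] := yP w; rewrite -yvw in dw.
  have := le_lt_trans (crdB_le_geodist (lift ord0 i) _ _) dv.
  have := le_lt_trans (crdB_le_geodist (lift ord0 i) _ _) dw.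
  rewrite !crdP !ltr_norml; set c := crd _ _ => /andP[w1 w2] /andP[v1 v2].
  have [vw'|wv'|/eqP] := ltngtP (v i) (w i); last by rewrite (negbTE vw).
    have : (v i)%:R + 1 <= (w i)%:R :> R by rewrite natr1 ler_nat.
    nra.
  have : (w i)%:R + 1 <= (v i)%:R :> R by rewrite natr1 ler_nat.
  nra.
have <- : #|{ffun 'I_d -> 'I_m}| = (m ^ d)%N by rewrite card_ffun !card_ord.
rewrite cardE -(size_map y); apply: (@uniq_leq_size _ _ (enum_fset X)).
  by rewrite map_inj_uniq ?enum_uniq.
by move=> _ /mapP[v _ ->]; have [] := yP v.
Qed.

(** The rate in |X| becomes a rate in h through (10 d h)^(-d) <= |X|. With z = 1/(5 h d) and m its
    integer part, m >= z/2 when m > 0, whence the 10; when m = 0 the left side is at most 1 and [X]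
    is nonempty. *)
Lemma powR_card_le (X : {fset sphere}) s : 0 < s -> 0 < fill_distance X ->
  #|` X|%:R `^ (- (s / d%:R)) <= (10 * d%:R * fill_distance X) `^ s.
Proof.
set h := fill_distance X => s0 h_gt0.
have d_gt0' : 0 < d%:R :> R by rewrite ltr0n.
have dh_gt0 : 0 < 10 * d%:R * h by rewrite !mulr_gt0.
have card_ge : (10 * d%:R * h)^-1 ^+ d <= #|` X|%:R.
  pose m := Num.truncn (5 * h * d%:R)^-1.
  have z_ge0 : 0 <= (5 * h * d%:R)^-1 by rewrite invr_ge0 !mulr_ge0// ltW.
  have /andP[m_le m_gt] := truncn_itv z_ge0; rewrite -/m in m_le m_gt.
  have zE : (10 * d%:R * h)^-1 = (5 * h * d%:R)^-1 / 2.
    by field; rewrite !gt_eqF.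
  have [m0|m_gt0] := posnP m.
    apply: (@le_trans _ _ 1).
      rewrite exprn_ile1 ?invr_ge0 ?(ltW dh_gt0)// zE.
      rewrite m0 in m_gt; move: m_gt z_ge0; set z := (_)^-1; lra.
    rewrite ler1n cardfs_gt0; apply/fset0Pn.
    by have [y yX _] := fill_distance_cover (point : sphere) h_gt0; exists y.
  have mX : (m ^ d <= #|` X|)%N.
    apply: grid_le_card => //; rewrite -/h mulrAC -ler_pdivlMl ?mulr_gt0//.
    by rewrite mulr1.
  apply: (@le_trans _ _ (m%:R ^+ d)); last by rewrite -natrX ler_nat.
  rewrite lerXn2r ?nnegrE ?invr_ge0 ?(ltW dh_gt0)// zE.
  have : 1 <= m%:R :> R by rewrite ler1n.
  move: m_gt; rewrite -natr1; set z := (_)^-1; lra.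
have X_gt0 : 0 < #|` X|%:R :> R.
  by apply: lt_le_trans card_ge; rewrite exprn_gt0 ?invr_gt0.
rewrite powRN -[leRHS]invrK lef_pV2 ?posrE ?invr_gt0 ?powR_gt0//.
have -> : ((10 * d%:R * h) `^ s)^-1 = ((10 * d%:R * h)^-1 ^+ d) `^ (s / d%:R).
  rewrite -powR_mulrn ?invr_ge0 ?(ltW dh_gt0)// -powRrM mulrCA divff ?gt_eqF//.
  have zs : (10 * d%:R * h) `^ s != 0 by rewrite gt_eqF ?powR_gt0.
  rewrite mulr1; apply: (mulfI zs); rewrite mulfV// -powRM ?invr_ge0 ?(ltW dh_gt0)//.
  by rewrite mulfV ?powR1// gt_eqF.
by rewrite ge0_ler_powR ?nnegrE ?divr_ge0 ?exprn_ge0 ?invr_ge0 ?(ltW dh_gt0) ?(ltW s0).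
Qed.

End Covering.

(** * One level of the iteration *)

Section Step.
Context (R : realType) (d : nat) (d_gt0 : (0 < d)%N).
Local Notation sphere := (sphere R d).
Context (mu : probability sphere R) (mu_rot : rotation_invariant mu).
Context (Z : nat -> nat) (Y : forall l, 'I_(Z l) -> sphere -> R).
Hypothesis Y_basis : harmonic_basis mu Y.
Local Notation L2 := (Lfun mu 2%:E).
Local Notation coef := (fourier_coef mu Y).
Local Notation sqn s f := (sobolev_sqnorm mu Y s f).
Local Notation nrm s f := (fine (sobolev_sqnorm mu Y s f)).
Local Notation energy := (degree_energy mu Y).
Implicit Types f g : sphere -> R.

Lemma weight_mono s t l : s <= t -> weight s l <= weight t l :> R.
Proof. by move=> st; rewrite ler_powR ?lerDl// ler_pM2l. Qed.

Lemma sqn_mono s t f : s <= t -> (sqn s f <= sqn t f)%E.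
Proof.
move=> st; rewrite !sqnE; apply: lee_nneseries => [l _ _|l _].
  by rewrite lee_fin mulr_ge0 ?weight_ge0 ?energy_ge0.
by rewrite lee_fin ler_wpM2r ?energy_ge0// weight_mono.
Qed.

Lemma nrm_mono s t f : s <= t -> (sqn t f < +oo)%E -> nrm s f <= nrm t f.
Proof.
move=> st ft; rewrite fine_le ?ge0_fin_numE ?sqn_ge0//; last exact: sqn_mono.
exact: le_lt_trans (sqn_mono f st) ft.
Qed.

Lemma nrm_ge0 s f : 0 <= nrm s f.
Proof. by rewrite fine_ge0// sqn_ge0. Qed.

Lemma sqn_le s f B :
  (forall L, \sum_(l < L) weight s l * energy f l <= B) -> (sqn s f <= B%:E)%E.
Proof.
move=> fB; rewrite sqnE; apply: lime_le.
  apply: is_cvg_nneseries => l _ _.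
  by rewrite lee_fin mulr_ge0 ?weight_ge0 ?energy_ge0.
by apply: nearW => L; rewrite sumEFin lee_fin big_mkord.
Qed.

Lemma nrm_le s f B :
  (forall L, \sum_(l < L) weight s l * energy f l <= B) -> nrm s f <= B.
Proof.
move=> /sqn_le fB; rewrite -lee_fin fineK// ge0_fin_numE ?sqn_ge0//.
exact: le_lt_trans fB (ltry _).
Qed.

Lemma partial_le_nrm s f L : (sqn s f < +oo)%E ->
  \sum_(l < L) weight s l * energy f l <= nrm s f.
Proof.
move=> f_fin; rewrite -lee_fin fineK ?ge0_fin_numE ?sqn_ge0// sqnE.
apply: (leq_nneseries_partial (u := fun l => weight s l * energy f l)) => l.
by rewrite mulr_ge0 ?weight_ge0 ?energy_ge0.
Qed.

Variables (tau sigma A C1 C4 C7 K rho : R) (a : nat -> R).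
Variables (ker : sphere -> sphere -> R) (X : {fset sphere}).
Hypotheses (tau_ge0 : 0 <= tau) (tau_lt : tau < sigma).
Hypothesis A_bound : forall L x,
  \sum_(l < L) (weight tau l)^-1 * \sum_(k < Z l) Y k x ^+ 2 <= A.
Hypothesis rho01 : 0 < rho < 1.
Hypothesis a_leg : fourier_legendre Y ker a.
(** The exponent is left free so that it can be matched to the weights to be absorbed; the powers of
    [1 + l%:R] then cancel exactly. *)
Hypothesis a_decay : forall l (p : R), 0 <= p <= 4 * sigma ->
  `|a l| <= C4 * (rho * (1 + l%:R)) `^ (- p).
Hypothesis a_low : forall l (p : R), 0 <= p <= sigma ->
  `|1 - a l| <= C1 * (rho * (1 + l%:R)) `^ p.
Hypothesis ker_cont : forall y, continuous (ker ^~ y).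
Hypothesis qmcX : qmc_design mu Y sigma K X.
Hypothesis card_le :
  (K * #|` X|%:R `^ (- (sigma / d%:R))) ^+ 2 <= C7 * rho `^ (4 * sigma).

Let rho_gt0 : 0 < rho. Proof. by case/andP: rho01. Qed.
Let rho_neq0 : rho != 0. Proof. by rewrite gt_eqF. Qed.
Let sigma_gt0 : 0 < sigma. Proof. exact: le_lt_trans tau_ge0 tau_lt. Qed.
Let one_l_gt0 l : 0 < 1 + l%:R :> R. Proof. by rewrite ltr_pwDl. Qed.
Let A_ge0 : 0 <= A. Proof. by have := A_bound 0 point; rewrite big_ord0. Qed.

Let C4_ge0 : 0 <= C4.
Proof.
have := le_trans (normr_ge0 _) (@a_decay 0%N 0 _).
rewrite lexx mulr_ge0 ?(ltW sigma_gt0)//= => /(_ isT).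
by rewrite pmulr_lge0// powR_gt0// mulr_gt0.
Qed.

Let ker_B := C4 * rho `^ (- (2 * tau)).

Lemma a_le_weight l : `|a l| <= ker_B * (weight tau l)^-1.
Proof.
have tau2 : 0 <= 2 * tau <= 4 * sigma by move: tau_ge0 tau_lt; lra.
apply: (le_trans (a_decay l tau2)); rewrite /ker_B powRM ?(ltW rho_gt0) ?(ltW (one_l_gt0 l))//.
by rewrite mulrA /weight (powRN (1 + _)).
Qed.

Lemma ker_bounded x y : `|ker x y| <= ker_B * A.
Proof.
have /(_ eventually_filter) kerN := cvg_norm (@a_leg x y).
rewrite -(cvg_lim (@norm_hausdorff _ _) kerN); apply: limr_le.
  by apply/cvg_ex; eexists; exact: kerN.
apply: nearW => N; apply: kernel_partial_le => //; exact: a_le_weight.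
Qed.

Lemma ker_L2 y : ker ^~ y \in L2.
Proof.
apply: (@L2_bounded _ _ _ mu _ (ker_B * A)) => [|x]; last exact: ker_bounded.
exact: continuous_sphere_measurable.
Qed.

(** Every [ker ^~ y] has coefficients [a l * Y k y], so the symbol multiplies the discrete
    coefficient of [g], which is the Fourier coefficient plus its quadrature error. *)
Lemma coef_quasi_interp g l (k : 'I_(Z l)) :
  coef (quasi_interp ker X g) k = a l * (quad_err mu Y X g k + coef g k).
Proof.
rewrite /quad_err subrK /fourier_coef /quasi_interp -/(ip mu _ _) ipZl; last first.
- exact: Y_L2.
- by apply: L2_sum => y; apply: L2Z; exact: ker_L2.
rewrite ip_suml; last 2 first.
- by move=> y; apply: L2Z; exact: ker_L2.
- exact: Y_L2.
rewrite mulrCA; congr (_ * _); rewrite mulr_sumr; apply: eq_bigr => y _.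
rewrite ipZl ?ker_L2 ?Y_L2//.
have kerE : ip mu (ker ^~ y) (Y k) = a l * Y k y.
  apply: (coef_kernel Y_basis A_bound (B := ker_B)); first exact: a_leg.
    exact: a_le_weight.
  exact: continuous_sphere_measurable.
rewrite kerE; ring.
Qed.

Lemma quasi_interp_L2 g : quasi_interp ker X g \in L2.
Proof. by apply/L2Z/L2_sum => y; apply: L2Z; exact: ker_L2. Qed.

Lemma quasi_interp_continuous g : continuous (quasi_interp ker X g).
Proof.
have sum_cont (r : seq sphere) : continuous (fun x => \sum_(y <- r) g y * ker x y).
  elim: r => [|y r IHr].
    have -> : (fun x : sphere => \sum_(y <- [::]) g y * ker x y) = cst 0.
      by apply/funext => x; rewrite big_nil.
    exact: cst_continuous.
  have -> : (fun x => \sum_(z <- y :: r) g z * ker x z) =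
      fun x => g y * ker x y + \sum_(z <- r) g z * ker x z.
    by apply/funext => x; rewrite big_cons.
  move=> x; apply: (@continuousD _ _ sphere (fun z => g y * ker z y)); last exact: IHr.
  apply: (@continuousM R sphere (cst (g y)) (ker ^~ y)); last exact: ker_cont.
  exact: cst_continuous.
move=> x; apply: (@continuousM R sphere (cst #|` X|%:R^-1)); last exact: sum_cont.
exact: cst_continuous.
Qed.

Definition residual g x : R := g x - quasi_interp ker X g x.

Lemma coef_residual g l (k : 'I_(Z l)) : g \in L2 ->
  coef (residual g) k = (1 - a l) * coef g k - a l * quad_err mu Y X g k.
Proof.
move=> g2; rewrite coefB ?quasi_interp_L2// coef_quasi_interp; ring.
Qed.

Definition err_energy g l := \sum_(k < Z l) quad_err mu Y X g k ^+ 2.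

Lemma err_energy_ge0 g l : 0 <= err_energy g l.
Proof. by apply: sumr_ge0 => k _; exact: sqr_ge0. Qed.

(** Young's inequality with a free parameter: for small [th] the convolution part keeps a factor
    near 1, and the quadrature part pays [th^-1]. *)
Lemma energy_residual_le g l th : g \in L2 -> 0 < th ->
  energy (residual g) l <= (1 + th) * ((1 - a l) ^+ 2 * energy g l)
    + (1 + th^-1) * (a l ^+ 2 * err_energy g l).
Proof.
move=> g2 th0; rewrite /degree_energy /err_energy !mulr_sumr -big_split/=.
apply: ler_sum => k _; rewrite coef_residual// -!exprMn.
set u := (1 - a l) * _; set v := a l * _.
have : 0 <= (th * u + v) ^+ 2 / th by rewrite mulr_ge0 ?sqr_ge0 ?invr_ge0 ?ltW.
rewrite (_ : (th * u + v) ^+ 2 / th = th * u ^+ 2 + 2 * u * v + th^-1 * v ^+ 2).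
  by move: u v => u v; nra.
by field; rewrite gt_eqF.
Qed.

(** The three factors come from the QMC rate in terms of [rho], the product estimate and the decay
    of the symbol. *)
Definition duality_const := C7 * (2 * A * 2 `^ (2 * sigma)) * C4 ^+ 2.

Let T_gt0 l : 0 < rho * (1 + l%:R). Proof. exact: mulr_gt0. Qed.
Let T_neq0 l : rho * (1 + l%:R) != 0. Proof. by rewrite gt_eqF. Qed.

Let weightE s l :
  weight s l = rho `^ (- (2 * s)) * (rho * (1 + l%:R)) `^ (2 * s).
Proof.
rewrite powRM ?(ltW rho_gt0) ?(ltW (one_l_gt0 l))// mulrA powRN mulVf ?mul1r//.
by rewrite gt_eqF ?powR_gt0.
Qed.

Let a_sqr_weight (s t : R) l : 0 <= s -> 0 <= t -> s + t <= 4 * sigma ->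
  weight t l * (weight s l * a l ^+ 2) <= C4 ^+ 2 * rho `^ (- (2 * (s + t))).
Proof.
move=> s0 t0 st.
have st4 : 0 <= s + t <= 4 * sigma by rewrite addr_ge0.
have := a_decay l st4; rewrite -(@ler_pXn2r _ 2) ?nnegrE ?mulr_ge0 ?powR_ge0// => h.
have -> : a l ^+ 2 = `|a l| ^+ 2 by rewrite -normrX ger0_norm ?sqr_ge0.
rewrite mulrA; apply: (le_trans (ler_wpM2l _ h)).
  by rewrite mulr_ge0 ?weight_ge0.
rewrite !weightE exprMn -[(_ `^ _) ^+ 2]powR_mulrn ?powR_ge0// -powRrM.
rewrite (_ : - (s + t) * 2 = - (2 * t) + - (2 * s)); last ring.
rewrite powRD ?T_neq0 ?implybT//.
rewrite (_ : - (2 * (s + t)) = - (2 * t) + - (2 * s)); last ring.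
rewrite [X in _ <= _ * X]powRD ?rho_neq0 ?implybT// !powRN.
have Tt := powR_gt0 (2 * t) (T_gt0 l); have Ts := powR_gt0 (2 * s) (T_gt0 l).
have rt := powR_gt0 (2 * t) rho_gt0; have rs := powR_gt0 (2 * s) rho_gt0.
move: Tt Ts rt rs; move: (_ `^ _) (_ `^ _) (_ `^ _) (_ `^ _).
move=> Tt Ts rt rs Tt0 Ts0 rt0 rs0.
rewrite le_eqVlt; apply/orP; left; apply/eqP; field.
by rewrite !gt_eqF.
Qed.

(** Duality with [m l = weight s l * a l ^+ 2]: the factor rho^(4 sigma) of the QMC rate meets the
    losses rho^(-2(s + tau)) and rho^(-2(s + sigma)). At [s = sigma] the second term has no gain
    left, but it carries only the weaker norm of [g]. *)
Lemma sum_err_energy_le g s L : 0 <= s <= sigma -> sobolev mu Y sigma g ->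
  \sum_(l < L) weight s l * (a l ^+ 2 * err_energy g l) <=
  duality_const * (rho `^ (2 * (2 * sigma - s - tau)) * nrm sigma g
        + rho `^ (2 * (sigma - s)) * nrm tau g).
Proof.
move=> /andP[s0 s_le] g_sob; have [g2 g_fin g_cont] := g_sob.
have gt_fin : (sqn tau g < +oo)%E.
  exact: le_lt_trans (sqn_mono g (ltW tau_lt)) g_fin.
have m0 l : 0 <= weight s l * a l ^+ 2 by rewrite mulr_ge0 ?weight_ge0 ?sqr_ge0.
have st1 : s + tau <= 4 * sigma by move: tau_lt sigma_gt0 s_le; lra.
have st2 : s + sigma <= 4 * sigma by move: sigma_gt0 s_le; lra.
have := @sum_quad_err_le _ _ _ _ _ Y_basis tau A A_bound sigma K X g L
  (fun l => weight s l * a l ^+ 2) (C4 ^+ 2 * rho `^ (- (2 * (s + tau))))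
  (C4 ^+ 2 * rho `^ (- (2 * (s + sigma)))) sigma_gt0 qmcX g_sob gt_fin m0
  (fun l => a_sqr_weight l s0 tau_ge0 st1)
  (fun l => a_sqr_weight l s0 (ltW sigma_gt0) st2).
under eq_bigr => l _ do rewrite -mulrA -/(err_energy g l).
move=> /le_trans; apply.
apply: (@le_trans _ _ (C7 * rho `^ (4 * sigma) * (2 * A * 2 `^ (2 * sigma) *
  (C4 ^+ 2 * rho `^ (- (2 * (s + tau))) * nrm sigma g
   + nrm tau g * (C4 ^+ 2 * rho `^ (- (2 * (s + sigma)))))))).
  apply: ler_wpM2r card_le.
  by rewrite !(mulr_ge0, addr_ge0) ?powR_ge0 ?nrm_ge0 ?sqr_ge0.
rewrite (_ : 2 * (2 * sigma - s - tau) = 4 * sigma + - (2 * (s + tau))); last ring.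
rewrite (_ : 2 * (sigma - s) = 4 * sigma + - (2 * (s + sigma))); last ring.
rewrite !(@powRD _ rho) ?rho_neq0 ?implybT//.
by rewrite le_eqVlt; apply/orP; left; apply/eqP; rewrite /duality_const; ring.
Qed.


Let rho_le1 : rho <= 1. Proof. by case/andP: rho01 => _ /ltW. Qed.

Lemma duality_const_ge0 : 0 <= duality_const.
Proof.
have C7_ge0 : 0 <= C7.
  by have := le_trans (sqr_ge0 _) card_le; rewrite pmulr_lge0// powR_gt0.
by rewrite /duality_const !mulr_ge0 ?powR_ge0 ?sqr_ge0.
Qed.

(** Young's inequality with [th = 1] doubles both parts; the quadrature part has two terms, each
    bounded by the norm of order [sigma], whence the 4. *)
Definition step_const := 2 * C1 ^+ 2 + 4 * duality_const.

Let one_minus_a_weight (s : R) l : 0 <= s <= sigma ->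
  weight s l * (1 - a l) ^+ 2 <= C1 ^+ 2 * rho `^ (2 * (sigma - s)) * weight sigma l.
Proof.
move=> /andP[s0 s_le].
have ss : 0 <= sigma - s <= sigma by move: s0 s_le; lra.
have C1_ge0 : 0 <= C1.
  have := le_trans (normr_ge0 _) (a_low l ss).
  by rewrite pmulr_lge0// powR_gt0.
have := a_low l ss; rewrite -(@ler_pXn2r _ 2) ?nnegrE ?mulr_ge0 ?powR_ge0// => h.
have -> : (1 - a l) ^+ 2 = `|1 - a l| ^+ 2 by rewrite -normrX ger0_norm ?sqr_ge0.
apply: (le_trans (ler_wpM2l (weight_ge0 s l) h)).
rewrite exprMn -[(_ `^ _) ^+ 2]powR_mulrn ?powR_ge0// -powRrM.
rewrite !weightE (_ : 2 * (sigma - s) = 2 * sigma + - (2 * s)); last ring.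
rewrite (_ : (sigma - s) * 2 = 2 * sigma + - (2 * s)); last ring.
rewrite !powRD ?rho_neq0 ?T_neq0 ?implybT// !powRN.
have Tt := powR_gt0 (2 * sigma) (T_gt0 l); have Ts := powR_gt0 (2 * s) (T_gt0 l).
have rt := powR_gt0 (2 * sigma) rho_gt0; have rs := powR_gt0 (2 * s) rho_gt0.
move: Tt Ts rt rs; move: (_ `^ _) (_ `^ _) (_ `^ _) (_ `^ _).
move=> u1 u2 u3 u4 h1 h2 h3 h4.
rewrite le_eqVlt; apply/orP; left; apply/eqP; field.
by rewrite !gt_eqF.
Qed.

(** In these lower norms the convolution part and the quadrature part gain the same power of [rho].
    The case [s = tau] feeds the recursion, and [s = 0] the final L2 estimate. *)
Lemma residual_low_le g s L : 0 <= s <= tau -> sobolev mu Y sigma g ->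
  \sum_(l < L) weight s l * energy (residual g) l <=
  step_const * rho `^ (2 * (sigma - s)) * nrm sigma g.
Proof.
move=> /andP[s0 s_le] g_sob; have [g2 g_fin g_cont] := g_sob.
have s_sigma : 0 <= s <= sigma by rewrite s0 (le_trans s_le (ltW tau_lt)).
have C_ge0 := duality_const_ge0.
apply: (@le_trans _ _ (2 * (\sum_(l < L) weight s l * (1 - a l) ^+ 2 * energy g l)
   + 2 * \sum_(l < L) weight s l * (a l ^+ 2 * err_energy g l))).
  rewrite !mulr_sumr -big_split/=; apply: ler_sum => l _.
  have := energy_residual_le l g2 (@ltr01 R); rewrite invr1 => h.
  apply: (le_trans (ler_wpM2l (weight_ge0 s l) h)).
  by rewrite le_eqVlt; apply/orP; left; apply/eqP; ring.
have T_le : \sum_(l < L) weight s l * (1 - a l) ^+ 2 * energy g l <=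
    C1 ^+ 2 * rho `^ (2 * (sigma - s)) * nrm sigma g.
  apply: (@le_trans _ _ (C1 ^+ 2 * rho `^ (2 * (sigma - s)) *
      \sum_(l < L) weight sigma l * energy g l)).
    rewrite mulr_sumr; apply: ler_sum => l _; rewrite mulrA.
    by rewrite ler_wpM2r ?energy_ge0// one_minus_a_weight.
  by rewrite ler_wpM2l ?partial_le_nrm// mulr_ge0 ?sqr_ge0 ?powR_ge0.
have D_le : \sum_(l < L) weight s l * (a l ^+ 2 * err_energy g l) <=
    2 * duality_const * rho `^ (2 * (sigma - s)) * nrm sigma g.
  apply: (le_trans (sum_err_energy_le L s_sigma g_sob)).
  have r_le : rho `^ (2 * (2 * sigma - s - tau)) <= rho `^ (2 * (sigma - s)).
    by rewrite ger_powR ?rho_gt0//; move: tau_lt; lra.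
  have n_le := nrm_mono (ltW tau_lt) g_fin.
  have h : rho `^ (2 * (2 * sigma - s - tau)) * nrm sigma g
        + rho `^ (2 * (sigma - s)) * nrm tau g <=
      rho `^ (2 * (sigma - s)) * nrm sigma g + rho `^ (2 * (sigma - s)) * nrm sigma g.
    by rewrite lerD ?ler_wpM2r ?ler_wpM2l ?nrm_ge0 ?powR_ge0.
  apply: (le_trans (ler_wpM2l C_ge0 h)).
  by rewrite le_eqVlt; apply/orP; left; apply/eqP; ring.
apply: (@le_trans _ _ (2 * (C1 ^+ 2 * rho `^ (2 * (sigma - s)) * nrm sigma g)
  + 2 * (2 * duality_const * rho `^ (2 * (sigma - s)) * nrm sigma g))).
  by rewrite lerD// ler_pM2l.
by rewrite le_eqVlt; apply/orP; left; apply/eqP; rewrite /step_const; ring.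
Qed.

(** At order [sigma] the factor [1 - a l] brings no power of [rho] and may exceed 1 in modulus; the
    weights [G] before and [G'] after the step take up the excess. *)
Lemma residual_high_le g (G G' : nat -> R) b th L : 0 < th ->
  (forall l, 0 <= G' l <= b) -> (forall l, (1 - a l) ^+ 2 * G' l <= G l) ->
  sobolev mu Y sigma g ->
  \sum_(l < L) weight sigma l * G' l * energy (residual g) l <=
  (1 + th) * (\sum_(l < L) weight sigma l * G l * energy g l)
  + (1 + th^-1) * b * duality_const *
    (rho `^ (2 * (sigma - tau)) * nrm sigma g + nrm tau g).
Proof.
move=> th0 G'b GG' g_sob; have [g2 g_fin g_cont] := g_sob.
have b0 : 0 <= b by case/andP: (G'b 0) => ? /(le_trans _); apply.
apply: (@le_trans _ _ ((1 + th) * (\sum_(l < L) weight sigma l * G l * energy g l)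
  + (1 + th^-1) * b * \sum_(l < L) weight sigma l * (a l ^+ 2 * err_energy g l))).
  rewrite !mulr_sumr -big_split/=; apply: ler_sum => l _.
  have /andP[G'0 G'_le] := G'b l.
  have h := energy_residual_le l g2 th0.
  have w0 : 0 <= weight sigma l * G' l by rewrite mulr_ge0 ?weight_ge0.
  apply: (le_trans (ler_wpM2l w0 h)); rewrite mulrDr; apply: lerD.
    rewrite mulrCA; apply: ler_wpM2l; first by rewrite addr_ge0// ltW.
    rewrite -2!mulrA; apply: ler_wpM2l; first exact: weight_ge0.
    by rewrite mulrCA mulrA ler_wpM2r ?energy_ge0.
  rewrite mulrCA -[leRHS]mulrA; apply: ler_wpM2l.
    by rewrite addr_ge0// invr_ge0 ltW.
  rewrite mulrAC mulrC; apply: ler_wpM2r => //.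
  by rewrite mulr_ge0 ?weight_ge0// mulr_ge0 ?sqr_ge0 ?err_energy_ge0.
rewrite lerD2l -[leRHS]mulrA; apply: ler_wpM2l.
  by rewrite mulr_ge0// addr_ge0// invr_ge0 ltW.
have ss : 0 <= sigma <= sigma by rewrite lexx ltW.
have := sum_err_energy_le L ss g_sob; rewrite subrr mulr0 powRr0 mul1r.
by rewrite (_ : 2 * sigma - sigma - tau = sigma - tau)//; ring.
Qed.

Lemma residual_sobolev g : sobolev mu Y sigma g -> sobolev mu Y sigma (residual g).
Proof.
move=> g_sob; have [g2 g_fin g_cont] := g_sob; split.
- by apply: L2B => //; exact: quasi_interp_L2.
(* Only finiteness matters here, so [th = 1], [G' = 1] and [G = (1 - a)^2] are good enough. *)
- apply: (@le_lt_trans _ _ ((1 + 1) * (C1 ^+ 2 * nrm sigma g) +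
    (1 + 1^-1) * 1 * duality_const *
    (rho `^ (2 * (sigma - tau)) * nrm sigma g + nrm tau g))%:E); last exact: ltry.
  apply: sqn_le => L.
  have G'b (l : nat) : 0 <= (1 : R) <= 1 by rewrite ler01 lexx.
  have GG' l : (1 - a l) ^+ 2 * 1 <= (1 - a l) ^+ 2 by rewrite mulr1.
  have := residual_high_le (G' := fun=> 1) L (@ltr01 R) G'b GG' g_sob.
  under eq_bigr => l _ do rewrite mulr1.
  move=> /le_trans; apply; rewrite lerD2r ler_wpM2l ?addr_ge0//.
  apply: (@le_trans _ _ (\sum_(l < L) C1 ^+ 2 * (weight sigma l * energy g l))).
    apply: ler_sum => l _; rewrite mulrA ler_wpM2r ?energy_ge0//.
    have ss : 0 <= sigma <= sigma by rewrite lexx ltW.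
    have := one_minus_a_weight l ss.
    by rewrite subrr mulr0 powRr0 mulr1.
  by rewrite -mulr_sumr; apply: ler_wpM2l (partial_le_nrm L g_fin); exact: sqr_ge0.
- move=> x; apply: (@continuousB _ _ sphere g); first exact: g_cont.
  exact: quasi_interp_continuous.
Qed.

Lemma ip_residual_le g : sobolev mu Y sigma g ->
  ip mu (residual g) (residual g) <= step_const * rho `^ (2 * sigma) * nrm sigma g.
Proof.
move=> g_sob; have [r2 _ _] := residual_sobolev g_sob.
rewrite -lee_fin -(parseval Y_basis r2).
rewrite (eq_eseriesr (g := fun l => (weight 0 l * energy (residual g) l)%:E)); last first.
  by move=> l _; rewrite /weight mulr0 powRr0 mul1r.
rewrite -sqnE; apply: sqn_le => L.
by have := @residual_low_le g 0 L; rewrite lexx tau_ge0 subr0; apply.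
Qed.

End Step.

(** * The kernel and its symbol *)

Section ZonalKernel.
Context (R : realType) (d : nat) (mu : probability (sphere R d) R).
Local Notation sphere := (sphere R d).

Lemma enormB_continuous (y : sphere) :
  continuous (fun x : sphere => enorm (sphere_val x - sphere_val y)).
Proof.
have p_poly : polyfn 2 (fun x => \sum_i (crd i x - crd i y) * (crd i x - crd i y)).
  have lin i : polyfn 1 (fun x => crd i x - crd i y).
    apply: polyfnD; last exact: polyfn_cstn.
    rewrite (_ : crd i = fun x => crd i x * 1).
      exact/polyfn_crd/polyfn_cst.
    by apply/funext => x; rewrite mulr1.
  by apply: polyfn_sum => i _; exact: (polyfnM (lin i) (lin i)).
move=> x; apply: (@continuous_comp sphere R R _ Num.sqrt); last first.
  exact: sqrt_continuous.
have p_cont := polyfn_continuous p_poly; move: (p_cont x).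
rewrite (_ : (fun x => \sum_i _) = (fun z : sphere =>
  dotp (sphere_val z - sphere_val y) (sphere_val z - sphere_val y))) //.
by apply/funext => z; apply: eq_bigr => i _; rewrite !mxE.
Qed.

Lemma zonal_kernel_continuous (phi : R -> R) rho (y : sphere) :
  {within `[0, +oo[, continuous phi} -> 0 < rho ->
  continuous (zonal_kernel mu phi rho ^~ y).
Proof.
move=> phi_cont rho_gt0 x.
pose t z := rho^-1 * enorm (sphere_val z - sphere_val y).
have t_ge0 z : 0 <= t z by rewrite mulr_ge0 ?invr_ge0 ?(ltW rho_gt0)// sqrtr_ge0.
have t_cont : continuous t.
  move=> z; apply: (@continuousM R sphere (cst rho^-1)).
    exact: cst_continuous.
  exact: enormB_continuous.
apply: (@continuousM R sphere (cst (zonal_mass mu phi rho y)^-1) (phi \o t)).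
  exact: cst_continuous.
have tx : t x \in `[0, +oo[ by rewrite in_itv/= t_ge0.
have /subspace_continuousP/(_ (t x) tx) phi_x := phi_cont.
move=> A /phi_x W.
(* [phi] is continuous only within the half-line, but [t] never leaves it. *)
have W' : nbhs (t x) [set u | 0 <= u -> A (phi u)].
  have W1 : nbhs (t x) [set u | u \in `[0, +oo[ -> A (phi u)] := W.
  by apply: filterS W1 => u uA u0; apply: uA; rewrite in_itv/= u0.
apply: (@filterS _ (nbhs x) (nbhs_filter x) _ _ _ (t_cont x _ W')) => z /=.
by apply.
Qed.

End ZonalKernel.

Section Symbol.
Context (R : realType) (sigma c1 c3 c4 : R).
Hypotheses (sigma_gt0 : 0 < sigma) (c1_gt0 : 0 < c1) (c3_gt0 : 0 < c3).
Hypothesis c4_gt0 : 0 < c4.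

Definition admissible rho (a : nat -> R) :=
  [/\ 0 < rho < 1,
      forall l : nat, l%:Z <= Num.floor (rho^-1 - 1) ->
        `|1 - a l| <= c1 * l%:R `^ sigma * rho `^ sigma
    & forall l : nat, (0 < l)%N ->
        c3 * (1 + rho * l%:R) `^ (- (4 * sigma)) <= a l
          <= c4 * (1 + rho * l%:R) `^ (- (4 * sigma))].

Variables (rho : R) (a : nat -> R).
Hypothesis a_adm : admissible rho a.

Let rho01 : 0 < rho < 1. Proof. by case: a_adm. Qed.
Let rho_gt0 : 0 < rho. Proof. by case/andP: rho01. Qed.
Let one_l_gt0 l : 0 < 1 + l%:R :> R. Proof. by rewrite ltr_pwDl. Qed.
Let T l := rho * (1 + l%:R).
Let T_gt0 l : 0 < T l. Proof. exact: mulr_gt0. Qed.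

(** [T l <= 1] means [l <= rho^-1 - 1], the range of the low-degree assumption; it also allows
    lowering the exponent from [sigma] to [p]. *)
Lemma symbol_low l p : T l <= 1 -> 0 <= p <= sigma -> `|1 - a l| <= c1 * T l `^ p.
Proof.
move=> T1 /andP[p0 p_le]; have [_ a_low _] := a_adm.
have l_le : l%:Z <= Num.floor (rho^-1 - 1).
  rewrite floor_ge_int lerBrDl -(ler_pM2l rho_gt0) divff ?gt_eqF//.
apply: (le_trans (a_low l l_le)); rewrite -mulrA; apply: ler_wpM2l; first exact: ltW.
rewrite -powRM ?(ltW rho_gt0)//.
apply: (@le_trans _ _ (T l `^ sigma)); last first.
  by rewrite ger_powR// T_gt0.
rewrite ge0_ler_powR ?nnegrE ?mulr_ge0 ?(ltW sigma_gt0) ?(ltW rho_gt0) ?(ltW (T_gt0 l))//.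
by rewrite mulrC /T ler_pM2l// lerDr.
Qed.

(** Degree 0 lies in the low range as [rho < 1], and the bound vanishes there because
    [sigma > 0]. *)
Lemma symbol0 : a 0%N = 1.
Proof.
have [/andP[_ rho1] a_low _] := a_adm.
have h : (0 : int) <= Num.floor (rho^-1 - 1).
  by rewrite floor_ge_int subr_ge0 invf_ge1// ltW.
have := a_low 0%N h; rewrite powR0 ?gt_eqF// mulr0 mul0r normr_le0 subr_eq0.
by move/eqP.
Qed.

Lemma symbol_ge0 l : 0 <= a l.
Proof.
case: l => [|l]; first by rewrite symbol0.
have [_ _ /(_ l.+1 isT)/andP[+ _]] := a_adm; apply: le_trans.
by rewrite mulr_ge0 ?powR_ge0// ltW.
Qed.

Lemma symbol_le l p : (0 < l)%N -> 0 <= p <= 4 * sigma -> a l <= c4 * T l `^ (- p).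
Proof.
move=> l_gt0 /andP[p0 p_le]; have [_ _ /(_ l l_gt0)/andP[_ h]] := a_adm.
have /andP[_ rho1] := rho01.
apply: (le_trans h); apply: ler_wpM2l; first exact: ltW.
have rl : 0 <= rho * l%:R by rewrite mulr_ge0// ltW.
apply: (@le_trans _ _ ((1 + rho * l%:R) `^ (- p))).
  by rewrite ler_powR ?lerDl// lerN2.
rewrite !powRN lef_pV2 ?posrE ?powR_gt0//; last by rewrite ltr_pwDl.
rewrite ge0_ler_powR ?nnegrE ?(ltW (T_gt0 l)) ?addr_ge0//.
by rewrite /T mulrDr mulr1 lerD2r ltW.
Qed.

(** The 1 in [1 + c4] covers [l = 0], where the decay assumption is silent but the symbol is 1 and
    [rho < 1]. *)
Lemma symbol_decay l p : 0 <= p <= 4 * sigma ->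
  `|a l| <= (1 + c4) * T l `^ (- p).
Proof.
move=> p_itv; rewrite ger0_norm ?symbol_ge0//.
case: l => [|l]; last first.
  apply: (le_trans (symbol_le (ltn0Sn l) p_itv)).
  by rewrite ler_wpM2r ?powR_ge0// lerDr.
have /andP[p0 _] := p_itv; have /andP[_ rho1] := rho01.
rewrite symbol0 /T addr0 mulr1.
have h : 1 <= rho `^ (- p).
  by rewrite -(powRr0 rho) ger_powR ?rho_gt0 ?(ltW rho1)// oppr_le0.
have := ltW c4_gt0; nra.
Qed.

Lemma symbol_le_cst l : a l <= 1 + c4.
Proof.
have h : 0 <= (0 : R) <= 4 * sigma by rewrite lexx mulr_ge0// ltW.
have := symbol_decay l h; rewrite oppr0 powRr0 mulr1.
exact: le_trans (ler_norm _).
Qed.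

Lemma symbol_error l p : 0 <= p <= sigma ->
  `|1 - a l| <= (2 + c1 + c4) * T l `^ p.
Proof.
move=> p_itv; have T0 := powR_ge0 (T l) p.
have [T1|T1] := leP (T l) 1.
  apply: (le_trans (symbol_low T1 p_itv)); rewrite ler_wpM2r//.
  by have := ltW c4_gt0; lra.
have h : 1 <= T l `^ p.
  by have /andP[p0 _] := p_itv; rewrite -(powRr0 (T l)) ler_powR// ltW.
apply: (@le_trans _ _ (2 + c1 + c4)); last first.
  by rewrite ler_peMr// !addr_ge0// ltW.
have := symbol_ge0 l; have := symbol_le_cst l; have := ltW c1_gt0.
by rewrite ler_norml => ? ? ?; apply/andP; split; lra.
Qed.

Let a0 := (1 + c1) `^ (- sigma^-1).
Let b0 := (1 + c4) `^ (4 * sigma)^-1.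

(** Origin of the window: [T l <= a0] makes the low-degree bound at most [c1 / (1 + c1)], and
    [b0 <= T l] puts the symbol between 0 and [c4 / (1 + c4)]. *)
Lemma symbol_contraction_out l : T l <= a0 \/ b0 <= T l -> `|1 - a l| <= 1.
Proof.
have s4 : 0 < 4 * sigma by rewrite mulr_gt0.
have a0_le1 : a0 <= 1.
  by rewrite /a0 -[leRHS](powRr0 (1 + c1)) ler_powR ?lerDl ?oppr_le0 ?invr_ge0 ?ltW.
have b0_ge1 : 1 <= b0.
  by rewrite /b0 -[leLHS](powRr0 (1 + c4)) ler_powR ?lerDl ?invr_ge0 ?ltW.
case=> [T_le|T_ge].
  have ss : 0 <= sigma <= sigma by rewrite lexx ltW.
  apply: (le_trans (symbol_low (le_trans T_le a0_le1) ss)).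
  have : T l `^ sigma <= (1 + c1)^-1.
    apply: (@le_trans _ _ (a0 `^ sigma)).
      by rewrite ge0_ler_powR ?nnegrE ?(ltW sigma_gt0) ?(ltW (T_gt0 l)) ?powR_ge0.
    rewrite /a0 -powRrM mulNr mulVf ?gt_eqF// powR_inv1//.
    by rewrite addr_ge0// ltW.
  move=> h; apply: (le_trans (ler_wpM2l (ltW c1_gt0) h)).
  by rewrite ler_pdivrMr ?addr_gt0// mul1r lerDr.
have l_gt0 : (0 < l)%N.
  case: l T_ge => [|//]; rewrite /T addr0 mulr1 => rho_ge.
  have /andP[_ rho1] := rho01.
  by have := lt_le_trans rho1 (le_trans b0_ge1 rho_ge); rewrite ltxx.
have ss : 0 <= 4 * sigma <= 4 * sigma by rewrite lexx ltW.
have a_le := symbol_le l_gt0 ss; have a_ge := symbol_ge0 l.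
have : T l `^ (- (4 * sigma)) <= (1 + c4)^-1.
  rewrite powRN lef_pV2 ?posrE ?powR_gt0 ?addr_gt0//.
  apply: (@le_trans _ _ (b0 `^ (4 * sigma))).
    by rewrite /b0 -powRrM mulVf ?gt_eqF// powRr1// addr_ge0// ltW.
  by rewrite ge0_ler_powR ?nnegrE ?(ltW s4) ?(ltW (T_gt0 l)) ?powR_ge0.
move=> h; have := le_trans a_le (ler_wpM2l (ltW c4_gt0) h).
have : c4 / (1 + c4) <= 1 by rewrite ler_pdivrMr ?addr_gt0// mul1r lerDr.
by move=> h1 h2; rewrite ler_norml; apply/andP; split; lra.
Qed.

End Symbol.

(* |1 - a l| exceeds 1 only when t = rho (1 + l) lies in a fixed window [a0, b0],
   where it is at most M. The weight G compensates the loss: it is a power of t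
   on the window and constant outside of it, so that it gains a factor M^2 when
   t decreases by the factor r from one level to the next. *)
Lemma contraction_weight (R : realType) (sigma c1 c3 c4 r : R) :
  0 < sigma -> 0 < c1 -> 0 < c3 -> 0 < c4 -> 0 < r < 1 ->
  exists G : R -> R, exists glo ghi : R,
    [/\ 0 < glo, forall t, glo <= G t <= ghi &
        forall rho a, admissible sigma c1 c3 c4 rho a -> forall l t,
          t <= r * (rho * (1 + l%:R)) ->
          (1 - a l) ^+ 2 * G t <= G (rho * (1 + l%:R))].
Proof.
move=> sigma_gt0 c1_gt0 c3_gt0 c4_gt0 /andP[r0 r1].
pose a0 := (1 + c1) `^ (- sigma^-1); pose b0 := (1 + c4) `^ (4 * sigma)^-1.
pose M := 2 + c1 + c4; have M_gt1 : 1 < M by rewrite /M; lra.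
have a0_gt0 : 0 < a0 by rewrite powR_gt0// addr_gt0.
have b0_gt0 : 0 < b0 by rewrite powR_gt0// addr_gt0.
have M2_gt0 : 0 < M ^+ 2 by rewrite exprn_gt0//; lra.
have lnr : ln r < 0 by rewrite ln_lt0// r0.
have lnM : 0 < ln (M ^+ 2) by rewrite ln_gt0// exprn_egt1.
(* Chosen so that r^p = M^(-2): shrinking the argument by [r] pays for the worst factor M^2. *)
pose p := ln (M ^+ 2) / - ln r.
have p_gt0 : 0 < p by rewrite divr_gt0// oppr_gt0.
have rp : r `^ p = (M ^+ 2)^-1.
  rewrite /powR gt_eqF// /p -mulrA invrN mulNr mulVf ?lt_eqF// mulrN1 expRN.
  by rewrite lnK.
(* The lower end is [a0 * r], not [a0]: for [T > a0] it stays below [r * T], so clamping does not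
   spoil the shrinking. The inner [max] keeps the interval nonempty. *)
pose clamp t := Num.max (a0 * r) (Num.min t (Num.max b0 (a0 * r))).
have clamp_ge t : a0 * r <= clamp t by rewrite le_max lexx.
have clamp_le t : clamp t <= Num.max b0 (a0 * r).
  by rewrite ge_max le_max lexx orbT/= ge_min lexx orbT.
have ar_gt0 : 0 < a0 * r by rewrite mulr_gt0.
have clamp_gt0 t : 0 < clamp t by exact: lt_le_trans (clamp_ge t).
have clamp_mono t u : t <= u -> clamp t <= clamp u.
  by move=> tu; rewrite /clamp; apply: le_max2 => //; apply: le_min2.
have powR_mono u v : 0 <= u -> u <= v -> u `^ p <= v `^ p.
  move=> u0 uv; apply: (ge0_ler_powR (ltW p_gt0)) => //; rewrite nnegrE//.
  exact: le_trans uv.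
exists (fun t => clamp t `^ p), ((a0 * r) `^ p), (Num.max b0 (a0 * r) `^ p).
split=> [|t|rho a a_adm l t t_le]; first exact: powR_gt0.
  have hi_ge0 : 0 <= Num.max b0 (a0 * r) by rewrite le_max (ltW b0_gt0).
  have clamp_ge0 := ltW (clamp_gt0 t).
  by apply/andP; split; apply: powR_mono => //; exact: ltW.
have T_gt0 : 0 < rho * (1 + l%:R).
  by case: a_adm => /andP[rho0 _] _ _; rewrite mulr_gt0// ltr_pwDl.
set T := rho * (1 + l%:R) in t_le T_gt0 *.
have tT : t <= T by rewrite (le_trans t_le)// ler_piMl ?ltW.
have out : T <= a0 \/ b0 <= T -> (1 - a l) ^+ 2 * clamp t `^ p <= clamp T `^ p.
  move=> /(symbol_contraction_out sigma_gt0 c1_gt0 c3_gt0 c4_gt0 a_adm) h.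
  have h2 : (1 - a l) ^+ 2 <= 1 by rewrite -[leLHS]ger0_norm ?sqr_ge0// normrX
    -[leRHS](expr1n _ 2) lerXn2r ?nnegrE.
  apply: (@le_trans _ _ (clamp t `^ p)); first by rewrite ler_piMl ?powR_ge0.
  by apply: powR_mono; [exact: ltW|exact: clamp_mono].
have [Ta|Ta] := leP T a0; first by apply: out; left.
have [Tb|Tb] := leP b0 T; first by apply: out; right.
have clampT : clamp T = T.
  rewrite /clamp; have -> : Num.min T (Num.max b0 (a0 * r)) = T.
    by apply/min_idPl; rewrite le_max ltW.
  by apply/max_idPr; apply: le_trans (ltW Ta); rewrite ler_piMr ?ltW.
have clampt : clamp t <= r * T.
  by rewrite ge_max ge_min t_le andbT mulrC ler_pM2l// ltW.
have M_le : (1 - a l) ^+ 2 <= M ^+ 2.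
  have ss : 0 <= (0 : R) <= sigma by rewrite lexx ltW.
  have := symbol_error sigma_gt0 c1_gt0 c3_gt0 c4_gt0 a_adm l ss.
  rewrite powRr0 mulr1 => h.
  by rewrite -[leLHS]ger0_norm ?sqr_ge0// normrX lerXn2r ?nnegrE// /M; lra.
apply: (@le_trans _ _ (M ^+ 2 * (r * T) `^ p)).
  apply: ler_pM; rewrite ?sqr_ge0 ?powR_ge0//.
  by apply: powR_mono => //; exact: ltW.
by rewrite powRM ?(ltW r0) ?(ltW T_gt0)// rp mulrA divff ?gt_eqF// mul1r clampT.
Qed.

(** * The recursion over the levels *)

Section Recursion.
Context (R : realType).

Definition growth (C q : R) k := \prod_(i < k) (1 + C * q ^+ i).

Lemma growth_ge1 C q k : 0 <= C -> 0 <= q -> 1 <= growth C q k.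
Proof.
move=> C0 q0; rewrite /growth; elim/big_rec: _ => // i x _ x1.
by rewrite mulr_ege1// lerDl mulr_ge0 ?exprn_ge0.
Qed.

(** From 1 + x <= exp x and the geometric series; the absence of [k] on the right is what makes the
    final constant independent of the number of levels. *)
Lemma growth_le C q k : 0 <= C -> 0 <= q < 1 -> growth C q k <= expR (C / (1 - q)).
Proof.
move=> C0 /andP[q0 q1].
apply: (@le_trans _ _ (expR (C * \sum_(i < k) q ^+ i))).
  rewrite mulr_sumr /growth; elim: k => [|k IHk].
    by rewrite !big_ord0 expR0.
  rewrite !big_ord_recr/= expRD ler_pM//.
  - by rewrite (le_trans ler01)// growth_ge1.
  - by rewrite addr_ge0// mulr_ge0 ?exprn_ge0.
  - exact: expR_ge1Dx.
rewrite ler_expR ler_wpM2l//.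
have q1' : 0 < 1 - q by rewrite subr_gt0.
have := subrX1 q k; rewrite -(ler_pM2l q1') divff ?gt_eqF//.
by have := exprn_ge0 k q0; nra.
Qed.

(** The leading 1 serves the case of no step; [2 * ghi + 4 * ghi * D] bounds the first step, the
    exponential all later growth, and [/ glo] returns from the weighted energy to the norm. *)
Definition recursion_const (D S glo ghi q : R) :=
  1 + (2 * ghi + 4 * ghi * D) *
      expR ((1 + 2 * ghi * D * (1 + S) / glo) / (1 - q)) / glo.

(* x j bounds from above a weighted Sobolev energy of the j-th error, ns and nt
   are its squared norms in H^sigma and in H^tau. *)
Lemma recursion_bounded (m : nat) (x : nat -> nat -> R) (ns nt theta : nat -> R)
    (D S glo ghi q : R) :
  0 <= D -> 0 <= S -> 0 < glo -> glo <= ghi -> 0 <= q < 1 ->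
  (forall j, 0 <= ns j) -> (forall L, x 0%N L <= ghi * ns 0%N) ->
  nt 0%N <= ns 0%N ->
  (forall j, (j < m)%N -> forall th L, 0 < th -> x j.+1 L <= (1 + th) * x j L +
     (1 + th^-1) * ghi * D * (theta j.+1 ^+ 2 * ns j + nt j)) ->
  (forall j, (j < m)%N -> nt j.+1 <= S * theta j.+1 ^+ 2 * ns j) ->
  (forall j B, (j <= m)%N -> (forall L, x j L <= B) -> ns j <= B / glo) ->
  (forall j, (j < m)%N -> 0 < theta j.+1 <= q ^+ j) ->
  (forall j, (j.+1 < m)%N -> theta j.+2 <= theta j.+1) ->
  ns m <= recursion_const D S glo ghi q * ns 0%N.
Proof.
move=> D0 S0 glo0 glohi /andP[q0 q1] ns0 x0 nt0 xS ntS nsx thq thS.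
set N := ns 0%N in x0 nt0 *; have N0 : 0 <= N by exact: ns0.
pose C := 1 + 2 * ghi * D * (1 + S) / glo; pose P1 := 2 * ghi + 4 * ghi * D.
have ghi0 : 0 < ghi by exact: lt_le_trans glohi.
have C0 : 0 <= C by rewrite addr_ge0// divr_ge0 ?(ltW glo0)// !mulr_ge0 ?addr_ge0// ltW.
have P10 : 0 <= P1 by rewrite addr_ge0 ?mulr_ge0// ltW.
pose P k := P1 * growth C q k.
have g1 k : 1 <= growth C q k by exact: growth_ge1.
have PS k : P k.+1 = P k * (1 + C * q ^+ k).
  by rewrite /P /growth big_ord_recr/= mulrA.
have P_ge k : 0 <= P k by rewrite mulr_ge0// (le_trans ler01).
have P_mono k : P k <= P k.+1.
  by rewrite PS ler_peMr// lerDl mulr_ge0 ?exprn_ge0.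
have claim j : (j < m)%N -> (forall L, x j.+1 L <= P j * N) /\
    nt j.+1 <= S * theta j.+1 ^+ 2 * (P j * N / glo).
  elim: j => [|j IHj] jm.
    have /andP[th0 th1] := thq 0%N jm; rewrite expr0 in th1.
    have th2 : theta 1%N ^+ 2 <= 1 by rewrite exprn_ile1// ltW.
    split=> [L|].
      (* At the first level no earlier gain in H^tau is available, so [th = 1] is used once, at the
         price of a constant. *)
      have := xS 0%N jm 1 L ltr01; rewrite invr1 => /le_trans; apply.
      rewrite /P /growth big_ord0 mulr1 /P1.
      have h1 := x0 L.
      have h2 : theta 1%N ^+ 2 * N + nt 0%N <= 2 * N.
        by have := ler_wpM2r N0 th2; rewrite mul1r; lra.
      have gD : 0 <= ghi * D by rewrite mulr_ge0// ltW.
      rewrite -/N; have := ler_wpM2l gD h2; lra.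
    apply: (le_trans (ntS 0%N jm)); apply: ler_wpM2l.
      by rewrite mulr_ge0 ?sqr_ge0.
    rewrite -/N ler_pdivlMr// mulrC ler_wpM2r// /P /growth big_ord0 mulr1.
    apply: (le_trans glohi); rewrite /P1.
    have gD : 0 <= ghi * D by rewrite mulr_ge0// ltW.
    lra.
  have [IHx IHt] := IHj (ltnW jm).
  have nsj : ns j.+1 <= P j * N / glo by apply: nsx => //; exact: ltnW.
  have /andP[th0 thqj] := thq j (ltnW jm).
  have th_le := thS j jm; have /andP[th'0 _] := thq j.+1 jm.
  set th := theta j.+1 in IHt th0 thqj th_le *.
  have th2 : theta j.+2 ^+ 2 <= th ^+ 2 by rewrite lerXn2r ?nnegrE// ltW.
  set B := P j * N in IHx IHt nsj; have B0 : 0 <= B by rewrite mulr_ge0.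
  have Bg0 : 0 <= B / glo by rewrite divr_ge0// ltW.
  split=> [L|].
    (* Young's parameter is the gain of the previous level: the perturbation is quadratic in [th],
       the factor [1 + th^-1] makes it linear, and the step costs [1 + C * th]. *)
    apply: (le_trans (xS j.+1 jm th L th0)).
    have e1 : (1 + th) * x j.+1 L <= (1 + th) * B.
      by rewrite ler_wpM2l// addr_ge0// ltW.
    have e2 : theta j.+2 ^+ 2 * ns j.+1 + nt j.+1 <= th ^+ 2 * (1 + S) * (B / glo).
      rewrite mulrDr mulr1 mulrDl; apply: lerD; first by rewrite ler_pM ?sqr_ge0.
      by rewrite (mulrC _ S).
    have th_le1 : th <= 1 by rewrite (le_trans thqj)// exprn_ile1// ltW.
    have e3 : (1 + th^-1) * th ^+ 2 <= 2 * th.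
      rewrite mulrDl mul1r expr2 mulrA mulVf ?gt_eqF// mul1r mulr_natl mulr2n lerD2r.
      by rewrite ler_piMl// ltW.
    have gD : 0 <= (1 + th^-1) * ghi * D.
      by rewrite !mulr_ge0 ?addr_ge0 ?invr_ge0// ltW.
    apply: (le_trans (lerD e1 (ler_wpM2l gD e2))).
    have gDS : 0 <= ghi * D * (1 + S) * (B / glo).
      apply: mulr_ge0 Bg0; rewrite mulr_ge0 ?addr_ge0//.
      by rewrite mulr_ge0// ltW.
    have e4 : (1 + th^-1) * ghi * D * (th ^+ 2 * (1 + S) * (B / glo)) <=
        2 * th * (ghi * D * (1 + S) * (B / glo)).
      rewrite (_ : _ * _ = (1 + th^-1) * th ^+ 2 * (ghi * D * (1 + S) * (B / glo))).
        exact: ler_wpM2r gDS _ _ e3.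
      by ring.
    apply: (le_trans (lerD (lexx _) e4)).
    rewrite PS [leRHS]mulrAC -/B.
    have -> : (1 + th) * B + 2 * th * (ghi * D * (1 + S) * (B / glo)) = B * (1 + C * th).
      by rewrite /C; ring.
    by rewrite ler_wpM2l// lerD2l ler_wpM2l.
  apply: (le_trans (ntS j.+1 jm)).
  apply: ler_wpM2l; first by rewrite mulr_ge0 ?sqr_ge0.
  apply: (le_trans nsj); rewrite ler_wpM2r ?invr_ge0 ?(ltW glo0)//.
  by rewrite ler_wpM2r.
rewrite /recursion_const -/C -/P1; move: m nsx claim {xS ntS thq thS} => [|m] nsx claim.
  rewrite -/N ler_peMl// lerDl divr_ge0 ?(ltW glo0)// mulr_ge0// expR_ge0.
have [xm _] := claim m (ltnSn m).
apply: (le_trans (nsx m.+1 _ (leqnn _) xm)).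
rewrite mulrAC ler_wpM2r//; set e := expR _.
have Pm : P m <= P1 * e by rewrite ler_wpM2l// growth_le// q0.
apply: (@le_trans _ _ (P1 * e / glo)); last by rewrite lerDr.
by rewrite ler_wpM2r// invr_ge0 ltW.
Qed.

End Recursion.

(** As [nu > 1], the fill distance is at most the square of the scale, so h^(2 sigma) is at most
    rho^(4 sigma). *)
Lemma card_scale_le (R : realType) (d : nat) (d_gt0 : (0 < d)%N)
    (X : {fset sphere R d}) (K nu sigma : R) :
  0 < K -> 1 < nu -> 0 < sigma -> 0 < fill_distance X ->
  (K * #|` X|%:R `^ (- (sigma / d%:R))) ^+ 2 <=
  (K * (10 * d%:R) `^ sigma) ^+ 2 *
    (nu * Num.sqrt (fill_distance X)) `^ (4 * sigma).
Proof.
move=> K0 nu1 sigma0 h0; set h := fill_distance X in h0 *.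
set rho := nu * Num.sqrt h.
have rho0 : 0 <= rho by rewrite mulr_ge0 ?sqrtr_ge0//; lra.
have h_le : h <= rho ^+ 2.
  rewrite exprMn sqr_sqrtr ?(ltW h0)// ler_peMl ?(ltW h0)//.
  by rewrite exprn_ege1// ltW.
have d0 : 0 <= 10 * d%:R :> R by rewrite mulr_ge0.
rewrite (_ : 4 * sigma = 2 * sigma * 2); last ring.
rewrite (powRrM rho) powR_mulrn ?powR_ge0// -exprMn.
rewrite lerXn2r ?nnegrE ?mulr_ge0 ?powR_ge0 ?(ltW K0)//.
rewrite -mulrA ler_pM2l//.
apply: (le_trans (powR_card_le d_gt0 sigma0 h0)); rewrite -/h.
rewrite powRM ?(ltW h0)// ler_wpM2l ?powR_ge0// powRrM powR_mulrn//.
by rewrite ge0_ler_powR ?nnegrE ?(ltW sigma0) ?(ltW h0) ?exprn_ge0.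
Qed.

Lemma multilevel_residual (R : realType) (d : nat)
    (Q : nat -> (sphere R d -> R) -> sphere R d -> R) f n :
  f \- multilevel_approx Q f n = (multilevel Q f n).2.
Proof.
rewrite /multilevel_approx; elim: n => [|n IHn] /=.
  by apply/funext => x /=; rewrite subr0.
case: (multilevel Q f n) IHn => Mf Ef /= IHn; rewrite -IHn.
by apply/funext => x /=; rewrite opprD addrA.
Qed.

Theorem theorem3p7 (R : realType) (d : nat) (d_gt0 : (0 < d)%N)
  (mu : probability (sphere R d) R) (mu_rot : rotation_invariant mu)
  (Z : nat -> nat) (Y : forall l, 'I_(Z l) -> sphere R d -> R)
  (Y_basis : harmonic_basis mu Y)
  (sigma : R) (sigma_gt : d%:R / 2 < sigma)
  (phi : R -> R) (phi_cont : {within `[0, +oo[, continuous phi})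
  (phi_infty : cvg (phi x @[x --> +oo]))
  (rho0 : R) (rho0_gt0 : 0 < rho0) (rho0_lt1 : rho0 < 1)
  (phihat : R -> nat -> R)
  (phihatE : forall rho : R, 0 < rho < rho0 ->
     fourier_legendre Y (zonal_kernel mu phi rho) (phihat rho))
  (c1 c2 c3 c4 : R) (c1_gt0 : 0 < c1) (c2_gt0 : 0 < c2)
  (c3_gt0 : 0 < c3) (c3_le_c4 : c3 <= c4)
  (phihat_low : forall (rho : R) (l : nat), 0 < rho < rho0 ->
     l%:Z <= Num.floor (rho^-1 - 1) ->
     `|1 - phihat rho l| <= c1 * l%:R `^ sigma * rho `^ sigma)
  (phihat_high : forall (rho : R) (l : nat), 0 < rho < rho0 ->
     Num.floor (rho^-1 - 1) < l%:Z -> phihat rho l <= c2)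
  (phihat_decay : forall (rho : R) (l : nat), 0 < rho < rho0 -> (0 < l)%N ->
     c3 * (1 + rho * l%:R) `^ (- (4 * sigma)) <= phihat rho l
       <= c4 * (1 + rho * l%:R) `^ (- (4 * sigma)))
  (delta cdelta : R) (delta_gt0 : 0 < delta) (delta_lt1 : delta < 1)
  (cdelta_gt0 : 0 < cdelta) (cdelta_le1 : cdelta <= 1)
  (nu : R) (nu_gt1 : 1 < nu)
  (K cq cX : R) (K_gt0 : 0 < K) (cq_ge1 : 1 <= cq) (cX_gt0 : 0 < cX) :
  exists2 C : R, 0 < C &
    forall (n : nat) (X : nat -> {fset sphere R d}),
      (0 < n)%N ->
      (forall j, (1 <= j <= n)%N -> qmc_design mu Y sigma K (X j)) ->
      (forall j, (1 <= j <= n)%N -> quasi_uniform cq cX (X j)) ->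
      (forall j, (1 <= j < n)%N ->
         cdelta * delta * fill_distance (X j) <= fill_distance (X j.+1)
           <= delta * fill_distance (X j)) ->
      (forall j, (1 <= j <= n)%N -> 0 < scale nu X j < rho0) ->
      forall f : sphere R d -> R, sobolev mu Y sigma f ->
        let Q j := quasi_interp (zonal_kernel mu phi (scale nu X j)) (X j) in
        let beta := (1 + nu `^ (- (2 * sigma))) * delta `^ (sigma / 2) in
        (Lnorm mu 2%:E (EFin \o (f \- multilevel_approx Q f n)%R)
         <= (C * fill_distance (X 1%N) `^ (sigma / 2) * beta ^+ n.-1
             * sobolev_norm mu Y sigma f)%:E)%E.
Proof.
have c4_gt0 : 0 < c4 by exact: lt_le_trans c3_le_c4.
have d2 : 0 < d%:R / 2 :> R by rewrite divr_gt0 ?ltr0n.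
have sigma_gt0 : 0 < sigma by exact: lt_trans sigma_gt.
(* Any order strictly between d/2 and [sigma] would do. *)
pose tau := (d%:R / 2 + sigma) / 2.
have tau_gt : d%:R / 2 < tau by rewrite midf_lt.
have tau_lt : tau < sigma by rewrite midf_lt.
have tau_ge0 : 0 <= tau by rewrite ltW// (lt_trans d2).
have [A A_bound] := embedding_bound d_gt0 mu_rot Y_basis tau_gt.
have A_ge0 : 0 <= A by have := A_bound 0%N point; rewrite big_ord0.
pose C1 := 2 + c1 + c4; pose C4 := 1 + c4.
pose C7 := (K * (10 * d%:R) `^ sigma) ^+ 2.
pose D := duality_const sigma A C4 C7; pose S := step_const sigma A C1 C4 C7.
have D_ge0 : 0 <= D.
  apply: mulr_ge0; last exact: sqr_ge0.
  apply: mulr_ge0; first exact: sqr_ge0.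
  by rewrite mulr_ge0 ?powR_ge0// mulr_ge0.
have S_ge0 : 0 <= S.
  by apply: addr_ge0; apply: mulr_ge0 => //; exact: sqr_ge0.
(* Bound for the ratio of consecutive scales, which are proportional to the square roots of the fill
   distances. *)
pose r := Num.sqrt delta.
have r01 : 0 < r < 1 by rewrite sqrtr_gt0 delta_gt0/= -sqrtr1 ltr_sqrt.
have /andP[r_gt0 r_lt1] := r01.
have [G [glo [ghi [glo_gt0 G_itv G_contr]]]] :=
  contraction_weight sigma_gt0 c1_gt0 c3_gt0 c4_gt0 r01.
have glo_ghi : glo <= ghi by case/andP: (G_itv 0); exact: le_trans.
pose q := r `^ (sigma - tau).
have eps_gt0 : 0 < sigma - tau by rewrite subr_gt0.
have q01 : 0 <= q < 1.
  rewrite powR_ge0/=.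
  have /(_ r 1) := gt0_ltr_powR eps_gt0; rewrite powR1 !nnegrE.
  by apply => //; exact: ltW.
pose Rc := recursion_const D S glo ghi q.
have Rc_ge0 : 0 <= Rc.
  have ghi_ge0 : 0 <= ghi by rewrite (le_trans (ltW glo_gt0)).
  apply: addr_ge0 => //; apply: divr_ge0; last exact: ltW.
  apply: mulr_ge0; last exact: expR_ge0.
  by apply: addr_ge0; [exact: mulr_ge0|apply: mulr_ge0 => //; exact: mulr_ge0].
(* [S] comes from the last L2 step, [Rc] from the recursion before it, the power of [nu] from the
   last scale; the 1 ensures positivity. *)
exists (Num.sqrt (S * Rc) * nu `^ sigma + 1).
  by rewrite ltr_wpDl// mulr_ge0 ?sqrtr_ge0 ?powR_ge0.
move=> n X n_gt0 qmcX _ hX scaleX f f_sob.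
set Q := fun j => _; set beta := _ * _; cbv zeta.
pose h j := fill_distance (X j); pose rho := scale nu X.
pose E j := (multilevel Q f j).2.
have ES j : E j.+1 = residual (zonal_kernel mu phi (rho j.+1)) (X j.+1) (E j).
  by rewrite /E /=; case: (multilevel Q f j).
have rho_adm j : (1 <= j <= n)%N ->
    admissible sigma c1 c3 c4 (rho j) (phihat (rho j)).
  move=> /scaleX rho_itv; split.
  - by case/andP: rho_itv => -> /= /lt_trans; apply.
  - by move=> l; exact: phihat_low.
  - by move=> l; exact: phihat_decay.
have nu_gt0 : 0 < nu by exact: lt_trans nu_gt1.
(* The covering estimate needs positive fill distances; positivity of the scales provides them. *)
have h_gt0 j : (1 <= j <= n)%N -> 0 < h j.
  move=> /scaleX/andP[+ _]; rewrite /scale pmulr_rgt0// sqrtr_gt0.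
  exact.
have step j : (j < n)%N -> sobolev mu Y sigma (E j) ->
  [/\ sobolev mu Y sigma (E j.+1),
      forall L s, 0 <= s <= tau ->
        \sum_(l < L) weight s l * degree_energy mu Y (E j.+1) l <=
        S * rho j.+1 `^ (2 * (sigma - s)) * fine (sobolev_sqnorm mu Y sigma (E j)),
      forall L (g g' : nat -> R) th, 0 < th -> (forall l, 0 <= g' l <= ghi) ->
        (forall l, (1 - phihat (rho j.+1) l) ^+ 2 * g' l <= g l) ->
        \sum_(l < L) weight sigma l * g' l * degree_energy mu Y (E j.+1) l <=
        (1 + th) * \sum_(l < L) weight sigma l * g l * degree_energy mu Y (E j) l +
        (1 + th^-1) * ghi * D *
        (rho j.+1 `^ (2 * (sigma - tau)) * fine (sobolev_sqnorm mu Y sigma (E j)) +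
         fine (sobolev_sqnorm mu Y tau (E j)))
    & ip mu (E j.+1) (E j.+1) <= S * rho j.+1 `^ (2 * sigma) *
        fine (sobolev_sqnorm mu Y sigma (E j))].
  move=> jn E_sob; have jn' : (1 <= j.+1 <= n)%N by [].
  have adm := rho_adm _ jn'.
  have rho01 : 0 < rho j.+1 < 1 by case: adm.
  have leg := phihatE _ (scaleX _ jn').
  have decay l p := @symbol_decay _ _ _ _ _ sigma_gt0 c3_gt0 c4_gt0 _ _ adm l p.
  have err l p := @symbol_error _ _ _ _ _ sigma_gt0 c1_gt0 c3_gt0 c4_gt0 _ _ adm l p.
  have rho_gt0 : 0 < rho j.+1 by case/andP: rho01.
  have ker_cont y : continuous (zonal_kernel mu phi (rho j.+1) ^~ y).
    exact: zonal_kernel_continuous.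
  have card_le := card_scale_le d_gt0 K_gt0 nu_gt1 sigma_gt0 (h_gt0 _ jn').
  have qmc := qmcX _ jn'.
  rewrite ES; split.
  - exact: (residual_sobolev Y_basis tau_ge0 tau_lt A_bound rho01 leg decay err
      ker_cont qmc card_le).
  - move=> L s s_itv.
    exact: (residual_low_le Y_basis tau_ge0 tau_lt A_bound rho01 leg decay err
      ker_cont qmc card_le).
  - move=> L g g' th th0 g'b gg'.
    exact: (residual_high_le Y_basis tau_ge0 tau_lt A_bound rho01 leg decay
      ker_cont qmc card_le).
  - exact: (ip_residual_le Y_basis tau_ge0 tau_lt A_bound rho01 leg decay err
      ker_cont qmc card_le).
have E_sob j : (j <= n)%N -> sobolev mu Y sigma (E j).
  by elim: j => [//|j IHj] jn; have [] := step j jn (IHj (ltnW jn)).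
have E_fin j : (j <= n)%N -> (sobolev_sqnorm mu Y sigma (E j) < +oo)%E.
  by move=> /E_sob[].
have rho_gt0 j : (1 <= j <= n)%N -> 0 < rho j by move=> /scaleX/andP[].
have rho_step j : (1 <= j < n)%N -> rho j.+1 <= r * rho j.
  move=> /hX/andP[_ h_le]; rewrite /rho /scale mulrCA ler_pM2l//.
  by rewrite /r -sqrtrM ?(ltW delta_gt0)// ler_wsqrtr.
pose theta j := rho j `^ (sigma - tau).
have theta_gt0 j : (1 <= j <= n)%N -> 0 < theta j.
  by move=> /rho_gt0; exact: powR_gt0.
have theta_step j : (1 <= j < n)%N -> theta j.+1 <= q * theta j.
  move=> jn; have /andP[j1 jn'] := jn.
  have rj : 0 < rho j by apply: rho_gt0; rewrite j1 ltnW.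
  rewrite /theta /q -powRM ?(ltW r_gt0) ?(ltW rj)//.
  apply: (ge0_ler_powR (ltW eps_gt0)); rewrite ?nnegrE ?rho_step//.
    by rewrite ltW// rho_gt0.
  by rewrite mulr_ge0// ltW.
have /andP[q_ge0 q_lt1] := q01.
have theta_le j : (j < n)%N -> theta j.+1 <= q ^+ j.
  elim: j => [|j IHj] jn.
    rewrite expr0 /theta; have /rho_adm[/andP[r0 r1] _ _] : (1 <= 1 <= n)%N by [].
    rewrite -(powRr0 (rho 1%N)) ger_powR ?r0 ?(ltW r1)//; exact: ltW.
  apply: (le_trans (theta_step j.+1 jn)); rewrite exprS ler_wpM2l//.
  exact/IHj/ltnW.
have theta2 j : rho j `^ (2 * (sigma - tau)) = theta j ^+ 2.
  by rewrite mulrC powRrM powR_mulrn ?powR_ge0.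
have nrm_E : fine (sobolev_sqnorm mu Y sigma (E n.-1)) <=
    Rc * fine (sobolev_sqnorm mu Y sigma f).
  have n1 j : (j < n.-1)%N -> (j.+1 < n)%N by rewrite -ltnS prednK.
  (* The error of level [j] is weighted at the scale of level [j.+1], the one about to act on it.
     The recursion stops at [n.-1], level [n] being kept for the L2 gain. *)
  pose x j L := \sum_(l < L)
    weight sigma l * G (rho j.+1 * (1 + l%:R)) * degree_energy mu Y (E j) l.
  pose ns j := fine (sobolev_sqnorm mu Y sigma (E j)).
  pose nt j := fine (sobolev_sqnorm mu Y tau (E j)).
  have ns0 j : 0 <= ns j by exact: nrm_ge0.
  have x0 L : x 0%N L <= ghi * ns 0%N.
    apply: (@le_trans _ _
        (ghi * \sum_(l < L) weight sigma l * degree_energy mu Y (E 0%N) l)).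
      rewrite mulr_sumr; apply: ler_sum => l _; rewrite mulrA.
      apply: ler_wpM2r; first exact: energy_ge0.
      rewrite mulrC; apply: ler_wpM2r; first exact: weight_ge0.
      by case/andP: (G_itv (rho 1%N * (1 + l%:R))).
    apply: ler_wpM2l; first exact: le_trans (ltW glo_gt0) glo_ghi.
    by apply: partial_le_nrm; exact: E_fin.
  have nt0 : nt 0%N <= ns 0%N.
    by apply: nrm_mono; [exact: ltW|exact: E_fin].
  have xS j : (j < n.-1)%N -> forall th L, 0 < th ->
      x j.+1 L <= (1 + th) * x j L +
        (1 + th^-1) * ghi * D * (theta j.+1 ^+ 2 * ns j + nt j).
    move=> /n1 jn th L th0.
    have [_ _ high _] := step j (ltnW jn) (E_sob j (ltnW (ltnW jn))).
    rewrite -theta2; apply: (high L (fun l => G (rho j.+1 * (1 + l%:R)))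
      (fun l => G (rho j.+2 * (1 + l%:R))) th th0) => l.
      have /andP[g1 g2] := G_itv (rho j.+2 * (1 + l%:R)).
      by rewrite g2 (le_trans (ltW glo_gt0)).
    apply: G_contr; first by apply: rho_adm; exact: ltnW.
    by rewrite mulrA ler_wpM2r ?rho_step ?addr_ge0.
  have ntS j : (j < n.-1)%N -> nt j.+1 <= S * theta j.+1 ^+ 2 * ns j.
    move=> /n1 jn.
    have [_ low _ _] := step j (ltnW jn) (E_sob j (ltnW (ltnW jn))).
    rewrite -theta2; apply: nrm_le => L.
    by apply: low; rewrite tau_ge0 lexx.
  have nsx j B : (j <= n.-1)%N -> (forall L, x j L <= B) -> ns j <= B / glo.
    move=> jn xB; apply: nrm_le => L.
    rewrite ler_pdivlMr//; apply: (le_trans _ (xB L)); rewrite mulr_suml.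
    apply: ler_sum => l _; rewrite mulrAC.
    apply: ler_wpM2r; first exact: energy_ge0.
    apply: ler_wpM2l; first exact: weight_ge0.
    by case/andP: (G_itv (rho j.+1 * (1 + l%:R))).
  have thq j : (j < n.-1)%N -> 0 < theta j.+1 <= q ^+ j.
    by move=> /n1 jn; rewrite theta_gt0 ?theta_le//; exact: ltnW.
  have thS j : (j.+1 < n.-1)%N -> theta j.+2 <= theta j.+1.
    move=> /n1 jn; apply: (le_trans (theta_step j.+1 (ltnW jn))).
    rewrite ler_piMl ?(ltW q_lt1)//; apply: ltW; apply: theta_gt0.
    exact: (ltnW (ltnW jn)).
  exact: (@recursion_bounded _ n.-1 x ns nt theta D S glo ghi q D_ge0 S_ge0
    glo_gt0 glo_ghi q01 ns0 x0 nt0 xS ntS nsx thq thS).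
have ipE : ip mu (E n) (E n) <=
    S * rho n `^ (2 * sigma) * fine (sobolev_sqnorm mu Y sigma (E n.-1)).
  have n1n : (n.-1 < n)%N by rewrite prednK.
  have [_ _ _] := step n.-1 n1n (E_sob _ (leq_pred n)).
  by rewrite prednK.
have h_le j : (j < n)%N -> h j.+1 <= delta ^+ j * h 1%N.
  elim: j => [|j IHj] jn; first by rewrite expr0 mul1r.
  have /andP[_ hj] := hX j.+1 jn.
  by rewrite exprS -mulrA (le_trans hj)// ler_pM2l// IHj// ltnW.
have [En2 _ _] := E_sob n (leqnn n).
rewrite multilevel_residual -/(E n) (Lnorm2E En2) lee_fin.
have N_ge0 : 0 <= fine (sobolev_sqnorm mu Y sigma f) by exact: nrm_ge0.
have sqrt_ip : Num.sqrt (ip mu (E n) (E n)) <=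
    Num.sqrt (S * Rc) * rho n `^ sigma * sobolev_norm mu Y sigma f.
  have rn2 : rho n `^ (2 * sigma) = (rho n `^ sigma) ^+ 2.
    by rewrite mulrC powRrM powR_mulrn ?powR_ge0.
  rewrite /sobolev_norm -[rho n `^ sigma]ger0_norm ?powR_ge0// -sqrtr_sqr.
  have SRr : 0 <= S * Rc by exact: mulr_ge0.
  rewrite -!sqrtrM//; last by apply: mulr_ge0 => //; exact: sqr_ge0.
  apply: ler_wsqrtr; apply: (le_trans ipE).
  have Sr : 0 <= S * rho n `^ (2 * sigma) by rewrite mulr_ge0 ?powR_ge0.
  apply: (le_trans (ler_wpM2l Sr nrm_E)).
  by rewrite rn2 le_eqVlt; apply/orP; left; apply/eqP; ring.
apply: (le_trans sqrt_ip).
have rho_n : rho n `^ sigma <=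
    nu `^ sigma * (h 1%N `^ (sigma / 2) * beta ^+ n.-1).
  rewrite /rho /scale powRM ?sqrtr_ge0 ?(ltW nu_gt0)//.
  apply: ler_wpM2l; first exact: powR_ge0.
  have hn0 : 0 < h n by apply: h_gt0; rewrite n_gt0 leqnn.
  have h10 : 0 < h 1%N by exact: h_gt0.
  rewrite -/(h n) -powR12_sqrt ?(ltW hn0)// -powRrM (mulrC _ sigma).
  have hn_le : h n <= delta ^+ n.-1 * h 1%N.
    by have := h_le n.-1; rewrite prednK//; exact.
  have s2 : 0 <= sigma / 2 by rewrite divr_ge0// ltW.
  apply: (@le_trans _ _ ((delta ^+ n.-1 * h 1%N) `^ (sigma / 2))).
    apply: (ge0_ler_powR s2) => //; rewrite nnegrE ?(ltW hn0)//.
    by rewrite mulr_ge0 ?exprn_ge0 ?(ltW h10) ?(ltW delta_gt0).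
  rewrite powRM ?exprn_ge0 ?(ltW h10) ?(ltW delta_gt0)// mulrC.
  apply: ler_wpM2l; first exact: powR_ge0.
  rewrite -powR_mulrn ?(ltW delta_gt0)// powRAC powR_mulrn ?powR_ge0//.
  rewrite lerXn2r ?nnegrE ?powR_ge0//.
    by rewrite /beta mulr_ge0 ?addr_ge0 ?powR_ge0.
  (* The factor C_nu of [beta] is at least 1. *)
  by rewrite /beta ler_peMl ?powR_ge0// lerDl powR_ge0.
have s0 := sqrtr_ge0 (S * Rc).
have b0 : 0 <= h 1%N `^ (sigma / 2) * beta ^+ n.-1.
  by rewrite mulr_ge0 ?powR_ge0// exprn_ge0// mulr_ge0 ?addr_ge0 ?powR_ge0.
apply: ler_wpM2r; first exact: sqrtr_ge0.
apply: (le_trans (ler_wpM2l s0 rho_n)).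
by rewrite [leLHS]mulrA -[leRHS]mulrA; apply: (ler_wpM2r b0); rewrite lerDl.
Qed.
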